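(* Let $G=\mathrm{Alt}(n)$ or $G=\mathrm{Sym}(n)$. Suppose $V\in\mathbf{Mod}(G,d,q)$ is faithful and dc-irreducible with $d<n$. Assume $n\ge 7$; if $G=\mathrm{Alt}(n)$ and $q=2$, further assume that $n\ge 10$. Then there is a dim-connected submodule $L\le V$ (a submodule in the universe of $V$, not required to be $G$-invariant) such that one of the following holds: (1) $q>0$, $q\mid n$, $d=n-2$, and $V$ is isomorphic, as a $G$-module, to $\overline{\mathrm{std}}(n,L)$ or to $\mathrm{sgn}\otimes\overline{\mathrm{std}}(n,L)$; (2) $q>0$, $q\nmid n$, $d=n-1$, and $V$ is isomorphic, as a $G$-module, to $\overline{\mathrm{std}}(n,L)$ or to $\mathrm{sgn}\otimes\overline{\mathrm{std}}(n,L)$; (3) $q=0$, $d=n-1$, and $V$ is covered by $\mathrm{std}(n,L)$ or by $\mathrm{sgn}\otimes\mathrm{std}(n,L)$, i.e. there is a surjective morphism of $G$-modules from one of these onto $V$. Moreover, when $q=0$, the kernel of the covering map is $\left\langle\sum_{i=1}^{n-1}(e_i-e_n)\right\rangle\otimes K$ for some $K\le\Omega_n(L)$.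
   Context: **Modular universe.** A modular universe is a subcategory $\mathcal U$ of the category of abelian groups such that: (inverses) if $f\in\mathrm{Ar}(\mathcal U)$ is an isomorphism, then $f^{-1}\in\mathrm{Ar}(\mathcal U)$; (products) if $V_1,V_2\in\mathrm{Ob}(\mathcal U)$ and $f_1,f_2\in\mathrm{Ar}(\mathcal U)$, then $V_1\times V_2\in\mathrm{Ob}(\mathcal U)$ and $\mathrm{Ar}(\mathcal U)$ contains $f_1\times f_2$, the projections $V_1\times V_2\to V_i$ and the diagonal embeddings $V_1\to V_1^k$; (sections) if $W\le V$ are both in $\mathrm{Ob}(\mathcal U)$, then $V/W\in\mathrm{Ob}(\mathcal U)$ and the inclusion $W\to V$ and quotient map $V\to V/W$ are in $\mathrm{Ar}(\mathcal U)$; (kernels/images) if $f:V_1\to V_2$ is in $\mathrm{Ar}(\mathcal U)$, then the algebraic kernel and image $\ker f,\operatorname{im}f$ are in $\mathrm{Ob}(\mathcal U)$, and for $W_1,W_2\in\mathrm{Ob}(\mathcal U)$, if $W_1\le\ker f$ the induced map $V_1/W_1\to V_2$ is in $\mathrm{Ar}(\mathcal U)$, and if $\operatorname{im}f\le W_2\le V_2$ the induced map $V_1\to W_2$ is in $\mathrm{Ar}(\mathcal U)$; (module structure) for $V\in\mathrm{Ob}(\mathcal U)$, the sum map $V\times V\to V$ and the multiplication-by-$k$ maps $V\to V$ ($k\in\mathbb Z$) are in $\mathrm{Ar}(\mathcal U)$. Objects of $\mathcal U$ are called modules, arrows compatible morphisms; a submodule of a module $V$ is a subgroup of $V$ that is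 an object of $\mathcal U$. If a group $G$ acts on $V$ by compatible morphisms, $V$ is called a $G$-module (the universe is left implicit). **Additive dimension.** An additive dimension on $\mathcal U$ is a function $\dim:\mathrm{Ob}(\mathcal U)\to\mathbb N$ with $\dim V=\dim\ker f+\dim\operatorname{im}f$ for all $f:V\to W$ in $\mathrm{Ar}(\mathcal U)$. A module with an additive dimension is an object of a modular universe equipped with an additive dimension. It is dim-connected if every proper submodule $W<V$ in $\mathcal U$ satisfies $\dim W<\dim V$. **Characteristic.** $V$ has characteristic $p$ ($p$ prime) if it has exponent $p$, and characteristic $0$ if it is divisible. **Classes.** $\mathbf{Mod}(G,d,q)$ is the class of all dim-connected $G$-modules with an additive dimension (in any modular universe) of dimension exactly $d$ and of characteristic $q$ ($q$ a prime or $0$). $V\in\mathbf{Mod}(G,d,q)$ is dc-irreducible if it has no non-trivial, proper, dim-connected $G$-submodule. **Standard modules.** Let $S=\mathrm{Sym}(n)$, and let $\mathrm{perm}(n,\mathbb Z)=\mathbb Ze_1\oplus\cdots\oplus\mathbb Ze_n$ with $S$ permuting the $e_i$ naturally; $\mathrm{std}(n,\mathbb Z)=\{\sum_i c_ie_i:c_i\in\mathbb Z,\ \sum c_i=0\}$. For an abelian group $L$ (regarded as a trivial $S$-module), $\mathrm{perm}(n,L)=\mathrm{perm}(n,\mathbb Z)\otimes_{\mathbb Z}L$, $\mathrm{std}(n,L)=\mathrm{std}(n,\mathbb Z)\otimes_{\mathbb Z}L$, and $\overline{\mathrm{std}}(n,L)=\mathrm{std}(n,L)/C_{\mathrm{std}(n,L)}(S)$,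 where $C_{\mathrm{std}(n,L)}(S)$ is the subgroup of $S$-fixed elements. These are regarded as $\mathrm{Alt}(n)$-modules by restriction. $\mathrm{sgn}\otimes M$ denotes $M$ with the action twisted by the signature. $\Omega_n(L)$ is the subgroup of elements $\ell\in L$ with $n\ell=0$. *)

(* Defs.v *)
From HB Require Import structures.
From mathcomp Require Import all_boot all_order all_algebra.
From mathcomp Require Import all_fingroup all_solvable.
From mathcomp Require Import generic_quotient ring_quotient.
From mathcomp Require Import boolp.
From mathcomp Require Import freeg.

Set Implicit Arguments.
Unset Strict Implicit.
Unset Printing Implicit Defensive.

Import GRing.Theory.
Local Open Scope ring_scope.
Local Open Scope quotient_scope.

(* A concrete abelian group is a subgroup V : zmodClosed A of an ambient      *)
(* A : zmodType, so that W <= V is literal inclusion of subsets of A, and     *)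
(* V / W is literally a set of W-cosets, for all V containing W at once.      *)

Definition mksub (A : zmodType) (P : pred A) (HP : zmod_closed P) :
    zmodClosed A :=
  HB.pack_for (zmodClosed A) P (GRing.isZmodClosed.Build A P HP).

Section Generated.
Variables (A : zmodType) (P : A -> Prop).

Definition gensub_mem : pred A :=
  [pred x | `[< forall S : zmodClosed A, (forall y, P y -> y \in S) -> x \in S >]].

Lemma gensub_closed : zmod_closed gensub_mem.
Proof.
split=> [|x y]; first by apply/asboolP => S _; exact: rpred0.
move=> /asboolP Hx /asboolP Hy; apply/asboolP => S HS.
by rewrite rpredB ?Hx ?Hy.
Qed.
Definition gensub : zmodClosed A := mksub gensub_closed.

Lemma mem_gensub x : P x -> x \in gensub.
Proof. by move=> Px; apply/asboolP => S; apply. Qed.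

End Generated.

Section ProductSubgroup.
Variables (A1 A2 : zmodType) (V1 : zmodClosed A1) (V2 : zmodClosed A2).

Definition prodsub_mem : pred (A1 * A2)%type :=
  [pred x | (x.1 \in V1) && (x.2 \in V2)].

Lemma prodsub_closed : zmod_closed prodsub_mem.
Proof.
split=> [|x y]; first by rewrite inE /= !rpred0.
by rewrite !inE /= => /andP[? ?] /andP[? ?]; rewrite !rpredB.
Qed.
Definition prodsub : zmodClosed (A1 * A2)%type := mksub prodsub_closed.

End ProductSubgroup.

(* powZ A k is A^(k+1), and likewise for powsub and diag.                     *)
Fixpoint powZ (A : zmodType) (k : nat) : zmodType :=
  if k is k'.+1 then (A * powZ A k')%type else A.

Fixpoint powsub (A : zmodType) (V : zmodClosed A) (k : nat) :
    zmodClosed (powZ A k) :=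
  match k return zmodClosed (powZ A k) with
  | 0%N => V
  | k'.+1 => prodsub V (powsub V k')
  end.

Fixpoint diag (A : zmodType) (k : nat) (x : A) : powZ A k :=
  match k return powZ A k with
  | 0%N => x
  | k'.+1 => (x, diag k' x)
  end.

Notation quotZ W := (Quotient.quot W).

Section QuotientSubgroup.
Variables (A : zmodType) (V W : zmodClosed A).

Definition quotsub_mem : pred (quotZ W) :=
  [pred y | `[< exists2 x : A, x \in V & y = \pi_(quotZ W) x >]].

Lemma quotsub_closed : zmod_closed quotsub_mem.
Proof.
split=> [|_ _ /asboolP[x Vx ->] /asboolP[y Vy ->]]; apply/asboolP.
  by exists 0; rewrite ?rpred0 // raddf0.
by exists (x - y); rewrite ?rpredB // raddfB.
Qed.
Definition quotsub : zmodClosed (quotZ W) := mksub quotsub_closed.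

End QuotientSubgroup.

Section SubgroupType.
Variables (A : zmodType) (V : zmodClosed A).

Definition subZ := {x : A | x \in V}.

HB.instance Definition _ := SubChoice.on subZ.
HB.instance Definition _ := [SubChoice_isSubZmodule of subZ by <:].

End SubgroupType.

Section KernelImage.
Variables (A B : zmodType) (V : zmodClosed A) (f : A -> B).

Definition is_kernel (K : zmodClosed A) :=
  forall x, x \in K <-> x \in V /\ f x = 0.

Definition is_image (I : zmodClosed B) :=
  forall y, y \in I <-> exists2 x, x \in V & y = f x.

End KernelImage.

(* An arrow V -> W is given by any function between the ambient groups whose  *)
(* restriction to V is that arrow: its values outside V are irrelevant        *)
(* (mu_ext).                                                                  *)

Record modular_universe := ModularUniverse {
  Ob : forall A : zmodType, zmodClosed A -> Prop;
  Ar : forall A B : zmodType, zmodClosed A -> zmodClosed B -> (A -> B) -> Prop;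
  mu_arrow : forall (A B : zmodType) (V : zmodClosed A) (W : zmodClosed B) f,
    Ar V W f ->
    [/\ Ob V, Ob W, {in V, forall x, f x \in W}
      & {in V &, {morph f : x y / x + y}}];
  mu_ext : forall (A B : zmodType) (V : zmodClosed A) (W : zmodClosed B) f g,
    {in V, f =1 g} -> Ar V W f -> Ar V W g;
  mu_id : forall (A : zmodType) (V : zmodClosed A), Ob V -> Ar V V id;
  mu_comp : forall (A B C : zmodType) (V : zmodClosed A) (W : zmodClosed B)
      (X : zmodClosed C) f g,
    Ar V W f -> Ar W X g -> Ar V X (g \o f);
  mu_inv : forall (A B : zmodType) (V : zmodClosed A) (W : zmodClosed B) f g,
    Ar V W f -> {in W, forall y, g y \in V} ->
    {in V, cancel f g} -> {in W, cancel g f} -> Ar W V g;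
  mu_prod : forall (A1 A2 : zmodType) (V1 : zmodClosed A1) (V2 : zmodClosed A2),
    Ob V1 -> Ob V2 -> Ob (prodsub V1 V2);
  mu_prod_map : forall (A1 A2 B1 B2 : zmodType)
      (V1 : zmodClosed A1) (V2 : zmodClosed A2)
      (W1 : zmodClosed B1) (W2 : zmodClosed B2) f1 f2,
    Ar V1 W1 f1 -> Ar V2 W2 f2 ->
    Ar (prodsub V1 V2) (prodsub W1 W2) (fun x => (f1 x.1, f2 x.2));
  mu_fst : forall (A1 A2 : zmodType) (V1 : zmodClosed A1) (V2 : zmodClosed A2),
    Ob V1 -> Ob V2 -> Ar (prodsub V1 V2) V1 fst;
  mu_snd : forall (A1 A2 : zmodType) (V1 : zmodClosed A1) (V2 : zmodClosed A2),
    Ob V1 -> Ob V2 -> Ar (prodsub V1 V2) V2 snd;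
  mu_diag : forall (A : zmodType) (V : zmodClosed A) k,
    Ob V -> Ar V (powsub V k) (diag k);
  mu_quot : forall (A : zmodType) (W V : zmodClosed A),
    Ob W -> Ob V -> {subset W <= V} -> Ob (quotsub V W);
  mu_incl : forall (A : zmodType) (W V : zmodClosed A),
    Ob W -> Ob V -> {subset W <= V} -> Ar W V id;
  mu_proj : forall (A : zmodType) (W V : zmodClosed A),
    Ob W -> Ob V -> {subset W <= V} -> Ar V (quotsub V W) \pi_(quotZ W);
  mu_ker : forall (A B : zmodType) (V : zmodClosed A) (W : zmodClosed B) f K,
    Ar V W f -> is_kernel V f K -> Ob K;
  mu_im : forall (A B : zmodType) (V : zmodClosed A) (W : zmodClosed B) f I,
    Ar V W f -> is_image V f I -> Ob I;
  mu_factor : forall (A B : zmodType) (V1 W1 : zmodClosed A)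
      (V2 : zmodClosed B) f (g : quotZ W1 -> B),
    Ar V1 V2 f -> Ob W1 ->
    {in W1, forall x, x \in V1 /\ f x = 0} ->
    {in V1, forall x, g (\pi_(quotZ W1) x) = f x} ->
    Ar (quotsub V1 W1) V2 g;
  mu_corestrict : forall (A B : zmodType) (V1 : zmodClosed A)
      (V2 W2 : zmodClosed B) f,
    Ar V1 V2 f -> Ob W2 -> {in V1, forall x, f x \in W2} ->
    {subset W2 <= V2} -> Ar V1 W2 f;
  mu_add : forall (A : zmodType) (V : zmodClosed A),
    Ob V -> Ar (prodsub V V) V (fun x => x.1 + x.2);
  mu_mulz : forall (A : zmodType) (V : zmodClosed A) (k : int),
    Ob V -> Ar V V (fun x => x *~ k)
}.

Record additive_dimension (U : modular_universe) := AdditiveDimension {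
  dimension :> forall A : zmodType, zmodClosed A -> nat;
  dimension_additive : forall (A B : zmodType) (V : zmodClosed A)
      (W : zmodClosed B) f K I,
    Ar U V W f -> is_kernel V f K -> is_image V f I ->
    dimension V = (dimension K + dimension I)%N
}.

Section Modules.
Variables (U : modular_universe) (dim : additive_dimension U).
Variables (A : zmodType) (V : zmodClosed A).

Definition submodule (W : zmodClosed A) := Ob U W /\ {subset W <= V}.

Definition divisible :=
  forall k : nat, (0 < k)%N ->
  {in V, forall x, exists2 y, y \in V & y *+ k = x}.

Definition exponent_prime (p : nat) :=
  [/\ prime p, exists2 x, x \in V & x != 0 & {in V, forall x, x *+ p = 0}].

Definition has_characteristic (q : nat) :=
  if q == 0%N then divisible else exponent_prime q.

End Modules.

Definition dim_connected (U : modular_universe) (dim : additive_dimension U)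
    (A : zmodType) (V : zmodClosed A) :=
  forall W : zmodClosed A,
    submodule U V W -> ~ {subset V <= W} -> (dim A W < dim A V)%N.

Section GModules.
Variables (U : modular_universe) (dim : additive_dimension U).
Variables (gT : finGroupType) (G : {group gT}).
Variables (A : zmodType) (V : zmodClosed A) (rho : gT -> A -> A).

(* For gT = 'S_n, (g * h)%g is "first g, then h", so gmodM is the usual       *)
(* axiom of left actions, with permutations composed as functions.            *)
Record Gmodule : Prop := {
  gmod_ob : Ob U V;
  gmod_ar : forall g, g \in G -> Ar U V V (rho g);
  gmod1 : {in V, forall x, rho 1%g x = x};
  gmodM : {in G &, forall g h,
             {in V, forall x, rho (g * h)%g x = rho h (rho g x)}}
}.

Definition faithful_Gmodule :=
  forall g, g \in G -> {in V, forall x, rho g x = x} -> g = 1%g.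

Definition Gstable (W : zmodClosed A) :=
  forall g, g \in G -> {in W, forall x, rho g x \in W}.

Record Mod (d q : nat) : Prop := {
  Mod_gmod : Gmodule;
  Mod_dc : dim_connected dim V;
  Mod_dim : dim A V = d;
  Mod_char : has_characteristic V q
}.

Definition dc_irreducible :=
  forall W : zmodClosed A,
    submodule U V W -> Gstable W -> dim_connected dim W ->
    {in W, forall x, x = 0} \/ {subset V <= W}.

End GModules.

Definition Omega (n : nat) (M : zmodType) : pred M := [pred x | x *+ n == 0].
Arguments Omega : clear implicits.

Section Tensor.
Variables (M N : zmodType).

Notation freeMN := {freeg (M * N)%type / int}.

Definition fpair (m : M) (x : N) : freeMN := Freeg [:: (1, (m, x))].

Inductive tens_relation : freeMN -> Prop :=
| TensAddl m m' x : tens_relation (fpair (m + m') x - fpair m x - fpair m' x)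
| TensAddr m x x' : tens_relation (fpair m (x + x') - fpair m x - fpair m x').

Definition tensor : zmodType := quotZ (gensub tens_relation).

Definition tens (m : M) (x : N) : tensor :=
  \pi_(quotZ (gensub tens_relation)) (fpair m x).

Lemma tensDl x : {morph tens^~ x : m m' / m + m'}.
Proof.
move=> m m'; apply/eqP; rewrite /tens -raddfD -Quotient.idealrBE.
by rewrite opprD addrA; apply/mem_gensub/TensAddl.
Qed.

Lemma tensDr m : {morph tens m : x x' / x + x'}.
Proof.
move=> x x'; apply/eqP; rewrite /tens -raddfD -Quotient.idealrBE.
by rewrite opprD addrA; apply/mem_gensub/TensAddr.
Qed.

Section Lift.
Variables (P : zmodType) (b : M -> N -> P).

Definition free_lift (u : freeMN) : P :=
  fglift (fun z : (M * N)%type => b z.1 z.2 : zmodule P) u.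

(* Meaningful for biadditive b only. *)
Definition tens_lift (t : tensor) : P := free_lift (repr t).

Lemma free_lift_is_zmod_morphism : zmod_morphism free_lift.
Proof. exact: (@lift_is_additive int (M * N)%type (zmodule P)). Qed.

Lemma free_lift_pair m x : free_lift (fpair m x) = b m x.
Proof. by rewrite /free_lift /fpair liftU scale1r. Qed.

Hypothesis bDl : forall x, {morph b^~ x : m m' / m + m'}.
Hypothesis bDr : forall m, {morph b m : x x' / x + x'}.

Lemma tens_lift_pi u :
  tens_lift (\pi_(quotZ (gensub tens_relation)) u) = free_lift u.
Proof.
have lB := free_lift_is_zmod_morphism.
have l0 : free_lift 0 = 0 by rewrite -(subrr (0 : freeMN)) lB subrr.
pose K : pred freeMN := [pred v | free_lift v == 0].
have KP : zmod_closed K.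
  by split=> [|v w]; rewrite !inE ?l0 ?eqxx // => /eqP v0 /eqP w0;
    rewrite lB v0 w0 subrr.
have relK v : tens_relation v -> v \in mksub KP.
  by case=> *; apply/eqP; rewrite !lB !free_lift_pair ?bDl ?bDr;
    rewrite -addrA -opprD subrr.
have : repr (\pi_(quotZ (gensub tens_relation)) u) - u \in gensub tens_relation.
  by rewrite Quotient.idealrBE reprK.
by move=> /asboolP/(_ _ relK)/eqP; rewrite lB => /eqP; rewrite subr_eq0 => /eqP.
Qed.

Lemma tens_lift_tens m x : tens_lift (tens m x) = b m x.
Proof. by rewrite tens_lift_pi free_lift_pair. Qed.

Lemma tens_lift_is_zmod_morphism : zmod_morphism tens_lift.
Proof.
move=> t t'; rewrite -[t]reprK -[t']reprK -raddfB !tens_lift_pi.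
exact: free_lift_is_zmod_morphism.
Qed.

End Lift.

(* The image in M (x) N of N1 (x) N2, for subgroups N1 <= M and N2 <= N.      *)
Definition tensub (N1 : zmodClosed M) (N2 : zmodClosed N) : zmodClosed tensor :=
  gensub (fun t => exists m x, [/\ m \in N1, x \in N2 & t = tens m x]).

End Tensor.

Section Standard.
Variable n : nat.

(* perm(n, Z) is 'rV[int]_n, and c *m perm_mx s moves the i-th basis vector   *)
(* to the (s i)-th one.                                                       *)

Definition stdZ_mem : pred 'rV[int]_n := [pred c : 'rV[int]_n | \sum_i c 0 i == 0].

Lemma stdZ_closed : zmod_closed stdZ_mem.
Proof.
split=> [|c c']; rewrite !inE.
  by apply/eqP; rewrite big1 // => i _; rewrite mxE.
move=> /eqP c0 /eqP c'0; apply/eqP.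
rewrite (eq_bigr (fun i => c 0 i - c' 0 i)); last by move=> i _; rewrite !mxE.
by rewrite sumrB c0 c'0 subrr.
Qed.

Definition stdZ : zmodClosed 'rV[int]_n := mksub stdZ_closed.

Lemma stdZ_perm (s : 'S_n) c : c \in stdZ -> c *m perm_mx s \in stdZ.
Proof.
move=> /eqP c0; apply/eqP; rewrite -[RHS]c0 [RHS](reindex_inj (@perm_inj _ s^-1)).
by apply: eq_bigr => i _; rewrite -(invgK s) -col_permE mxE invgK.
Qed.

Definition stdZ_act (s : 'S_n) (c : subZ stdZ) : subZ stdZ :=
  Sub (val c *m perm_mx s) (stdZ_perm s (valP c)).

Variable L : zmodType.

Definition std : zmodType := tensor (subZ stdZ) L.

Definition std_act (s : 'S_n) : std -> std :=
  tens_lift (fun c l => tens (stdZ_act s c) l).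

Lemma std_act_tens s c l : std_act s (tens c l) = tens (stdZ_act s c) l.
Proof.
apply: (tens_lift_tens (b := fun c l => tens (stdZ_act s c) l)).
  move=> x c1 c2 /=; rewrite -tensDl; congr tens.
  by apply: val_inj; rewrite /= mulmxDl.
by move=> m x x'; exact: tensDr.
Qed.

Lemma std_act_is_zmod_morphism s : zmod_morphism (std_act s).
Proof.
apply: tens_lift_is_zmod_morphism.
  move=> x c1 c2 /=; rewrite -tensDl; congr tens.
  by apply: val_inj; rewrite /= mulmxDl.
by move=> m x x'; exact: tensDr.
Qed.

Definition std_fix_mem : pred std := [pred t | [forall s, std_act s t == t]].

Lemma std_fix_closed : zmod_closed std_fix_mem.
Proof.
split=> [|t t'].
  apply/forallP => s; apply/eqP.
  by rewrite -[X in std_act s X](subrr 0) std_act_is_zmod_morphism subrr.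
move=> /forallP Ht /forallP Ht'; apply/forallP => s; apply/eqP.
by rewrite std_act_is_zmod_morphism (eqP (Ht s)) (eqP (Ht' s)).
Qed.

Definition std_fix : zmodClosed std := mksub std_fix_closed.

Definition stdbar : zmodType := quotZ std_fix.

Definition stdbar_act (s : 'S_n) (y : stdbar) : stdbar :=
  \pi_(quotZ std_fix) (std_act s (repr y)).

Lemma stdbar_act_pi s t :
  stdbar_act s (\pi_(quotZ std_fix) t) = \pi_(quotZ std_fix) (std_act s t).
Proof.
apply/eqP; rewrite -Quotient.idealrBE -std_act_is_zmod_morphism.
have : repr (\pi_(quotZ std_fix) t) - t \in std_fix.
  by rewrite Quotient.idealrBE reprK.
by move=> fx; have /forallP/(_ s)/eqP-> := fx.
Qed.

(* The i-th basis vector of perm(n, Z), counting from 0, for i < n. *)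
Definition basis_perm (i : nat) : 'rV[int]_n := \row_(j < n) (i == j)%:R.

Definition std_vector : 'rV[int]_n :=
  \sum_(0 <= i < n.-1) (basis_perm i - basis_perm n.-1).

Lemma std_vector_stdZ : std_vector \in stdZ.
Proof.
have sum_basis i : (i < n)%N -> \sum_j basis_perm i 0 j = 1.
  move=> lt_in; rewrite (bigD1 (Ordinal lt_in)) //= mxE eqxx big1 ?addr0 // => j.
  by rewrite mxE eq_sym -val_eqE /= => /negPf->.
rewrite /std_vector big_nat rpred_sum // => i /andP[_ lt_i].
have lt_n : (n.-1 < n)%N by case: (n) lt_i.
have lt_in : (i < n)%N by apply: ltn_trans lt_n.
rewrite /stdZ /mksub inE /=.
under eq_bigr do rewrite [_ 0 _]mxE [X in _ + X]mxE.
by rewrite sumrB !sum_basis // subrr.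
Qed.

Definition std_line : zmodClosed (subZ stdZ) :=
  gensub (fun c : subZ stdZ => val c = std_vector).

End Standard.

Definition sgn_twist (n : nat) (M : zmodType) (act : 'S_n -> M -> M)
    (s : 'S_n) (x : M) : M :=
  act s x *~ ((-1) ^+ s).

Section Comparison.
Variables (n : nat) (G : {group 'S_n}) (U : modular_universe).
Variables (A : zmodType) (V : zmodClosed A) (rho : 'S_n -> A -> A).

Definition equivariant (M : zmodType) (act : 'S_n -> M -> M) (phi : M -> A) :=
  forall s, s \in G -> forall x, phi (act s x) = rho s (phi x).

Definition onto_V (M : zmodType) (phi : M -> A) :=
  (forall x, phi x \in V) /\ {in V, forall v, exists x, phi x = v}.

Variable L : zmodClosed A.

(* A homomorphism from std(n, L) is a morphism of modules in U when it is     *)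
(* compatible after identifying std(n, L) with a power of L along a Z-basis   *)
(* of std(n, Z), equivalently when each l |-> phi (c (x) l) is compatible.    *)
Definition compatible (phi : std n (subZ L) -> A) :=
  forall c : subZ (stdZ n), Ar U L V (fun l => phi (tens c (insubd 0 l))).

Definition covered_by_std (act : 'S_n -> std n (subZ L) -> std n (subZ L))
    (phi : {additive std n (subZ L) -> A}) :=
  [/\ onto_V phi, equivariant act phi & compatible phi].

Definition isomorphic_to_stdbar
    (act : 'S_n -> stdbar n (subZ L) -> stdbar n (subZ L)) :=
  exists psi : {additive stdbar n (subZ L) -> A},
    [/\ injective psi, onto_V psi, equivariant act psi
      & compatible (psi \o \pi_(quotZ (std_fix n (subZ L))))].

End Comparison.

(* Main.v *)
Require Import Defs.
From HB Require Import structures.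
From mathcomp Require Import all_boot all_order all_algebra.
From mathcomp Require Import all_fingroup all_solvable.
From mathcomp Require Import generic_quotient ring_quotient.
From mathcomp Require Import boolp.
From mathcomp Require Import freeg.
From mathcomp Require Import zify.

Set Implicit Arguments.
Unset Strict Implicit.
Unset Printing Implicit Defensive.

Import GRing.Theory.
Local Open Scope ring_scope.
Local Open Scope quotient_scope.

(** The compatible endomorphisms of [V] form a ring, and the dimension of the image is a rank on it.
    Images of [V] are dim-connected because [V] is, so rank 0 means zero; ranks are subadditive and
    satisfy Frobenius' inequality. This replaces linear algebra: instead of eigenspaces, the images
    of group-ring elements are counted, and the identities needed between group-ring elements are
    decided by evaluation on words in transpositions.

    The heart of the proof is that disjoint 3-cycles [c] and [h] satisfy (1 - h)(1 - c) = 0 on [V]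
    ([module_cycles_null]). If q is not 2 ([odd_key]), the Klein group of four points cuts [V] into
    a fixed part and three conjugate parts; their ranks are limited by d < n, so the alternating
    group of the remaining points acts on parts too small for it. If q = 2 ([even_key]), c + c^-1 is
    an idempotent with the same image as 1 - c; three disjoint 3-cycles cut [V] into parts whose
    ranks are divisible by 2, 4 or 8 ([nine_split]). With d < n this leaves either the claim or a
    situation where 3-cycles act without fixed points, and there the Klein group is shown to act
    trivially ([klein_trivial_fpf]), which is absurd.

    Consequently the image of 1 - c is fixed by the alternating group of the points outside [c]
    ([commutator_fixed]). Take 3-cycles [a] and [b] with a single common point and let L = (1 - a)(1
    - b)V. It is fixed by all even permutations that fix two given points ([line_fixed]), so it has
    translates [pair_map i j] that behave like (e_i - e_j) tensored with [L]: they are alternating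
    and satisfy the cocycle relation. [L] is not 0 because [a] and [b] do not commute ([line_neq0]).

    By dc-irreducibility the translates span [V] ([line_spans]) and odd permutations act on [L]
    through a sign ([line_twist_sign]), so std(n, L), twisted or not, covers [V]. Relations among
    translates have constant coefficients ([mu_sum_const]), so the kernel of the cover consists of
    constant tuples, with n-torsion values forming a submodule K of [L]. Counting gives d + dim K =
    (n - 1) dim L ([dim_family]), and d < n forces dim L = 1. If q > 0 divides n, irreducibility
    gives K = L; if q > 0 does not divide n, then K = 0; if q = 0, [L] is divisible and its
    n-torsion has dimension 0. *)

(** * Permutations as words in transpositions, and decidable identities in their group rings *)

Definition word := seq (nat * nat).

Definition letter_act (ij : nat * nat) (k : nat) : nat :=
  if k == ij.1 then ij.2 else if k == ij.2 then ij.1 else k.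

Definition word_act (w : word) (k : nat) : nat :=
  foldl (fun l ij => letter_act ij l) k w.

Definition word_key (k : nat) (w : word) : seq nat :=
  [seq word_act w i | i <- iota 0 k].

Definition wf_word (k : nat) (w : word) : bool :=
  all (fun ij => [&& ij.1 < k, ij.2 < k & ij.1 != ij.2]%N) w.

Section WordPerm.
Variables (T : finType) (k : nat) (x : nat -> T).

Definition word_perm (w : word) : {perm T} :=
  (\prod_(ij <- w) tperm (x ij.1) (x ij.2))%g.

Lemma word_perm_cat w w' :
  word_perm (w ++ w') = (word_perm w * word_perm w')%g.
Proof. by rewrite /word_perm big_cat. Qed.

Lemma word_perm_cons ij w :
  word_perm (ij :: w) = (tperm (x ij.1) (x ij.2) * word_perm w)%g.
Proof. by rewrite /word_perm big_cons. Qed.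

Hypothesis injx : {in gtn k &, injective x}.

Lemma letter_act_lt (ij : nat * nat) i :
  (ij.1 < k)%N -> (ij.2 < k)%N -> (i < k)%N -> (letter_act ij i < k)%N.
Proof. by rewrite /letter_act => *; do 2?case: ifP. Qed.

Lemma word_act_lt w i : wf_word k w -> (i < k)%N -> (word_act w i < k)%N.
Proof.
elim: w i => [|ij w IH] i //= /andP[/and3P[? ? _] wfw] ltik.
by apply: IH => //; apply: letter_act_lt.
Qed.

Lemma word_permE w i : wf_word k w -> (i < k)%N ->
  word_perm w (x i) = x (word_act w i).
Proof.
elim: w i => [|ij w IH] i /=; first by rewrite /word_perm big_nil perm1.
move=> /andP[/and3P[lt1 lt2 _] wfw] ltik.
rewrite word_perm_cons permM -IH ?letter_act_lt //; congr (word_perm w _).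
rewrite /letter_act; case: tpermP => [/injx|/injx|ne1 ne2].
- by move=> -> //; rewrite eqxx.
- by move=> -> //; rewrite eqxx; case: eqP => [->|].
- by case: eqP ne1 => [->|_ _] //; case: eqP ne2 => [->|].
Qed.

Lemma word_perm_out w (y : T) : wf_word k w ->
  (forall i, (i < k)%N -> y != x i) -> word_perm w y = y.
Proof.
elim: w => [|ij w IH] /=; first by rewrite /word_perm big_nil perm1.
move=> /andP[/and3P[lt1 lt2 _] wfw] yP.
by rewrite word_perm_cons permM tpermD ?IH // eq_sym yP.
Qed.

Lemma word_perm_eq w w' : wf_word k w -> wf_word k w' ->
  word_key k w = word_key k w' -> word_perm w = word_perm w'.
Proof.
move=> wfw wfw' /eq_in_map eqww'; apply/permP => y.
have [/existsP[i /eqP->]|/existsPn yP] := boolP [exists i : 'I_k, y == x i].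
  by rewrite !word_permE // eqww' // mem_iota add0n ltn_ord.
by rewrite !word_perm_out // => i ltik; have := yP (Ordinal ltik).
Qed.

Lemma odd_word_perm w : wf_word k w -> odd_perm (word_perm w) = odd (size w).
Proof.
elim: w => [|ij w IH] /=; first by rewrite /word_perm big_nil odd_perm1.
move=> /andP[/and3P[lt1 lt2 ne12] wfw].
rewrite word_perm_cons odd_permM IH // odd_tperm.
by rewrite (_ : x ij.1 != x ij.2) ?addTb //; apply: contra_neq ne12 => /injx->.
Qed.

Lemma word_perm_on (S : {set T}) w : wf_word k w ->
  (forall i, (i < k)%N -> x i \in S) -> perm_on S (word_perm w).
Proof.
move=> wfw xS; apply/subsetP => y; rewrite inE; apply: contraR => yS.
by rewrite word_perm_out // => i /xS; apply: contraTneq => <-.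
Qed.

End WordPerm.

(* A formal element of the integral group ring of the permutations of         *)
(* {0, ..., k-1}: identities between such elements are decided by evaluation. *)
Definition gring := seq (int * word).

Definition gw (w : word) : gring := [:: (1, w)].
Definition gone : gring := gw [::].
Definition gadd (p q : gring) : gring := p ++ q.
Definition gopp (p : gring) : gring := [seq (- sw.1, sw.2) | sw <- p].
Definition gsub (p q : gring) : gring := gadd p (gopp q).
Definition gmul (p q : gring) : gring :=
  flatten [seq [seq (sw.1 * sw'.1, sw.2 ++ sw'.2) | sw' <- q] | sw <- p].

Definition ok_word (k : nat) (ev : bool) (w : word) : bool :=
  wf_word k w && (ev ==> ~~ odd (size w)).

Definition ok_gring k ev (p : gring) : bool := all (fun sw => ok_word k ev sw.2) p.

(* Collects the terms of a formal element that denote the same permutation;   *)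
(* each entry keeps the table of values and a representative word.            *)
Fixpoint ginsert (z : int) (l : seq nat) (w : word) (acc : seq (int * (seq nat * word))) :=
  if acc is (z', lw) :: acc' then
    if lw.1 == l then (z + z', lw) :: acc' else (z', lw) :: ginsert z l w acc'
  else [:: (z, (l, w))].

Definition gcollect (k : nat) (p : gring) :=
  foldr (fun sw acc => ginsert sw.1 (word_key k sw.2) sw.2 acc) [::] p.

(** Coefficients have to vanish modulo [m] only: [m = 0] gives identities over the integers, [m = 2]
    those of characteristic 2. *)
Definition gnull (k m : nat) (p : gring) : bool :=
  all (fun zlw => (m%:Z %| zlw.1)%Z) (gcollect k p).

Section Representation.
Variables (E : pzRingType) (k m : nat) (ev : bool) (R : word -> E).

Record word_rep : Prop := WordRep {
  wr_nil : R [::] = 1;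
  wr_cat : forall w w', ok_word k ev w -> ok_word k ev w' ->
    R (w ++ w') = R w * R w';
  wr_key : forall w w', ok_word k ev w -> ok_word k ev w' ->
    word_key k w = word_key k w' -> R w = R w'
}.

Definition geval (p : gring) : E := \sum_(sw <- p) R sw.2 *~ sw.1.

Hypotheses (HR : word_rep) (Hm : m%:R = 0 :> E).

Lemma geval1 : geval gone = 1.
Proof. by rewrite /geval big_seq1 /= wr_nil. Qed.

Lemma gevalw w : geval (gw w) = R w.
Proof. by rewrite /geval big_seq1. Qed.

Lemma gevalD p q : geval (gadd p q) = geval p + geval q.
Proof. exact: big_cat. Qed.

Lemma gevalN p : geval (gopp p) = - geval p.
Proof.
by rewrite /geval big_map -sumrN; apply: eq_bigr => sw _; rewrite mulrNz.
Qed.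

Lemma gevalB p q : geval (gsub p q) = geval p - geval q.
Proof. by rewrite gevalD gevalN. Qed.

Lemma gevalM p q : ok_gring k ev p -> ok_gring k ev q ->
  geval (gmul p q) = geval p * geval q.
Proof.
move=> /allP okp /allP okq.
rewrite /geval /gmul big_flatten big_map mulr_suml.
apply: eq_big_seq => sw sw_p.
rewrite big_map mulr_sumr; apply: eq_big_seq => sw' sw'_q /=.
by rewrite (wr_cat HR) ?(okp _ sw_p) ?(okq _ sw'_q) // mulrzAl mulrzAr -mulrzA mulrC.
Qed.

Lemma gnullP p : ok_gring k ev p -> gnull k m p -> geval p = 0.
Proof.
(* Invariant of the collection: the table stored in an entry is that of its representative word, so
   merging entries with equal tables is sound by [wr_key]. *)
pose good (zlw : int * (seq nat * word)) :=
  ok_word k ev zlw.2.2 && (word_key k zlw.2.2 == zlw.2.1).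
pose eval (acc : seq (int * (seq nat * word))) := \sum_(zlw <- acc) R zlw.2.2 *~ zlw.1.
have insP z w acc : ok_word k ev w -> all good acc ->
    all good (ginsert z (word_key k w) w acc) /\
    eval (ginsert z (word_key k w) w acc) = R w *~ z + eval acc.
  move=> okw; elim: acc => [|[z' [l' w']] acc IH] /=.
    by rewrite /good /= okw eqxx /eval big_seq1 big_nil addr0.
  move=> /andP[gw' gacc]; case: eqP => [e|_] /=; last first.
    have [-> e] := IH gacc; rewrite gw'; split=> //.
    by rewrite [LHS]big_cons [in RHS]/eval big_cons /= addrCA -e.
  rewrite gacc andbT; split; first by [].
  have /andP[/= okw' /eqP kw'] := gw'.
  have -> : R w = R w' by apply: (wr_key HR) => //; rewrite kw' e.
  by rewrite [LHS]big_cons [in RHS]/eval big_cons /= addrA -mulrzDr.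
have colP q : ok_gring k ev q -> all good (gcollect k q) /\ eval (gcollect k q) = geval q.
  elim: q => [|sw q IH] /=; first by rewrite /eval /geval !big_nil.
  move=> /andP[okw /IH[gq eq]]; have [g' ->] := insP sw.1 _ _ okw gq.
  by rewrite g' eq /geval big_cons.
move=> /colP[_ <-] /allP null_p; rewrite /eval big_seq big1 // => zlw /null_p/dvdzP[y ->].
by rewrite mulrC mulrzA -[R _]mulr1 -mulrzAr -pmulrn Hm mulr0 mul0rz.
Qed.

Lemma geval_eq p q : ok_gring k ev p -> ok_gring k ev q ->
  gnull k m (gsub p q) -> geval p = geval q.
Proof.
move=> okp okq nullpq; apply/eqP; rewrite -subr_eq0 -gevalB gnullP //.
by rewrite /ok_gring all_cat all_map; apply/andP.
Qed.

End Representation.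

Lemma word_act_id k w i : wf_word k w -> (k <= i)%N -> word_act w i = i.
Proof.
elim: w => //= -[a b] w IH /andP[/and3P[/= lta ltb _] wfw] leki.
rewrite /letter_act /= !gtn_eqF ?(leq_trans lta) ?(leq_trans ltb) //.
exact: IH.
Qed.

Lemma ok_word_widen k k' ev w : (k <= k')%N -> ok_word k ev w -> ok_word k' ev w.
Proof.
move=> le_kk' /andP[wfw evw]; rewrite /ok_word evw andbT.
apply: sub_all wfw => ij /and3P[lt1 lt2 ->].
by rewrite !(leq_trans _ le_kk').
Qed.

Lemma word_act_ge k w i : all (fun ij => (k <= ij.1) && (k <= ij.2))%N w ->
  if (i < k)%N then word_act w i = i else (k <= word_act w i)%N.
Proof.
elim: w i => [|[a b] w IH] i /=; first by case: ltnP.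
move=> /andP[/andP[/= lea leb] lew]; rewrite /letter_act /=.
case: eqP => [->|_]; first by have := IH b lew; rewrite !ltnNge lea leb.
case: eqP => [->|_]; first by have := IH a lew; rewrite !ltnNge lea leb.
exact: IH.
Qed.

Lemma word_key_comm n k w w' : wf_word k w ->
  all (fun ij => (k <= ij.1) && (k <= ij.2))%N w' ->
  word_key n (w ++ w') = word_key n (w' ++ w).
Proof.
move=> wfw gew'; apply: eq_map => i.
rewrite /word_act !foldl_cat -!/(word_act _ _).
have := word_act_ge i gew'; case: ltnP => [ltik ->|leki leki'].
  by have := word_act_ge (word_act w i) gew'; rewrite word_act_lt.
by rewrite !(word_act_id wfw).
Qed.

Lemma ok_word_cat k ev w w' : ok_word k ev w -> ok_word k ev w' -> ok_word k ev (w ++ w').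
Proof.
rewrite /ok_word /wf_word all_cat size_cat oddD => /andP[-> /implyP o1] /andP[-> /implyP o2].
by apply/implyP => ev_; rewrite (negPf (o1 ev_)) (negPf (o2 ev_)).
Qed.

Section RepTools.
Variables (E : pzRingType) (k m : nat) (ev : bool) (R : word -> E).
Hypotheses (HR : word_rep k ev R) (Hm : m%:R = 0 :> E).

Lemma word_rep_restrict k' : (k' <= k)%N -> word_rep k' ev R.
Proof.
move=> le_k'k; have wid := ok_word_widen le_k'k.
split=> [|w w' okw okw'|w w' okw okw' eqk].
- exact: wr_nil HR.
- by rewrite (wr_cat HR) ?wid.
rewrite (wr_key HR (wid _ _ okw) (wid _ _ okw')) //.
apply/eq_in_map => i; rewrite mem_iota add0n /= => ltik.
have [ltik'|leki] := ltnP i k'.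
  by move/eq_in_map: eqk; apply; rewrite mem_iota.
have /andP[wfw _] := okw; have /andP[wfw' _] := okw'.
by rewrite !(word_act_id (k := k')).
Qed.

Definition gcheck (p q : gring) : bool :=
  [&& ok_gring k ev p, ok_gring k ev q & gnull k m (gsub p q)].

Lemma gcheckP p q : gcheck p q -> geval R p = geval R q.
Proof. by move=> /and3P[? ? ?]; apply: (geval_eq HR Hm). Qed.

Lemma ok_gmul p q : ok_gring k ev p -> ok_gring k ev q -> ok_gring k ev (gmul p q).
Proof.
move=> /allP okp /allP okq; apply/allP => x /flattenP[l /mapP[sw /okp okw ->{l}]].
move=> /mapP[sw' /okq okw' ->{x}] /=; exact: ok_word_cat.
Qed.

Lemma geval0 : geval R [::] = 0.
Proof. by rewrite /geval big_nil. Qed.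

Lemma gmulP p q r :
  ok_gring k ev p && ok_gring k ev q && gcheck (gmul p q) r ->
  geval R p * geval R q = geval R r.
Proof. by move=> /andP[/andP[? ?] /gcheckP <-]; rewrite (gevalM HR). Qed.

Lemma gcommP p q p' q' :
  [&& ok_gring k ev p, ok_gring k ev q, ok_gring k ev p', ok_gring k ev q'
    & gcheck (gmul p q) (gmul q' p')] ->
  geval R p * geval R q = geval R q' * geval R p'.
Proof. by move=> /and5P[? ? ? ? /gcheckP]; rewrite !(gevalM HR). Qed.

(** Such an [f] is an endomorphism of the representation, so its image is a subrepresentation;
    statements about [f] stand for statements about that image. *)
Definition rel_rep (f : E) := forall w, ok_word k ev w -> R w * f = f * R w.

Lemma rel_rep1 : rel_rep 1.
Proof. by move=> w _; rewrite mulr1 mul1r. Qed.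

Lemma rel_geval f p : rel_rep f -> ok_gring k ev p ->
  geval R p * f = f * geval R p.
Proof.
move=> rf /allP okp; rewrite /geval mulr_suml mulr_sumr.
by apply: eq_big_seq => sw /okp/rf e; rewrite mulrzAl mulrzAr e.
Qed.

(** Words that move only points from [l] on commute with those that move only smaller points, so
    cutting by such a [p] keeps the symmetry on the first [l] points. *)
Lemma rel_high l p f : (l <= k)%N -> rel_rep f ->
  all (fun sw => ok_word k ev sw.2 &&
    all (fun ij => (l <= ij.1) && (l <= ij.2))%N sw.2) p ->
  forall w, ok_word l ev w -> R w * (geval R p * f) = geval R p * f * R w.
Proof.
move=> lek relf /allP okp w okw; have okwk := ok_word_widen lek okw.
rewrite -mulrA -relf // !mulrA; congr (_ * f).
rewrite /geval mulr_suml mulr_sumr; apply: eq_big_seq => sw /okp/andP[oks high].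
rewrite mulrzAl mulrzAr -!(wr_cat HR) //; congr (_ *~ _); apply: (wr_key HR);
  rewrite ?ok_word_cat //.
by apply: (word_key_comm k (k := l)) => //; case/andP: okw.
Qed.

Lemma gevalK w : ok_word k ev w ->
  geval R (gw w) * geval R (gw (rev w)) = 1 /\
  geval R (gw (rev w)) * geval R (gw w) = 1.
Proof.
have letK ij : involutive (letter_act ij).
  move=> i; rewrite /letter_act.
  case: (i =P ij.1) => [->|n1]; first by case: eqP => [->|_]; rewrite ?eqxx.
  case: (i =P ij.2) => [->|n2]; first by rewrite eqxx.
  by rewrite (introF eqP n1) (introF eqP n2).
have actK v i : word_act (v ++ rev v) i = i.
  elim: v i => //= ij v IH i; rewrite rev_cons -cats1 catA.
  by rewrite /word_act foldl_cat -/(word_act _ _) /= -/(word_act _ _) IH letK.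
have okr v : ok_word k ev v -> ok_word k ev (rev v).
  by rewrite /ok_word /wf_word all_rev size_rev.
have RK v : ok_word k ev v -> R v * R (rev v) = 1.
  move=> okv; rewrite -(wr_cat HR) ?okr // -(wr_nil HR); apply: (wr_key HR).
  - have /andP[a b] := okv; rewrite /ok_word /wf_word all_cat all_rev -/(wf_word k v) a.
    by rewrite size_cat size_rev addnn odd_double implybT.
  - by rewrite /ok_word implybT.
  by apply: eq_map => i; rewrite actK.
move=> okw; rewrite !gevalw RK //; split=> //.
by rewrite -{2}(revK w) RK ?okr.
Qed.

End RepTools.

(** * Rank functions on a ring *)

Section Rank.
Variable E : pzRingType.

(** These properties are all the linear algebra that the rank arguments start from. The model is the
    dimension of the image of a compatible endomorphism, [endo_rank_function]. *)
Record rank_function := RankFunction {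
  rk : E -> nat;
  rk_eq0 : forall x, rk x = 0%N <-> x = 0;
  rkD : forall x y, (rk (x + y)%R <= rk x + rk y)%N;
  rk_frobenius : forall x y z,
    (rk (x * y)%R + rk (y * z)%R <= rk y + rk (x * y * z)%R)%N
}.

Arguments rk r x%_R.

Variable rf : rank_function.
Local Notation rank := (rk rf).

Lemma rk0 : rank 0 = 0%N. Proof. exact/rk_eq0. Qed.

Lemma rkMl x y : (rank (x * y) <= rank y)%N.
Proof.
by have := rk_frobenius rf x y 0; rewrite !mulr0 rk0 !addn0.
Qed.

Lemma rkMr x y : (rank (x * y) <= rank x)%N.
Proof.
by have := rk_frobenius rf 0 x y; rewrite !mul0r rk0 addn0.
Qed.

Lemma rk_unitl u v x : v * u = 1 -> rank (u * x) = rank x.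
Proof.
move=> vu; apply/eqP; rewrite eqn_leq rkMl /=.
by rewrite -{1}[x]mul1r -vu -mulrA rkMl.
Qed.

Lemma rk_unitr u v x : u * v = 1 -> rank (x * u) = rank x.
Proof.
move=> uv; apply/eqP; rewrite eqn_leq rkMr /=.
by rewrite -{1}[x]mulr1 -uv mulrA rkMr.
Qed.

Lemma rkN x : rank (- x) = rank x.
Proof. by rewrite -mulN1r (rk_unitl (v := -1)) // mulN1r opprK. Qed.

Lemma rk_frobenius0 x y z : x * y * z = 0 -> (rank (x * y) + rank (y * z) <= rank y)%N.
Proof. by move=> xyz0; have := rk_frobenius rf x y z; rewrite xyz0 rk0 addn0. Qed.

(* [stab x f] says that right multiplication realises x on the image of f. *)
Definition stab (x f : E) := exists y, x * f = f * y.

Lemma stab_comm x f : x * f = f * x -> stab x f.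
Proof. by exists x. Qed.

Lemma stab1 f : stab 1 f.
Proof. by exists 1; rewrite mul1r mulr1. Qed.

Lemma stabD x y f : stab x f -> stab y f -> stab (x + y) f.
Proof. by move=> [x' ex] [y' ey]; exists (x' + y'); rewrite mulrDl mulrDr ex ey. Qed.

Lemma stabN x f : stab x f -> stab (- x) f.
Proof. by move=> [x' ex]; exists (- x'); rewrite mulNr mulrN ex. Qed.

Lemma stabM x y f : stab x f -> stab y f -> stab (x * y) f.
Proof. by move=> [x' ex] [y' ey]; exists (x' * y'); rewrite -mulrA ey mulrA ex mulrA. Qed.

Lemma stab_mul x y f : x * y = y * x -> stab x f -> stab x (y * f).
Proof. by move=> xy [x' ex]; exists x'; rewrite mulrA xy -!mulrA ex. Qed.

(** Write [y f = f y'] and apply Frobenius' inequality to [x], [f], [y']. For complementary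
    idempotents this is the half of the rank decomposition that subadditivity does not give. *)
Lemma rk_orth x y f : stab y f -> x * y * f = 0 ->
  (rank (x * f) + rank (y * f) <= rank f)%N.
Proof.
by move=> [y' ey] xyf; rewrite ey rk_frobenius0 // -mulrA -ey mulrA.
Qed.

Lemma rk_conj u v x y f : u * v = 1 -> v * u = 1 -> stab u f -> stab v f ->
  u * x = y * u -> rank (x * f) = rank (y * f).
Proof.
move=> uv vu [u' eu] [v' ev] uxy.
have le1 : (rank (x * f) <= rank (y * f))%N.
  by rewrite -(rk_unitl _ vu) mulrA uxy -mulrA eu mulrA rkMr.
have vyx : v * y = x * v by rewrite -[y]mulr1 -uv (mulrA y) -uxy !mulrA vu mul1r.
have le2 : (rank (y * f) <= rank (x * f))%N.
  by rewrite -(rk_unitl _ uv) mulrA vyx -mulrA ev mulrA rkMr.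
by apply/eqP; rewrite eqn_leq le1.
Qed.

Section Odd.
Hypothesis rk_double : forall x, rank (x + x) = rank x.

Lemma double_eq0 (x : E) : x + x = 0 -> x = 0.
Proof. by move=> xx0; apply/(rk_eq0 rf); rewrite -rk_double xx0 rk0. Qed.

(** The elements 1 + u and 1 - u annihilate each other and add up to 2; [rk_double], which stands
    for characteristic different from 2, makes division by 2 unnecessary. *)
Lemma rk_invol u f : u * u = 1 -> stab u f ->
  rank f = (rank ((1 + u) * f) + rank ((1 - u) * f))%N.
Proof.
move=> uu su; apply/eqP; rewrite eqn_leq; apply/andP; split.
  rewrite -[X in (X <= _)%N]rk_double (_ : f + f = (1 + u) * f + (1 - u) * f).
    exact: rkD.
  by rewrite -mulrDl addrACA subrr addr0 mulrDl mul1r.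
apply: rk_orth; first by apply: stabD; [exact: stab1|exact: stabN].
by rewrite [_ * (1 - u)]mulrBr mulr1 [_ * u]mulrDl mul1r uu [u + 1]addrC subrr mul0r.
Qed.

Lemma rank1_invol u g : (rank g <= 1)%N -> u * u = 1 -> stab u g ->
  u * g = g \/ u * g = - g.
Proof.
move=> rg uu su; have := rk_invol uu su.
case e1: (rank ((1 - u) * g)) => [|r1].
  by left; move/rk_eq0/eqP: e1; rewrite mulrBl mul1r subr_eq0 => /eqP.
case e2: (rank ((1 + u) * g)) => [|r2]; last by lia.
by right; move/rk_eq0/eqP: e2; rewrite mulrDl mul1r addrC addr_eq0 => /eqP.
Qed.

(** On an image of rank 1 the involution [s] is a sign, so conjugation by [s] changes nothing there:
    [c] agrees with its inverse [d], which is also its square, and is therefore trivial. *)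
Lemma rank1_inverted s c d g : (rank g <= 1)%N -> s * s = 1 -> stab s g ->
  c * c = d -> c * d = 1 -> s * c = d * s -> c * g = g * c -> c * g = g.
Proof.
move=> rg ss sg ccd cd scd cg.
have scg : s * (c * g) = s * g * c by rewrite cg mulrA.
have cgdg : c * g = d * g.
  case: (rank1_invol rg ss sg) => e; move: scg; rewrite mulrA scd -mulrA e.
    by rewrite -cg.
  by rewrite mulrN mulNr -cg => /oppr_inj.
by rewrite -[RHS]mul1r -cd -mulrA -cgdg mulrA ccd cgdg.
Qed.

End Odd.
End Rank.

(** * The Klein four-group in characteristic different from 2 *)

Definition gplus (w : word) : gring := gadd gone (gw w).
Definition gminus (w : word) : gring := gsub gone (gw w).

Definition bitransp (a b c d : nat) : word := [:: (a, b); (c, d)].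
Definition cycle3 (a b c : nat) : word := [:: (a, b); (a, c)].

(* The multiples by 4 of the idempotents attached to the four characters of   *)
(* the Klein group of {0, 1, 2, 3}.                                           *)
Definition klein (i : nat) : gring :=
  let b1 := bitransp 0 1 2 3 in let b2 := bitransp 0 2 1 3 in
  match i with
  | 0 => gmul (gplus b2) (gplus b1)
  | 1 => gmul (gminus b2) (gplus b1)
  | 2 => gmul (gplus b2) (gminus b1)
  | _ => gmul (gminus b2) (gminus b1)
  end.

Section RepRank.
Variables (E : pzRingType) (rf : rank_function E) (R : word -> E) (m : nat).
Hypothesis Hm : m%:R = 0 :> E.
Local Notation rank := (rk rf).
Local Notation "[[ p ]]" := (geval R p) (format "[[ p ]]").

Lemma gwM k ev (HR : word_rep k ev R) w w' w'' :
  gcheck k m ev (gw (w ++ w')) (gw w'') && ok_word k ev w && ok_word k ev w' ->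
  [[gw w]] * [[gw w']] = [[gw w'']].
Proof. by case/andP=> /andP[/(gcheckP HR Hm) <- ? ?]; rewrite !gevalw (wr_cat HR). Qed.

Lemma rk_gconj k ev (HR : word_rep k ev R) w p q X :
  [&& ok_word k ev w, ok_gring k ev p, ok_gring k ev q
    & gcheck k m ev (gmul (gw w) p) (gmul q (gw w))] ->
  rel_rep k ev R X -> rank ([[p]] * X) = rank ([[q]] * X).
Proof.
move=> /and4P[okw okp okq cpq] relX.
have [ww' w'w] := gevalK HR okw.
have okr : ok_word k ev (rev w).
  by move: okw; rewrite /ok_word /wf_word all_rev size_rev.
apply: (rk_conj _ ww' w'w).
- by apply/stab_comm/(rel_geval relX); rewrite /= okw.
- by apply/stab_comm/(rel_geval relX); rewrite /= okr.
by apply: (gcommP HR Hm); rewrite /= okw okp okq cpq.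
Qed.

End RepRank.

Section Klein.
Variables (E : pzRingType) (rf : rank_function E) (R : word -> E).
Hypothesis rk_double : forall x : E, rk rf (x + x) = rk rf x.
Local Notation rank := (rk rf).
Local Notation "[[ p ]]" := (geval R p) (format "[[ p ]]").
Let H0 : 0%:R = 0 :> E := erefl.

(** Splitting along [b1] and then along [b2] gives four parts; 3-cycles of 0, 1, 2 permute the three
    non-trivial characters transitively, whence three equal ranks. *)
Lemma klein_split (HR : word_rep 4 true R) X : rel_rep 4 true R X ->
  rank X = (rank ([[klein 0]] * X) + 3 * rank ([[klein 1]] * X))%N.
Proof.
move=> relX.
pose b1 := bitransp 0 1 2 3; pose b2 := bitransp 0 2 1 3.
have geval_plus w : [[gplus w]] = 1 + [[gw w]] by rewrite gevalD (geval1 HR).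
have geval_minus w : [[gminus w]] = 1 - [[gw w]] by rewrite gevalB (geval1 HR).
have b1b1 : [[gw b1]] * [[gw b1]] = 1.
  by rewrite -(geval1 HR); apply: (gwM H0 HR); vm_compute.
have b2b2 : [[gw b2]] * [[gw b2]] = 1.
  by rewrite -(geval1 HR); apply: (gwM H0 HR); vm_compute.
have st2 p : gcheck 4 0 true (gmul (gw b2) p) (gmul p (gw b2)) && ok_gring 4 true p ->
    stab [[gw b2]] ([[p]] * X).
  move=> /andP[cp okp]; apply: stab_mul.
    by apply: (gcommP HR H0); rewrite okp cp.
  exact/stab_comm/(rel_geval relX).
rewrite (rk_invol rk_double b1b1); last exact/stab_comm/(rel_geval relX).
rewrite -geval_plus -geval_minus.
rewrite (rk_invol rk_double b2b2 (st2 (gplus b1) _)); last by vm_compute.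
rewrite (rk_invol rk_double b2b2 (st2 (gminus b1) _)); last by vm_compute.
rewrite -geval_plus -geval_minus !mulrA -!(gevalM HR) //.
rewrite -/(klein 0) -/(klein 1) -/(klein 2) -/(klein 3).
have conj12 : rank ([[klein 1]] * X) = rank ([[klein 2]] * X).
  by apply: (rk_gconj rf H0 HR (w := cycle3 0 1 2)) => //; vm_compute.
have conj13 : rank ([[klein 1]] * X) = rank ([[klein 3]] * X).
  by apply: (rk_gconj rf H0 HR (w := cycle3 0 2 1)) => //; vm_compute.
by rewrite -conj12 -conj13; move: (rank _) (rank _) => *; lia.
Qed.

End Klein.

(** * Representations of Sym(T) and Alt(T), and the words they induce on chosen points *)

Section PermRep.
Variables (T : finType) (E : pzRingType) (ev : bool) (r : {perm T} -> E).

Definition in_class (g : {perm T}) : bool := ev ==> ~~ odd_perm g.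

Record perm_rep : Prop := PermRep {
  pr1 : r 1%g = 1;
  prM : forall g h, in_class g -> in_class h -> r (g * h)%g = r g * r h
}.

Definition rel_set (S : {set T}) (f : E) :=
  forall g, in_class g -> perm_on S g -> r g * f = f * r g.

Lemma rel_setW (S S' : {set T}) f : S' \subset S -> rel_set S f -> rel_set S' f.
Proof. by move=> ss rf g cg og; apply: rf => //; apply: subset_trans ss. Qed.

Lemma rel_setM S f g : rel_set S f -> rel_set S g -> rel_set S (f * g).
Proof. by move=> rf rg h ch oh; rewrite mulrA rf // -mulrA rg // mulrA. Qed.

Lemma rel_setB S f g : rel_set S f -> rel_set S g -> rel_set S (f - g).
Proof. by move=> rf rg h ch oh; rewrite mulrBr mulrBl rf // rg. Qed.

Lemma rel_set1 S : rel_set S 1.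
Proof. by move=> g _ _; rewrite mulr1 mul1r. Qed.

Definition points (k : nat) (S : {set T}) (x : nat -> T) :=
  {in gtn k &, injective x} /\ forall i, (i < k)%N -> x i \in S.

Lemma points_ex k (S : {set T}) : (k <= #|S|)%N -> (0 < #|S|)%N -> exists x, points k S x.
Proof.
move=> leks /card_gt0P[t tS].
have ltk i : (i < k)%N -> (i < size (enum S))%N by move=> lt; rewrite -cardE (leq_trans lt).
exists (nth t (enum S)); split=> [i j|i] ltik.
  by move=> ltjk /eqP; rewrite nth_uniq ?enum_uniq ?ltk // => /eqP.
by rewrite -mem_enum mem_nth ?ltk.
Qed.

Lemma pointsW k k' (S S' : {set T}) x : (k' <= k)%N -> S \subset S' -> points k S x -> points k' S' x.
Proof.
move=> le_k' ss [injx xS]; split=> [i j ilt jlt|i ilt].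
  by apply: injx; rewrite inE /= (leq_trans _ le_k').
by rewrite (subsetP ss) ?xS ?(leq_trans _ le_k').
Qed.

Hypothesis HP : perm_rep.

Definition word_op (x : nat -> T) (w : word) : E := r (word_perm x w).

Lemma ok_word_class k S x w : points k S x -> ok_word k ev w ->
  in_class (word_perm x w) /\ perm_on S (word_perm x w).
Proof.
move=> [injx xS] /andP[wfw evw]; split; first by rewrite /in_class (odd_word_perm injx wfw).
exact: word_perm_on wfw xS.
Qed.

Lemma points_rep k S x : points k S x -> word_rep k ev (word_op x).
Proof.
move=> px; have cls w okw := (ok_word_class (w := w) px okw).1.
split=> [|w w' okw okw'|w w' /andP[wfw _] /andP[wfw' _] eqk].
- by rewrite /word_op /word_perm big_nil pr1.
- by rewrite /word_op word_perm_cat prM ?cls.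
by congr r; apply: word_perm_eq eqk => //; case: px.
Qed.

Lemma rel_points k S x f : points k S x -> rel_set S f -> rel_rep k ev (word_op x) f.
Proof. by move=> px rf w okw; have [c o] := ok_word_class px okw; apply: rf. Qed.

Lemma rel_disjoint k (S S' : {set T}) x p : points k S x -> [disjoint S & S'] ->
  ok_gring k ev p -> rel_set S' (geval (word_op x) p).
Proof.
move=> px dSS' /allP okp g cg og; rewrite /geval mulr_sumr mulr_suml.
apply: eq_big_seq => sw /okp okw; rewrite mulrzAl mulrzAr.
have [cw ow] := ok_word_class px okw.
by rewrite -!prM // (perm_onC ow og dSS').
Qed.

(** This is what lets inductions pass to fewer points: a part cut out with elements supported on [S]
    keeps the symmetry of the points outside [S]. *)
Lemma rel_mul_disjoint k (S S' S0 : {set T}) x p f : points k S x -> [disjoint S & S'] ->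
  ok_gring k ev p -> S' \subset S0 -> rel_set S0 f ->
  rel_set S' (geval (word_op x) p * f).
Proof.
move=> px dSS' okp sub rf; apply: rel_setM; first exact: rel_disjoint px dSS' okp.
exact: rel_setW rf.
Qed.

Definition cat_points k (x y : nat -> T) (i : nat) : T :=
  if (i < k)%N then x i else y (i - k)%N.

Lemma points_cat k k' (S S' : {set T}) x y : points k S x -> points k' S' y ->
  [disjoint S & S'] -> points (k + k') (S :|: S') (cat_points k x y).
Proof.
move=> [injx xS] [injy yS'] /disjointFr dSS'; rewrite /cat_points.
have sub i : (i < k + k')%N -> ~~ (i < k)%N -> (i - k < k')%N by lia.
split=> [i j lti ltj|i]; rewrite ?inE.
  have {}lti : (i < k + k')%N := lti; have {}ltj : (j < k + k')%N := ltj.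
  case: ifPn => [ltik|geik]; case: ifPn => [ltjk|gejk].
  - exact: injx.
  - by move=> e; have := dSS' _ (xS _ ltik); rewrite e yS' ?sub.
  - by move=> e; have := dSS' _ (xS _ ltjk); rewrite -e yS' ?sub.
  - by move=> e; have := injy _ _ (sub _ lti geik) (sub _ ltj gejk) e; lia.
by move=> lti; case: ifPn => [/xS->|/sub/yS'->] //; rewrite orbT.
Qed.

Definition point_set (k : nat) (x : nat -> T) : {set T} := [set x (val i) | i : 'I_k].

Lemma points_point_set k (S : {set T}) x : points k S x -> points k (point_set k x) x.
Proof.
move=> [injx xS]; split=> // i ltik.
by apply/imsetP; exists (Ordinal ltik).
Qed.

Lemma point_set_sub k (S : {set T}) x : points k S x -> point_set k x \subset S.
Proof. by move=> [injx xS]; apply/subsetP => _ /imsetP[i _ ->]; apply: xS (ltn_ord i). Qed.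

Lemma card_point_set k (S : {set T}) x : points k S x -> #|point_set k x| = k.
Proof.
move=> [injx xS]; rewrite card_imset ?card_ord // => i j eqx.
by apply/val_inj/injx; rewrite ?inE /=.
Qed.

Lemma card_rest k (S : {set T}) x : points k S x -> #|S :\: point_set k x| = (#|S| - k)%N.
Proof.
by move=> px; rewrite cardsDS ?(point_set_sub px) // (card_point_set px).
Qed.

Lemma disjoint_rest k (S : {set T}) x : [disjoint point_set k x & S :\: point_set k x].
Proof. by rewrite disjoint_sym disjoints_subset setDE subsetIr. Qed.

Lemma word_op_shift k x y w : (forall i, (i < k)%N -> x i = y i) -> wf_word k w ->
  word_op x w = word_op y w.
Proof.
move=> exy wfw; congr r; rewrite /word_perm; apply: eq_big_seq => ij /(allP wfw).
by case/and3P=> lt1 lt2 _; rewrite !exy.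
Qed.

End PermRep.

Lemma word_perm_map (T : finType) (x : nat -> T) (s : nat -> nat) (w : word) :
  word_perm (x \o s) w = word_perm x [seq (s ij.1, s ij.2) | ij <- w].
Proof. by rewrite /word_perm big_map. Qed.

(** * Representations of small rank on which double transpositions are trivial *)

Section Bitranspositions.
Variables (T : finType) (E : pzRingType) (rf : rank_function E) (r : {perm T} -> E).
Hypothesis HP : perm_rep true r.
Hypothesis rk_double : forall x : E, rk rf (x + x) = rk rf x.
Local Notation rank := (rk rf).
Let H0 : 0%:R = 0 :> E := erefl.

Lemma quadruple_eq0 (x : E) : x *+ 4 = 0 -> x = 0.
Proof.
by rewrite (mulrnA x 2 2) !mulr2n => /(double_eq0 rk_double)/(double_eq0 rk_double).
Qed.

Lemma klein_sum (R : word -> E) k (HR : word_rep k true R) : (4 <= k)%N ->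
  geval R (klein 0) + geval R (klein 1) + geval R (klein 2) + geval R (klein 3) = 4%:R.
Proof.
move=> le4; have HR4 := word_rep_restrict HR le4.
rewrite -!gevalD (gcheckP (q := [:: (Posz 4, [::])]) HR4 H0) //.
by rewrite /geval big_seq1 /= (wr_nil HR).
Qed.

Lemma klein_trivial (R : word -> E) (HR : word_rep 4 true R) X : rel_rep 4 true R X ->
  rank (geval R (klein 1) * X) = 0%N ->
  [/\ R (bitransp 0 1 2 3) * X = X, R (bitransp 0 2 1 3) * X = X
    & R (bitransp 0 3 1 2) * X = X].
Proof.
move=> relX w0.
have e1 : geval R (klein 1) * X = 0 by apply/(rk_eq0 rf).
have e2 : geval R (klein 2) * X = 0.
  apply/(rk_eq0 rf); rewrite -[RHS]w0; apply/esym.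
  by apply: (rk_gconj rf H0 HR (w := cycle3 0 1 2)) => //; vm_compute.
have e3 : geval R (klein 3) * X = 0.
  apply/(rk_eq0 rf); rewrite -[RHS]w0; apply/esym.
  by apply: (rk_gconj rf H0 HR (w := cycle3 0 2 1)) => //; vm_compute.
have triv w p q : gcheck 4 0 true (gadd (gminus w) (gminus w)) (gadd p q) ->
    geval R p * X = 0 -> geval R q * X = 0 -> R w * X = X.
  move=> /(gcheckP HR H0); rewrite [LHS]gevalD [RHS]gevalD => e pX qX; apply/eqP.
  rewrite eq_sym -subr_eq0 -[X in X - _]mul1r -mulrBl; apply/eqP.
  apply: (double_eq0 rk_double).
  have -> : 1 - R w = geval R (gminus w) by rewrite gevalB (geval1 HR) gevalw.
  by rewrite -mulrDl e mulrDl pX qX addr0.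
split; [apply: triv e2 e3|apply: triv e1 e3|apply: triv e1 e2]; by vm_compute.
Qed.

(** Induction on [k]. If the Klein group of four points acts non-trivially, all four of its parts
    satisfy the rank bound for the next smaller [k], and the alternating group of the other points
    acts on each. By induction the double transpositions of those points are trivial on every part,
    hence on [f], and conjugation brings this back to the first four points. *)
Lemma bitransp_trivial k (S : {set T}) f : (4 * k <= #|S|)%N -> (rank f < 3 * k)%N ->
  rel_set true r S f ->
  forall x, points 4 S x -> word_op r x (bitransp 0 1 2 3) * f = f.
Proof.
elim: k S f => // k IH S f leS rk_f relf x px.
have HR := points_rep HP px; have relx := rel_points px relf.
have rkE := klein_split rk_double HR relx.
case w0 : (rank (geval _ (klein 1) * f)) => [|w]; first by have [] := klein_trivial HR relx w0.
have {}rkE i : (i < 4)%N -> (rank (geval (word_op r x) (klein i) * f) < 3 * k)%N.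
  have conj12 : rank (geval (word_op r x) (klein 1) * f) =
                rank (geval (word_op r x) (klein 2) * f).
    by apply: (rk_gconj rf H0 HR (w := cycle3 0 1 2)) => //; vm_compute.
  have conj13 : rank (geval (word_op r x) (klein 1) * f) =
                rank (geval (word_op r x) (klein 3) * f).
    by apply: (rk_gconj rf H0 HR (w := cycle3 0 2 1)) => //; vm_compute.
  move: rkE rk_f conj12 conj13; rewrite w0.
  case: i => [|[|[|[|//]]]]; rewrite ?w0 => rkE rk_f c12 c13 _; rewrite -?c12 -?c13;
    move: rkE rk_f => /=; by move: (rank _) => *; lia.
pose S' := S :\: point_set 4 x.
have cS' : (4 * k <= #|S'|)%N by rewrite (card_rest px); lia.
have k_gt0 : (0 < k)%N by have := rkE 0%N isT; lia.
have [y py] : exists y, points 4 S' y by apply: points_ex; lia.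
have px' := points_point_set px.
have dis := disjoint_rest 4 S x.
have triv i : (i < 4)%N -> word_op r y (bitransp 0 1 2 3) *
    (geval (word_op r x) (klein i) * f) = geval (word_op r x) (klein i) * f.
  move=> lti; apply: (IH S') => //; first exact: rkE.
  apply: (rel_mul_disjoint HP px' dis _ (subsetDl _ _) relf).
  by case: i lti => [|[|[|[|//]]]].
have yf : word_op r y (bitransp 0 1 2 3) * f = f.
  apply/eqP; rewrite -subr_eq0; apply/eqP/quadruple_eq0.
  have f4 : f *+ 4 = \sum_(i < 4) geval (word_op r x) (klein i) * f.
    by rewrite -mulr_natl -(klein_sum HR) // !mulrDl !big_ord_recr big_ord0 /= add0r.
  rewrite mulrnBl -mulrnAr f4 mulr_sumr (eq_bigr _ (fun (i : 'I_4) _ => triv i (ltn_ord i))).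
  exact: subrr.
pose z := cat_points 4 x y.
have pz : points 8 S z.
  have := points_cat px' py dis; apply: pointsW => //.
  by rewrite subUset (point_set_sub px) subsetDl.
have HRz := points_rep HP pz; have relz := rel_points pz relf.
(* The even permutation [s] exchanges the quadruples [x] and [y]. *)
pose s : word := [:: (0, 4); (1, 5); (2, 6); (3, 7)]%N.
have xE : word_op r x (bitransp 0 1 2 3) = word_op r z (bitransp 0 1 2 3).
  by apply: (word_op_shift r (k := 4)) => // i lti; rewrite /z /cat_points lti.
have yE : word_op r y (bitransp 0 1 2 3) = word_op r z (bitransp 4 5 6 7).
  by rewrite /word_op /word_perm !big_cons !big_nil.
have [ss ss'] := gevalK HRz (isT : ok_word 8 true s).
rewrite xE; have -> : word_op r z (bitransp 0 1 2 3) =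
    geval (word_op r z) (gw s) * word_op r z (bitransp 4 5 6 7) * geval (word_op r z) (gw (rev s)).
  rewrite -!(gevalw (word_op r z)) -!(gevalM HRz) //.
  by apply: (gcheckP HRz H0); vm_compute.
have fs : geval (word_op r z) (gw (rev s)) * f = f * geval (word_op r z) (gw (rev s)).
  exact: (rel_geval relz).
have fs' : geval (word_op r z) (gw s) * f = f * geval (word_op r z) (gw s).
  exact: (rel_geval relz).
by rewrite -!mulrA fs (mulrA (word_op _ _ _)) -yE yf mulrA fs' -mulrA ss mulr1.
Qed.

End Bitranspositions.

Section ConjTrivial.
Variables (E : pzRingType) (R : word -> E) (k m : nat) (ev : bool).
Hypotheses (Hm : m%:R = 0 :> E) (HR : word_rep k ev R).
Local Notation "[[ p ]]" := (geval R p) (format "[[ p ]]").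

Lemma conj_null s p q f : rel_rep k ev R f ->
  [&& ok_word k ev s, ok_gring k ev p, ok_gring k ev q
    & gcheck k m ev (gmul (gw s) p) (gmul q (gw s))] ->
  [[p]] * f = 0 -> [[q]] * f = 0.
Proof.
move=> relf /and4P[oks okp okq cpq] pf.
have [ss s's] := gevalK HR oks.
have spq : [[gw s]] * [[p]] = [[q]] * [[gw s]].
  by apply: (gcommP HR Hm); rewrite /= oks okp okq cpq.
have fs : [[gw (rev s)]] * f = f * [[gw (rev s)]].
  apply: (rel_geval relf); move: oks.
  by rewrite /= /ok_word /wf_word all_rev size_rev andbT.
by rewrite -[f]mul1r -ss -(mulrA _ _ f) mulrA -spq fs -mulrA (mulrA _ f) pf mul0r mulr0.
Qed.

Lemma gevalP1 w : [[gplus w]] = 1 + R w.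
Proof. by rewrite gevalD (geval1 HR) gevalw. Qed.

Lemma gevalM1 w : [[gminus w]] = 1 - R w.
Proof. by rewrite gevalB (geval1 HR) gevalw. Qed.

Lemma gminus_eq0 w f : [[gminus w]] * f = 0 <-> R w * f = f.
Proof.
rewrite gevalM1 mulrBl mul1r; split=> [/eqP|->]; last exact: subrr.
by rewrite subr_eq0 eq_sym => /eqP.
Qed.

Lemma stab_geval p q f : rel_rep k ev R f ->
  [&& ok_gring k ev p, ok_gring k ev q & gcheck k m ev (gmul p q) (gmul q p)] ->
  stab [[p]] ([[q]] * f).
Proof.
move=> relf /and3P[okp okq cpq]; apply: stab_mul.
  by apply: (gcommP HR Hm); rewrite okp okq cpq.
exact/stab_comm/(rel_geval relf).
Qed.

End ConjTrivial.

(** * Seven points in characteristic different from 2 *)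

Section SevenPoints.
Variables (E : pzRingType) (rf : rank_function E) (R : word -> E).
Hypothesis rk_double : forall x : E, rk rf (x + x) = rk rf x.
Hypothesis HR : word_rep 7 true R.
Local Notation rank := (rk rf).
Local Notation "[[ p ]]" := (geval R p) (format "[[ p ]]").
Let H0 : 0%:R = 0 :> E := erefl.
Let HR4 := word_rep_restrict HR (isT : (4 <= 7)%N).

Let h := cycle3 4 5 6.
Let c := cycle3 0 1 2.
Let s := bitransp 0 1 4 5.

(* 4 - klein 0 = klein 1 + klein 2 + klein 3. *)
Definition klein_compl : gring :=
  [:: (Posz 3, [::]); (Negz 0, bitransp 0 1 2 3); (Negz 0, bitransp 0 2 1 3);
      (Negz 0, bitransp 0 3 1 2)].

Variable f : E.
Hypothesis relf : rel_rep 7 true R f.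

Lemma rel_four : rel_rep 4 true R f.
Proof. by move=> w okw; apply: relf; apply: ok_word_widen okw. Qed.

Lemma rk_quadruple (x : E) : rank (x *+ 4) = rank x.
Proof. by rewrite (mulrnA x 2 2) !mulr2n !rk_double. Qed.

Lemma klein_rkE : rank ([[klein 2]] * f) = rank ([[klein 1]] * f) /\
  rank ([[klein 3]] * f) = rank ([[klein 1]] * f).
Proof.
split; apply/esym.
  by apply: (rk_gconj rf H0 HR (w := cycle3 0 1 2)) => //; vm_compute.
by apply: (rk_gconj rf H0 HR (w := cycle3 0 2 1)) => //; vm_compute.
Qed.

(** The involution [s] = (0 1)(4 5) inverts [h] = (4 5 6), and equally [c] = (0 1 2), so
    [rank1_inverted] applies to both. *)
Lemma rank1_h g : (rank g <= 1)%N -> stab [[gw s]] g -> [[gw h]] * g = g * [[gw h]] ->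
  [[gw h]] * g = g.
Proof.
move=> rg sg hg; apply: (rank1_inverted rk_double rg (s := [[gw s]])
  (d := [[gw (cycle3 4 6 5)]])) => //.
- by rewrite -(geval1 HR); apply: (gwM H0 HR); vm_compute.
- by apply: (gwM H0 HR); vm_compute.
- by rewrite -(geval1 HR); apply: (gwM H0 HR); vm_compute.
- by apply: (gcommP HR H0); vm_compute.
Qed.

Lemma rank1_c g : (rank g <= 1)%N -> stab [[gw s]] g -> [[gw c]] * g = g * [[gw c]] ->
  [[gw c]] * g = g.
Proof.
move=> rg sg hg; apply: (rank1_inverted rk_double rg (s := [[gw s]])
  (d := [[gw (cycle3 0 2 1)]])) => //.
- by rewrite -(geval1 HR); apply: (gwM H0 HR); vm_compute.
- by apply: (gwM H0 HR); vm_compute.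
- by rewrite -(geval1 HR); apply: (gwM H0 HR); vm_compute.
- by apply: (gcommP HR H0); vm_compute.
Qed.

Lemma rk_cycle_conj :
  rank ([[gminus h]] * f) = rank ([[gminus c]] * f).
Proof.
apply: (rk_gconj rf H0 HR (w := [:: (0, 4); (1, 5); (2, 6); (0, 1)]%N)) => //.
Qed.


Let b0 := rank ([[klein 0]] * f).
Let w1 := rank ([[klein 1]] * f).

Lemma gcommr p q : gcheck 7 0 true (gmul p q) (gmul q p) ->
  ok_gring 7 true p && ok_gring 7 true q -> [[p]] * ([[q]] * f) = [[q]] * ([[p]] * f).
Proof.
move=> cpq /andP[okp okq]; rewrite !mulrA; congr (_ * f).
by apply: (gcommP HR H0); rewrite okp okq cpq.
Qed.

Lemma gmulr p q p' : ok_gring 7 true p && ok_gring 7 true q && gcheck 7 0 true (gmul p q) p' ->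
  [[p]] * ([[q]] * f) = [[p']] * f.
Proof. by move=> H; rewrite mulrA (gmulP HR H0 H). Qed.

Lemma klein_quadruple : f *+ 4 = [[klein 0]] * f + [[klein_compl]] * f.
Proof.
rewrite -mulrDl -gevalD -mulr_natl; congr (_ * f).
have -> : 4%:R = geval R [:: (Posz 4, [::])].
  by rewrite /geval big_seq1 /= (wr_nil HR).
by apply: (gcheckP HR H0); vm_compute.
Qed.

Lemma klein_compl_sum :
  [[klein_compl]] * f = [[klein 1]] * f + [[klein 2]] * f + [[klein 3]] * f.
Proof.
rewrite -!mulrDl -!gevalD; congr (_ * f).
by apply: (gcheckP HR H0); vm_compute.
Qed.

Definition gscale16 (p : gring) : gring := [seq (sw.1 * 16, sw.2) | sw <- p].

(** Since [p q p] is 16 times [p], passing through [q] loses no rank of [p]; the factor is harmless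
    by [rk_quadruple]. *)
Lemma rk_corner p q :
  [&& ok_gring 7 true p, ok_gring 7 true q
    & gcheck 7 0 true (gmul (gmul p q) p) (gscale16 p)] ->
  (rank ([[p]] * f) <= rank ([[p]] * ([[q]] * f)))%N /\
  (rank ([[p]] * f) <= rank ([[q]] * f * [[p]]))%N.
Proof.
move=> /and3P[okp okq /(gcheckP HR H0)].
rewrite (gevalM HR) ?ok_gmul // (gevalM HR) //.
have -> : geval R (gscale16 p) = [[p]] *+ 4 *+ 4.
  rewrite /geval big_map -!sumrMnl; apply: eq_bigr => sw _.
  by rewrite mulrzA -mulrnA.
move=> pqp; have pf := rel_geval relf okp.
have rk16 : rank ([[p]] * f) = rank ([[p]] * [[q]] * [[p]] * f).
  by rewrite pqp !mulrnAl !rk_quadruple.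
split; rewrite rk16; first by rewrite -!mulrA pf !mulrA -(mulrA _ _ f) rkMr.
by rewrite -!mulrA -pf rkMl.
Qed.

(* The Klein components of f other than the fixed one are permuted cyclically *)
(* by the 3-cycle c.                                                          *)
Lemma rk_cycle_klein_ge : (2 * w1 <= rank ([[klein_compl]] * ([[gminus c]] * f)))%N.
Proof.
pose q := gmul klein_compl (gminus c).
have qE : [[klein_compl]] * ([[gminus c]] * f) = [[q]] * f.
  by rewrite mulrA -(gevalM HR).
have [|r1 _] := rk_corner (p := klein 1) (q := q); first by vm_compute.
have [|_ r2] := rk_corner (p := klein 2) (q := q); first by vm_compute.
have e0 : [[klein 1]] * ([[q]] * f) * [[klein 2]] = 0.
  rewrite -!mulrA -(rel_geval relf) // !mulrA -(gevalM HR) // -(gevalM HR) //.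
  rewrite (gcheckP (q := [::]) HR H0); last by vm_compute.
  by rewrite /geval big_nil mul0r.
rewrite qE; apply: leq_trans (rk_frobenius0 rf e0).
have [k2 _] := klein_rkE; move: r1 r2; rewrite k2 -/w1.
by move: (rank _) (rank _) => *; lia.
Qed.

(** [klein 0] and [klein_compl] annihilate each other, so the contributions of 1 - c on the fixed
    part and on the three other parts add up. *)
Lemma rk_cycle_ge :
  (2 * w1 + rank ([[gminus c]] * ([[klein 0]] * f)) <= rank ([[gminus c]] * f))%N.
Proof.
rewrite addnC (@leq_trans (rank ([[klein 0]] * ([[gminus c]] * f)) +
  rank ([[klein_compl]] * ([[gminus c]] * f)))%N) //.
  rewrite gcommr //; exact: leq_add rk_cycle_klein_ge.
apply: rk_orth.
  exact: (stab_geval H0 HR relf).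
rewrite mulrA -!(gevalM HR) // (gcheckP (q := [::]) HR H0); last by vm_compute.
by rewrite /geval big_nil mul0r.
Qed.

(** On the three non-trivial parts, of total rank at most [3 w1], the norm [y] = 1 + c + c^-1 has
    rank at least [w1] and is killed by 1 - c; this leaves at most [2 w1] for 1 - c. *)
Lemma rk_cycle_le :
  (rank ([[gminus c]] * f) <= 2 * w1 + rank ([[gminus c]] * ([[klein 0]] * f)))%N.
Proof.
have [k2 k3] := klein_rkE.
pose y : gring := gadd gone (gadd (gw c) (gw (cycle3 0 2 1))).
have orth : (rank ([[gminus c]] * ([[klein_compl]] * f)) +
             rank ([[y]] * ([[klein_compl]] * f)) <= 3 * w1)%N.
  apply: (@leq_trans (rank ([[klein_compl]] * f))); last first.
    rewrite klein_compl_sum; apply: leq_trans (rkD _ _ _) _.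
    have := rkD rf ([[klein 1]] * f) ([[klein 2]] * f).
    by rewrite k2 k3 -/w1; move: (rank _) => *; lia.
  apply: rk_orth; first exact: (stab_geval H0 HR relf).
  rewrite mulrA -!(gevalM HR) // (gcheckP (q := [::]) HR H0); last by vm_compute.
  by rewrite /geval big_nil mul0r.
have ge_w1 : (w1 <= rank ([[y]] * ([[klein_compl]] * f)))%N.
  rewrite mulrA -(gevalM HR) //.
  have [|r1 _] := rk_corner (p := klein 1) (q := gmul y klein_compl); first by vm_compute.
  exact: leq_trans r1 (rkMl _ _ _).
rewrite -rk_quadruple -mulrnAr klein_quadruple mulrDr.
apply: leq_trans (rkD _ _ _) _.
by move: (rank _) (rank _) (rank _) orth ge_w1 => *; lia.
Qed.

Lemma rk_klein_sum : rank f = (b0 + 3 * w1)%N.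
Proof. exact: (klein_split rk_double HR4 rel_four). Qed.

Lemma rank1_klein0_h : (b0 <= 1)%N -> [[gminus h]] * ([[klein 0]] * f) = 0.
Proof.
move=> le1; apply/(gminus_eq0 HR); rewrite -gevalw; apply: rank1_h => //.
  exact: (stab_geval H0 HR relf).
by rewrite gcommr // -mulrA -(rel_geval relf).
Qed.

Lemma rank1_klein0_c : (b0 <= 1)%N -> [[gminus c]] * ([[klein 0]] * f) = 0.
Proof.
move=> le1; apply/(gminus_eq0 HR); rewrite -gevalw; apply: rank1_c => //.
  exact: (stab_geval H0 HR relf).
by rewrite gcommr // -mulrA -(rel_geval relf).
Qed.

Lemma rank1_klein1_h : (w1 <= 1)%N -> [[gminus h]] * ([[klein 1]] * f) = 0.
Proof.
move=> le1; apply/(gminus_eq0 HR); rewrite -gevalw; apply: rank1_h => //.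
  exact: (stab_geval H0 HR relf).
by rewrite gcommr // -mulrA -(rel_geval relf).
Qed.

(** [h] moves none of the points 0, 1, 2, 3, so [klein_split] applies to (1 - h) f. *)
Lemma rk_minus_h : rank ([[gminus h]] * f) =
  (rank ([[gminus h]] * ([[klein 0]] * f)) +
   3 * rank ([[gminus h]] * ([[klein 1]] * f)))%N.
Proof.
have relh : rel_rep 4 true R ([[gminus h]] * f).
  move=> w okw; rewrite -gevalw mulrA.
  have okw7 : ok_word 7 true w by apply: ok_word_widen okw.
  have -> : [[gw w]] * [[gminus h]] = [[gminus h]] * [[gw w]].
    rewrite (gevalM1 HR) gevalw mulrBr mulrBl mulr1 mul1r; congr (_ - _).
    rewrite -!(wr_cat HR) //; apply: (wr_key HR); rewrite ?ok_word_cat //.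
    by apply: (word_key_comm 7 (k := 4)) => //; case/andP: okw.
  by rewrite -mulrA (rel_geval relf) ?mulrA //= okw7.
rewrite (klein_split rk_double HR4 relh).
by rewrite -!(gcommr (p := gminus h)).
Qed.

(** The conjugate elements 1 - c and 1 - h have equal rank. If [w1] were 2, then [b0] would be at
    most 1 and both 3-cycles trivial on the fixed part; the rank would be 4 when computed with [c]
    and a multiple of 3 when computed with [h]. *)
Lemma rk_klein1_le1 : (rank f <= 7)%N -> (w1 <= 1)%N.
Proof.
move=> rf7; have := rk_klein_sum; rewrite leqNgt => sumE; apply/negP => w1_gt1.
have w1E : w1 = 2%N by lia.
have le_b0 : (b0 <= 1)%N by lia.
have := rk_minus_h; have := rk_cycle_ge; have := rk_cycle_le.
rewrite rk_cycle_conj (rank1_klein0_c le_b0) (rank1_klein0_h le_b0) (rk0 rf) w1E.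
by move: (rank _) (rank _) => *; lia.
Qed.

Lemma seven_klein1 : (rank f <= 7)%N -> [[gminus h]] * ([[klein 1]] * f) = 0.
Proof. by move=> /rk_klein1_le1; apply: rank1_klein1_h. Qed.

Lemma seven_klein_compl : (rank f <= 7)%N -> [[gminus h]] * ([[klein_compl]] * f) = 0.
Proof.
move=> rf7; rewrite klein_compl_sum !mulrDr (seven_klein1 rf7) add0r.
have h1 : [[gmul (gminus h) (klein 1)]] * f = 0.
  by rewrite (gevalM HR) // -mulrA seven_klein1.
have h2 : [[gmul (gminus h) (klein 2)]] * f = 0.
  by apply: (conj_null H0 HR (s := c) relf _ h1); vm_compute.
have h3 : [[gmul (gminus h) (klein 3)]] * f = 0.
  by apply: (conj_null H0 HR (s := cycle3 0 2 1) relf _ h1); vm_compute.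
by rewrite !mulrA -!(gevalM HR) // h2 h3 addr0.
Qed.

Lemma seven_bitransp : (rank f <= 7)%N ->
  [[gminus h]] * ([[gminus (bitransp 0 1 2 3)]] * f) = 0.
Proof.
move=> rf7; apply/(quadruple_eq0 rk_double).
rewrite -!mulrnAr klein_quadruple !mulrDr.
have -> : [[gminus (bitransp 0 1 2 3)]] * ([[klein 0]] * f) = 0.
  rewrite (gmulr (p' := [::])); last by vm_compute.
  by rewrite /geval big_nil mul0r.
rewrite mulr0 add0r mulrA (gcommP HR H0 (p' := gminus h)
  (q' := gminus (bitransp 0 1 2 3))) //.
by rewrite -mulrA seven_klein_compl ?mulr0.
Qed.

(** If [w1 = 0], double transpositions are trivial on [f], hence so is [c]. If [w1 = 1], [h] is
    trivial outside the fixed part, and comparing the ranks of 1 - c and 1 - h gives 2 + rank Y at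
    most [b0], which is at most 3. So [Y] has rank at most 1 and [rank1_h] makes [h] trivial on
    it. *)
Lemma seven_key : (rank f <= 6)%N -> [[gminus h]] * ([[gminus c]] * f) = 0.
Proof.
move=> rf6; have rf7 : (rank f <= 7)%N by apply: leq_trans rf6 _.
have := rk_klein1_le1 rf7; rewrite leq_eqVlt ltnS leqn0 => /orP[]/eqP w1E; last first.
  have [b1f _ _] := klein_trivial rk_double HR4 rel_four w1E.
  have b1f0 : [[gminus (bitransp 0 1 2 3)]] * f = 0 by apply/(gminus_eq0 HR).
  have b2f : R [:: (0, 1); (3, 4)]%N * f = f.
    apply/(gminus_eq0 HR); apply: (conj_null H0 HR relf _ b1f0 (s := [:: (0, 1); (2, 4)]%N)).
    by vm_compute.
  have b3f : R [:: (3, 4); (0, 2)]%N * f = f.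
    apply/(gminus_eq0 HR); apply: (conj_null H0 HR relf _ b1f0
      (s := [:: (0, 3); (1, 4)]%N)).
    by vm_compute.
  have -> : [[gminus c]] * f = 0; last by rewrite mulr0.
  apply/(gminus_eq0 HR); rewrite (wr_key HR (w' := [:: (0, 1); (3, 4)] ++ [:: (3, 4); (0, 2)]%N)) //.
  by rewrite (wr_cat HR) // -mulrA b3f b2f.
apply/(quadruple_eq0 rk_double).
pose Y := [[gminus c]] * ([[klein 0]] * f).
have kc : [[gminus h]] * ([[gminus c]] * ([[klein_compl]] * f)) = 0.
  rewrite mulrA (gcommP HR H0 (p' := gminus h) (q' := gminus c)) //.
  by rewrite -mulrA seven_klein_compl ?mulr0.
rewrite -!mulrnAr klein_quadruple !mulrDr kc addr0 -/Y.
have YE : Y = [[gmul (gminus c) (klein 0)]] * f by rewrite /Y (gevalM HR) // mulrA.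
have rY : (rank Y <= 1)%N.
  have := rk_cycle_ge; rewrite -/Y -rk_cycle_conj rk_minus_h.
  rewrite rank1_klein1_h ?w1E // (rk0 rf).
  have := rkMl rf [[gminus h]] ([[klein 0]] * f); rewrite -/b0.
  have := rk_klein_sum; rewrite w1E; move: rf6 (rank Y) (rank (_ * _)).
  by move: (rank f) b0 => *; lia.
apply/(gminus_eq0 HR); rewrite -gevalw; apply: rank1_h => //; last first.
  by rewrite YE gcommr // -mulrA -(rel_geval relf).
(* From s (1 - c) = (1 - c^-1) s = (1 - c)(- c^-1 s): this is how [s] stabilises the image of
   [Y]. *)
exists [[gopp (gmul (gw (cycle3 0 2 1)) (gw s))]].
rewrite YE -mulrA -(rel_geval relf) // !mulrA; congr (_ * f).
by apply: (gcommP HR H0); vm_compute.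
Qed.

End SevenPoints.

(** * Disjoint 3-cycles in characteristic different from 2 *)

Definition gmap (s : nat -> nat) (p : gring) : gring :=
  [seq (sw.1, [seq (s ij.1, s ij.2) | ij <- sw.2]) | sw <- p].

Section PointTools.
Variables (T : finType) (E : pzRingType) (r : {perm T} -> E).

Lemma geval_map x s p : geval (word_op r (x \o s)) p = geval (word_op r x) (gmap s p).
Proof.
rewrite /geval big_map; apply: eq_bigr => sw _ /=.
by rewrite /word_op word_perm_map.
Qed.

Lemma points_comp k k' (S : {set T}) x s : points k S x ->
  all (fun i => s i < k)%N (iota 0 k') && uniq [seq s i | i <- iota 0 k'] ->
  points k' S (x \o s).
Proof.
move=> [injx xS] /andP[/allP lts us].
have lt i : (i < k')%N -> (s i < k)%N by move=> lti; apply: lts; rewrite mem_iota.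
split=> [i j lti ltj|i /lt/xS //] /= /injx e.
have {e} : s i = s j by apply: e; exact: lt.
have szE : size [seq s i | i <- iota 0 k'] = k' by rewrite size_map size_iota.
move/uniqP : us => /(_ 0%N); rewrite szE => us e; apply: us => //.
by rewrite !(nth_map 0%N) ?size_iota // !nth_iota.
Qed.

Lemma points_extend k k' (S : {set T}) x : points k S x -> (k <= k' <= #|S|)%N ->
  exists2 y, points k' S y & forall i, (i < k)%N -> y i = x i.
Proof.
move=> px /andP[le_kk' leS].
have [e|lt] := leqP k' k; first by exists x => //; apply: pointsW px.
have [|| z pz] := @points_ex T (k' - k) (S :\: point_set k x).
- by rewrite (card_rest px); lia.
- by rewrite (card_rest px); lia.
exists (cat_points k x z); last by move=> i lti; rewrite /cat_points lti.
have := points_cat (points_point_set px) pz (disjoint_rest k S x).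
by apply: pointsW; [lia|rewrite subUset (point_set_sub px) subsetDl].
Qed.

Lemma geval_shift k x y p : (forall i, (i < k)%N -> x i = y i) -> ok_gring k false p ->
  geval (word_op r x) p = geval (word_op r y) p.
Proof.
move=> exy /allP okp; apply: eq_big_seq => sw /okp /andP[wfw _].
by rewrite (word_op_shift r exy).
Qed.

End PointTools.

Definition disjoint_cycles_null (T : finType) (E : pzRingType) (r : {perm T} -> E) f :=
  forall x, points 6 [set: T] x ->
  geval (word_op r x) (gminus (cycle3 3 4 5)) *
    (geval (word_op r x) (gminus (cycle3 0 1 2)) * f) = 0.

Section OddKey.
Variables (T : finType) (E : pzRingType) (rf : rank_function E) (r : {perm T} -> E).
Hypothesis HP : perm_rep true r.
Hypothesis rk_double : forall x : E, rk rf (x + x) = rk rf x.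
Local Notation rank := (rk rf).
Let H0 : 0%:R = 0 :> E := erefl.

Lemma disjoint_shift k k' (S : {set T}) z : points (k + k') S z ->
  points k' (S :\: point_set k z) (z \o addn k).
Proof.
move=> [injz zS]; split=> [i j lti ltj|i lti] /=.
  move/injz => e; have /e : (k + i < k + k')%N by rewrite ltn_add2l.
  by rewrite inE /= ltn_add2l => /(_ ltj)/addnI.
rewrite inE zS ?ltn_add2l // andbT; apply/negP => /imsetP[j _ /injz e].
have ltj := ltn_ord j; have : (k + i)%N = j by apply: e; rewrite inE /=; lia.
lia.
Qed.

(** A second Klein group, on 4, 5, 6, 7, acts on the part [X] of rank at most 3. It is trivial
    unless its three non-trivial parts have rank 1 and exhaust [X]. In that case (0 1)(8 9) and its
    conjugate (0 1)(4 5) act on [X] by the same sign, so their product (4 5)(8 9) is trivial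
    there. *)
Lemma klein1_rank3 (S : {set T}) z f : points 10 S z -> rel_set true r S f ->
  (rank (geval (word_op r z) (klein 1) * f) <= 3)%N ->
  geval (word_op r z) (gmul (gminus (bitransp 4 5 6 7)) (klein 1)) * f = 0.
Proof.
move=> pz relS; set R := word_op r z; set X := geval R (klein 1) * f => rX.
have HR : word_rep 10 true R := points_rep HP pz.
have relf : rel_rep 10 true R f := rel_points pz relS.
have pz4 : points (4 + 4) S z by apply: pointsW pz.
have py := disjoint_shift pz4.
have pz' : points 4 S z by apply: pointsW pz.
have relX : rel_set true r (S :\: point_set 4 z) X.
  exact: (rel_mul_disjoint HP (points_point_set pz') (disjoint_rest 4 S z) _ (subsetDl _ _) relS).
have HRy := points_rep HP py.
have sumK := klein_sum HRy isT.
have := klein_split rk_double HRy (rel_points py relX).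
case w0 : (rank (geval _ (klein 1) * X)) => [|w] rkX.
  have [b1 _ _] := klein_trivial rk_double HRy (rel_points py relX) w0.
  rewrite (gevalM HR) // -mulrA; apply/(gminus_eq0 HR); rewrite -[RHS]b1.
  by rewrite /R /word_op word_perm_map.
have {w rkX w0} [rk1 k0] : (rank (geval (word_op r (z \o addn 4)) (klein 1) * X) <= 1)%N /\
    geval (word_op r (z \o addn 4)) (klein 0) * X = 0.
  split; first by rewrite w0; lia.
  by apply/(rk_eq0 rf); move: rX rkX; move: (rank X) (rank _) => *; lia.
move: sumK rk1 k0; rewrite !(geval_map r z (addn 4)) => sumK rk1 k0.
pose K i := gmap (addn 4) (klein i).
have XE p : ok_gring 10 true p -> geval R p * X = geval R (gmul p (klein 1)) * f.
  by move=> okp; rewrite mulrA (gevalM HR).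
have yy : geval R (gw (bitransp 0 1 8 9)) * geval R (gw (bitransp 0 1 8 9)) = 1.
  by rewrite -(geval1 HR); apply: (gwM H0 HR); vm_compute.
have sy : stab (geval R (gw (bitransp 0 1 8 9))) (geval R (K 1) * X).
  rewrite XE //; apply: (stab_geval H0 HR relf); by vm_compute.
(* The 3-cycles of 4, 5, 6 commute with [y] and permute the parts [K 1], [K 2], [K 3], so the sign
   of [y] on one of them is its sign on all of [X]. *)
have y_scalar q : [|| q == gplus (bitransp 0 1 8 9) | q == gminus (bitransp 0 1 8 9)] ->
    geval R q * (geval R (K 1) * X) = 0 -> geval R q * X = 0.
  move=> qE q1.
  have okq : ok_gring 10 true q by case/orP: qE => /eqP->.
  have {}q1 : geval R (gmul q (gmul (K 1) (klein 1))) * f = 0.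
    by rewrite (gevalM HR (p := q)) // (gevalM HR (p := K 1)) // -!mulrA.
  have q2 : geval R (gmul q (gmul (K 2) (klein 1))) * f = 0.
    apply: (conj_null H0 HR relf _ q1 (s := cycle3 4 5 6)).
    by case/orP: qE => /eqP->; vm_compute.
  have q3 : geval R (gmul q (gmul (K 3) (klein 1))) * f = 0.
    apply: (conj_null H0 HR relf _ q1 (s := cycle3 4 6 5)).
    by case/orP: qE => /eqP->; vm_compute.
  apply/(quadruple_eq0 rk_double); rewrite -mulrnAr -mulr_natl -sumK !mulrDl !mulrDr k0.
  move: q1 q2 q3; rewrite !(gevalM HR (p := q)) // !(gevalM HR (q := klein 1)) //.
  by rewrite -!mulrA => -> -> ->; rewrite mulr0 !addr0.
pose y := bitransp 0 1 8 9; pose y' := bitransp 0 1 4 5.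
have y_conj p q : [&& ok_gring 10 true p, ok_gring 10 true q
    & gcheck 10 0 true (gmul (gw (bitransp 4 8 5 9)) (gmul p (klein 1)))
                       (gmul (gmul q (klein 1)) (gw (bitransp 4 8 5 9)))] ->
    geval R p * X = 0 -> geval R q * X = 0.
  move=> /and3P[okp okq cpq] pX; rewrite XE //.
  apply: (conj_null H0 HR relf (s := bitransp 4 8 5 9) _ (p := gmul p (klein 1))).
    by rewrite cpq !ok_gmul.
  by rewrite -XE.
have yy'X : R (bitransp 4 5 8 9) * X = X.
  rewrite (wr_key HR (w' := y' ++ y)) // (wr_cat HR) // -mulrA.
  have [yX|yX] := rank1_invol rk_double rk1 yy sy.
    have e : geval R (gminus y) * X = 0.
      apply: y_scalar; first by rewrite eqxx orbT.
      by apply/(gminus_eq0 HR); rewrite -gevalw.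
    have /(gminus_eq0 HR) e' := y_conj (gminus y) (gminus y') isT e.
    by move/(gminus_eq0 HR): e => ->.
  have e : geval R (gplus y) * X = 0.
    apply: y_scalar; first by rewrite eqxx.
    by rewrite (gevalP1 HR) mulrDl mul1r -gevalw yX subrr.
  have := y_conj (gplus y) (gplus y') isT e; move: e.
  rewrite !(gevalP1 HR) !mulrDl !mul1r => /eqP; rewrite addrC addr_eq0 => /eqP->.
  by move=> /eqP; rewrite addrC addr_eq0 mulrN => /eqP->; rewrite opprK.
apply: (conj_null H0 HR relf (s := bitransp 6 8 7 9) _
  (p := gmul (gminus (bitransp 4 5 8 9)) (klein 1))); first by vm_compute.
by rewrite -XE //; apply/(gminus_eq0 HR).
Qed.

(* Beyond n = 8 the group Alt(n-4) is too large to act on a weight space of   *)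
(* the Klein group; for n = 7 and n = 8 ranks of 3-cycles are compared.        *)
Lemma disjoint_bitransp_cycle_null x : points 7 [set: T] x ->
  (7 <= #|T|)%N -> (rank 1%R < #|T|)%N ->
  geval (word_op r x) (gminus (cycle3 4 5 6)) *
    geval (word_op r x) (gminus (bitransp 0 1 2 3)) = 0.
Proof.
move=> px n_ge7 rk1; have HRx := points_rep HP px.
have [n_le8|n_gt8] := leqP #|T| 8.
  rewrite -[geval _ (gminus (bitransp _ _ _ _))]mulr1.
  by apply: (seven_bitransp rk_double HRx (@rel_rep1 _ _ _ _)); lia.
have [|z pz zx] := points_extend (k' := 9) px; first by rewrite cardsT; lia.
have HR := points_rep HP pz; set R := word_op r z in HR.
have pz4 : points 4 setT z by apply: pointsW pz.
have py : points 4 (setT :\: point_set 4 z) (z \o addn 4).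
  by apply: disjoint_shift; apply: pointsW pz.
have rkE := klein_split rk_double (word_rep_restrict HR (isT : (4 <= 9)%N))
  (@rel_rep1 E 4 true R).
have triv : geval R (gmul (gminus (bitransp 4 5 6 7)) (klein 1)) * 1 = 0.
  (* Three times this rank is less than the number of points, so the second case only occurs for 10
     or 11 points, with rank exactly 3. *)
  have [k3|k3] := ltnP (rank (geval R (klein 1) * 1)) (3 * ((#|T| - 4) %/ 4)).
    rewrite (gevalM HR) // -mulrA; apply/(gminus_eq0 HR).
    have := bitransp_trivial HP rk_double (f := geval R (klein 1) * 1) _ k3 _ py.
    rewrite {1}/word_op (word_perm_map z (addn 4)); apply.
      by rewrite (card_rest pz4) cardsT mulnC leq_trunc_div.
    apply: (rel_mul_disjoint HP (points_point_set pz4) (disjoint_rest 4 setT z) _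
      (subsetDl _ _)) => //; exact: rel_set1.
  have [|u pu uz] := points_extend (k' := 10) pz.
    by rewrite cardsT; move: (rank _) (rank _) k3 rkE rk1 => *; lia.
  have e p : ok_gring 9 false p -> geval (word_op r u) p = geval R p.
    by apply: geval_shift.
  rewrite -e //; apply: (klein1_rank3 pu); first exact: rel_set1.
  rewrite e //.
  by move: (rank _) (rank _) k3 rkE rk1 => *; lia.
have rel1 := @rel_rep1 E 9 true R.
have b'K w s : [&& ok_word 9 true s, ok_word 9 true w
    & gcheck 9 0 true (gmul (gw s) (gmul (gminus (bitransp 4 5 6 7)) (klein 1)))
        (gmul (gmul (gminus w) (klein 1)) (gw s))] ->
    R w * (geval R (klein 1) * 1) = geval R (klein 1) * 1.
  move=> /and3P[oks okw cw]; have ok1 : ok_gring 9 true (gminus w) by rewrite /= okw.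
  apply/(gminus_eq0 HR); rewrite mulrA -(gevalM HR) //.
  by apply: (conj_null H0 HR rel1 _ triv (s := s)); rewrite oks cw !ok_gmul.
have h1 : geval R (gmul (gminus (cycle3 4 5 6)) (klein 1)) * 1 = 0.
  rewrite (gevalM HR) // -mulrA; apply/(gminus_eq0 HR).
  rewrite (wr_key HR (w' := bitransp 4 5 7 8 ++ bitransp 7 8 4 6)) // (wr_cat HR) // -mulrA.
  rewrite (b'K (bitransp 7 8 4 6) (bitransp 4 7 5 8)); last by vm_compute.
  by rewrite (b'K (bitransp 4 5 7 8) (bitransp 4 5 6 8)); last by vm_compute.
have h2 : geval R (gmul (gminus (cycle3 4 5 6)) (klein 2)) * 1 = 0.
  by apply: (conj_null H0 HR (s := cycle3 0 1 2) rel1 _ h1); vm_compute.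
have h3 : geval R (gmul (gminus (cycle3 4 5 6)) (klein 3)) * 1 = 0.
  by apply: (conj_null H0 HR (s := cycle3 0 2 1) rel1 _ h1); vm_compute.
have xz i : (i < 7)%N -> x i = z i by move=> lti; rewrite zx.
rewrite !(geval_shift r xz) //.
apply: (double_eq0 rk_double); rewrite -(gevalM HR) // -gevalD.
rewrite (gcheckP (q := gadd (gmul (gminus (cycle3 4 5 6)) (klein 2))
  (gmul (gminus (cycle3 4 5 6)) (klein 3))) HR H0); last by vm_compute.
by rewrite gevalD -[X in X + _]mulr1 h2 -[X in _ + X]mulr1 h3 addr0.
Qed.

(** With two points 6, 7 to spare, (0 1 2) is the product of (0 1)(6 7) and (6 7)(0 2), so 1 - c is
    a combination of elements covered by [disjoint_bitransp_cycle_null]. Seven points leave only one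
    to spare, and there [seven_key] is used. *)
Lemma odd_key : (7 <= #|T|)%N -> (rank 1%R < #|T|)%N -> disjoint_cycles_null r 1.
Proof.
move=> n_ge7 rk1 x px.
have [n7|n7] := eqVneq #|T| 7%N.
  have [|z pz zx] := points_extend (k' := 7) px; first by rewrite cardsT n7.
  have HR := points_rep HP pz.
  pose s := nth 0%N [:: 0; 1; 2; 6; 3; 4; 5]%N.
  have shuf : points 7 [set: T] (z \o s) by apply: points_comp pz _.
  have := seven_key rk_double (points_rep HP shuf) (@rel_rep1 _ _ _ _).
  rewrite !(geval_map r z s).
  have -> : gmap s (gminus (cycle3 4 5 6)) = gminus (cycle3 3 4 5) by [].
  have -> : gmap s (gminus (cycle3 0 1 2)) = gminus (cycle3 0 1 2) by [].
  have zx6 i : (i < 6)%N -> z i = x i by move=> lti; rewrite zx // ltnW.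
  by rewrite !(geval_shift r zx6) // => -> //; rewrite -ltnS -n7.
have [|z pz zx] := points_extend (k' := 8) px.
  by move: n_ge7; rewrite cardsT leq_eqVlt eq_sym (negPf n7).
have HR := points_rep HP pz; set R := word_op r z in HR.
have null s : all (fun i => s i < 8)%N (iota 0 7) && uniq [seq s i | i <- iota 0 7] ->
    geval R (gmap s (gminus (cycle3 4 5 6))) *
    geval R (gmap s (gminus (bitransp 0 1 2 3))) = 0.
  move=> us; rewrite -!geval_map.
  by apply: disjoint_bitransp_cycle_null => //; apply: points_comp pz us.
have xz i : (i < 6)%N -> x i = z i by move=> lti; rewrite zx.
rewrite mulr1 !(geval_shift r xz) //.
have n1 := null (nth 0 [:: 0; 1; 6; 7; 3; 4; 5])%N isT.
have n2 := null (nth 0 [:: 6; 7; 0; 2; 3; 4; 5])%N isT.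
rewrite (gcheckP (p := gminus (cycle3 0 1 2)) (q := gadd (gminus (bitransp 0 1 6 7))
  (gmul (gw (bitransp 0 1 6 7)) (gminus (bitransp 6 7 0 2)))) HR H0); last by vm_compute.
rewrite gevalD mulrDr [X in X + _]n1 add0r (gevalM HR) // mulrA.
rewrite (gcommP HR H0 (p' := gminus (cycle3 3 4 5)) (q' := gw (bitransp 0 1 6 7))) //.
by rewrite -mulrA [X in _ * X]n2 mulr0.
Qed.

End OddKey.

(* In characteristic 2, the idempotent that projects onto the image of 1 - c. *)
Definition ecyc (a b c : nat) : gring := gadd (gw (cycle3 a b c)) (gw (cycle3 a c b)).
Definition fcyc (a b c : nat) : gring := gadd gone (ecyc a b c).

(** * Splitting ranks in characteristic 2 *)

Section CharTwo.
Variables (E : pzRingType) (rf : rank_function E) (R : word -> E) (k : nat) (ev : bool).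
Hypothesis char2 : 2%:R = 0 :> E.
Hypothesis HR : word_rep k ev R.
Local Notation rank := (rk rf).
Local Notation "[[ p ]]" := (geval R p) (format "[[ p ]]").

Definition stab_words (ws : seq word) (F : E) := forall w, w \in ws -> stab (R w) F.

Lemma stab0 (F : E) : stab 0 F.
Proof. by exists 0; rewrite mul0r mulr0. Qed.

Lemma stab_gring ws F p : stab_words ws F -> all (fun sw => sw.2 \in ws) p ->
  stab [[p]] F.
Proof.
move=> sF; elim: p => [|[z w] p IH] /=; first by rewrite /geval big_nil => _; exact: stab0.
move=> /andP[wws pws]; rewrite /geval big_cons; apply: stabD; last exact: IH.
have [y ey] := sF w wws; exists (y *~ z); rewrite mulrzAl mulrzAr ey //.
Qed.

(** Modulo 2, [p] and [q] act as complementary orthogonal idempotents on the image of [Y]. *)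
Definition split_check (Y p q : gring) :=
  [&& ok_gring k ev Y, ok_gring k ev p, ok_gring k ev q,
      gcheck k 2 ev (gmul (gadd p q) Y) Y, gcheck k 2 ev (gmul (gmul p q) Y) [::]
    & gcheck k 2 ev (gmul q Y) (gmul Y q)].

Lemma ok_gadd p q : ok_gring k ev p -> ok_gring k ev q -> ok_gring k ev (gadd p q).
Proof. by move=> okp okq; rewrite /ok_gring all_cat; apply/andP. Qed.

Lemma rk_split ws Y p q F : stab_words ws F -> split_check Y p q ->
  all (fun sw => sw.2 \in ws) q ->
  rank ([[Y]] * F) = (rank ([[p]] * ([[Y]] * F)) + rank ([[q]] * ([[Y]] * F)))%N.
Proof.
move=> sF /and5P[okY okp okq /(gcheckP HR char2)] + /andP[/(gcheckP HR char2)].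
rewrite !(gevalM HR) ?ok_gmul ?ok_gadd // gevalD => pqY pq0 /(gcheckP HR char2).
rewrite !(gevalM HR) // => qY qws.
apply/eqP; rewrite eqn_leq; apply/andP; split.
  by rewrite -{1}pqY -mulrA mulrDl rkD.
apply: rk_orth; last by rewrite mulrA pq0 /geval big_nil mul0r.
have [y ey] := stab_gring sF qws.
by exists y; rewrite mulrA qY -mulrA ey mulrA.
Qed.

(** The unit [u] exchanges the two summands of [rk_split]. Typically [u] is an involution inverting
    a 3-cycle [c]: on the image of c + c^-1 the two generate a copy of the 2 by 2 matrices over F_2,
    with idempotents c + u and c^-1 + u. *)
Lemma rk_even_split ws Y p q u F : stab_words ws F -> split_check Y p q ->
  all (fun sw => sw.2 \in ws) q -> u \in ws -> rev u \in ws ->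
  [&& ok_word k ev u, gcheck k 2 ev (gmul (gmul (gw u) p) Y) (gmul (gmul q Y) (gw u))
    & gcheck k 2 ev (gmul (gmul (gw (rev u)) q) Y) (gmul (gmul p Y) (gw (rev u)))] ->
  rank ([[Y]] * F) = (2 * rank ([[gmul p Y]] * F))%N.
Proof.
move=> sF chk qws uws vws /and3P[oku /(gcheckP HR char2) + /(gcheckP HR char2)].
have /and5P[okY okp okq _ _] := chk.
have [uv vu] := gevalK HR oku.
have okv : ok_gring k ev (gw (rev u)).
  by move: oku; rewrite /= /ok_word /wf_word all_rev size_rev andbT.
have okgu : ok_gring k ev (gw u) by rewrite /= oku.
rewrite !(gevalM HR (p := gmul _ _)) ?ok_gmul //.
rewrite !(gevalM HR) // => upY vqY.
have [u' eu] := sF _ uws; have [v' ev'] := sF _ vws.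
have le1 : (rank ([[p]] * ([[Y]] * F)) <= rank ([[q]] * ([[Y]] * F)))%N.
  rewrite -(rk_unitl rf _ vu) !mulrA upY -2!mulrA gevalw eu.
  by rewrite !mulrA rkMr.
have le2 : (rank ([[q]] * ([[Y]] * F)) <= rank ([[p]] * ([[Y]] * F)))%N.
  rewrite -(rk_unitl rf _ uv) !mulrA vqY -2!mulrA gevalw ev'.
  by rewrite !mulrA rkMr.
have le12 : rank ([[q]] * ([[Y]] * F)) = rank ([[p]] * ([[Y]] * F)).
  by apply/eqP; rewrite eqn_leq le2.
by rewrite (rk_split sF chk qws) -mulrA le12 addnn mul2n.
Qed.

Lemma rel_stab ws f : rel_rep k ev R f -> all (ok_word k ev) ws -> stab_words ws f.
Proof. by move=> relf /allP okws w /okws/relf/stab_comm. Qed.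

Definition comm_check (Y : gring) (ws : seq word) :=
  ok_gring k ev Y &&
  all (fun w => ok_word k ev w && gcheck k 2 ev (gmul (gw w) Y) (gmul Y (gw w))) ws.

Lemma stab_comm_check ws Y f : rel_rep k ev R f -> comm_check Y ws ->
  stab_words ws ([[Y]] * f).
Proof.
move=> relf /andP[okY /allP chk] w /chk/andP[okw cw]; rewrite -gevalw.
apply: stab_mul; first by apply: (gcommP HR char2); rewrite /= okw okY cw.
by apply/stab_comm/(rel_geval relf); rewrite /= okw.
Qed.

Lemma rk_cycle_split a b c X : ok_gring k ev (ecyc a b c) ->
  gcheck k 2 ev (gmul (ecyc a b c) (fcyc a b c)) [::] -> stab [[fcyc a b c]] X ->
  rank X = (rank ([[ecyc a b c]] * X) + rank ([[fcyc a b c]] * X))%N.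
Proof.
move=> oke ef sX; have okf : ok_gring k ev (fcyc a b c).
  by apply: ok_gadd => //; rewrite /= /ok_word implybT.
have sum1 : [[ecyc a b c]] + [[fcyc a b c]] = 1.
  rewrite /fcyc (gevalD _ gone) (geval1 HR) addrCA -mulr2n -mulr_natl char2.
  by rewrite mul0r addr0.
apply/eqP; rewrite eqn_leq; apply/andP; split.
  by rewrite -{1}[X]mul1r -sum1 mulrDl rkD.
apply: rk_orth => //; rewrite -(gevalM HR) // (gcheckP HR char2 ef).
by rewrite /geval big_nil mul0r.
Qed.

End CharTwo.

(** * Divisibility of the multiplicities of commuting 3-cycles *)

Section NinePoints.
Variables (E : pzRingType) (rf : rank_function E) (R : word -> E).
Hypothesis char2 : 2%:R = 0 :> E.
Hypothesis HR : word_rep 9 true R.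
Local Notation rank := (rk rf).
Local Notation "[[ p ]]" := (geval R p) (format "[[ p ]]").

Let e1 := ecyc 0 1 2. Let f1 := fcyc 0 1 2.
Let e2 := ecyc 3 4 5. Let f2 := fcyc 3 4 5.
Let e3 := ecyc 6 7 8. Let f3 := fcyc 6 7 8.

Definition fpf_words : seq word :=
  [:: [::]; cycle3 0 1 2; cycle3 0 2 1; cycle3 3 4 5; cycle3 3 5 4; cycle3 6 7 8;
      cycle3 6 8 7; bitransp 3 4 6 7; bitransp 0 1 3 4;
      [:: (0, 3); (1, 5); (2, 4); (6, 7)]%N].

Lemma stab_words_cat w w' F : ok_word 9 true w -> ok_word 9 true w' ->
  stab (R w) F -> stab (R w') F -> stab (R (w ++ w')) F.
Proof. by move=> okw okw' sw sw'; rewrite (wr_cat HR) //; apply: stabM. Qed.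

(* The commuting 3-cycles c1, c2, c3 generate a product of four copies of F_4 *)
(* on the image of e1 e2 e3; the four factors are permuted transitively by    *)
(* inversions, and each of them is inverted by a further involution.          *)
Lemma dvd8_rank F : stab_words R fpf_words F ->
  [[gmul (gmul e1 e2) e3]] * F = F -> (8 %| rank F)%N.
Proof.
move=> sF eF.
pose c1 := cycle3 0 1 2; pose d1 := cycle3 0 2 1.
pose c2 := cycle3 3 4 5; pose d2 := cycle3 3 5 4.
pose c3 := cycle3 6 7 8; pose d3 := cycle3 6 8 7.
pose s : word := [:: (0, 3); (1, 5); (2, 4); (6, 7)]%N.
pose ws := fpf_words ++ [seq w ++ w' | w <- fpf_words, w' <- fpf_words] ++ [seq rev w | w <- fpf_words].
have sws : stab_words R ws F.
  have ok w0 : w0 \in fpf_words -> ok_word 9 true w0 by apply/allP: w0; vm_compute.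
  move=> w; rewrite /ws mem_cat => /orP[|]; first exact: sF.
  rewrite mem_cat => /orP[|].
    case/allpairsP=> p; case=> m1 m2 ->{w}.
    by apply: stab_words_cat; rewrite ?ok //; exact: sF.
  move=> /mapP[w1 m1 ->{w}].
  have : has (fun w' => word_key 9 (rev w1) == word_key 9 w') fpf_words.
    by apply/allP: w1 m1; vm_compute.
  move=> /hasP[w2 m2 /eqP e]; rewrite (wr_key HR _ (ok w2 m2) e); first exact: sF.
  by have := ok w1 m1; rewrite /ok_word /wf_word all_rev size_rev.
(* [p1] projects to the part where [c1 = c2] and [q1] to the one where [c1 = c2^-1]; [p2] and [q2]
   compare [c1] with [c3] in the same way. Where all three cycles agree, [s] inverts their common
   value, which yields [p3] and [q3]. *)
pose p1 := gadd gone (gadd (gw (c1 ++ d2)) (gw (d1 ++ c2))).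
pose q1 := gadd gone (gadd (gw (c1 ++ c2)) (gw (d1 ++ d2))).
pose p2 := gadd gone (gadd (gw (c1 ++ d3)) (gw (d1 ++ c3))).
pose q2 := gadd gone (gadd (gw (c1 ++ c3)) (gw (d1 ++ d3))).
pose p3 := gadd (gw c1) (gw s).
pose q3 := gadd (gw d1) (gw s).
pose Y0 := gmul (gmul e1 e2) e3.
have r0 := rk_even_split rf char2 HR (u := bitransp 3 4 6 7) (p := p1) (q := q1) (Y := Y0) sws _ _ _ _ _.
have r1 := rk_even_split rf char2 HR (u := bitransp 0 1 3 4) (p := p2) (q := q2) (Y := gmul p1 Y0) sws _ _ _ _ _.
have r2 := rk_even_split rf char2 HR (u := s) (p := p3) (q := q3) (Y := gmul p2 (gmul p1 Y0)) sws _ _ _ _ _.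
rewrite -eF r0; try by vm_compute.
rewrite r1; try by vm_compute.
rewrite r2; try by vm_compute.
by rewrite !mulnA dvdn_mulr.
Qed.

Definition prod3 (x y z : gring) := gmul x (gmul y z).

Variable f : E.
Hypothesis relf : rel_rep 9 true R f.
Local Notation v x y z := (rank ([[prod3 x y z]] * f)).

Lemma nine_even : (2 %| v e1 f2 f3)%N.
Proof.
pose ws : seq word := [:: cycle3 0 1 2; cycle3 0 2 1; bitransp 0 1 6 7; rev (bitransp 0 1 6 7)].
have sws : stab_words R ws f by apply: rel_stab relf _; vm_compute.
rewrite (rk_even_split rf char2 HR (u := bitransp 0 1 6 7)
  (p := gadd (gw (cycle3 0 1 2)) (gw (bitransp 0 1 6 7)))
  (q := gadd (gw (cycle3 0 2 1)) (gw (bitransp 0 1 6 7))) sws); try by vm_compute.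
exact: dvdn_mulr.
Qed.

(** (0 1)(6 7) inverts the first cycle and (3 4)(6 7) the second, independently of each other; each
    doubles the rank once. *)
Lemma nine_dvd4 : (4 %| v e1 e2 f3)%N.
Proof.
pose u := bitransp 0 1 6 7; pose u' := bitransp 3 4 6 7.
pose ws : seq word := [:: cycle3 0 1 2; cycle3 0 2 1; u; rev u;
  cycle3 3 4 5; cycle3 3 5 4; u'; rev u'].
have sws : stab_words R ws f by apply: rel_stab relf _; vm_compute.
rewrite (rk_even_split rf char2 HR (u := u) (p := gadd (gw (cycle3 0 1 2)) (gw u))
  (q := gadd (gw (cycle3 0 2 1)) (gw u)) sws); try by vm_compute.
rewrite (rk_even_split rf char2 HR (u := u') (p := gadd (gw (cycle3 3 4 5)) (gw u'))
  (q := gadd (gw (cycle3 3 5 4)) (gw u')) sws); try by vm_compute.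
by rewrite mulnA dvdn_mulr.
Qed.

Lemma nine_dvd8 : (8 %| v e1 e2 e3)%N.
Proof.
apply: dvd8_rank; first by apply: (stab_comm_check char2 HR relf); vm_compute.
rewrite mulrA -(gevalM HR) //; congr (_ * f).
by apply: (gcheckP HR char2); vm_compute.
Qed.

(** Three commuting idempotents cut [f] into eight parts. Conjugation permutes the cycles, so the
    rank of a part depends only on its number of factors [e], whence the coefficients 1, 3, 3, 1. *)
Lemma nine_split :
  [/\ rank f = (v f1 f2 f3 + 3 * v e1 f2 f3 + 3 * v e1 e2 f3 + v e1 e2 e3)%N,
      rank ([[e3]] * f) = (v e1 f2 f3 + 2 * v e1 e2 f3 + v e1 e2 e3)%N,
      rank ([[f3]] * f) = (v f1 f2 f3 + 2 * v e1 f2 f3 + v e1 e2 f3)%N,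
      rank ([[gmul e1 f2]] * f) = (v e1 f2 f3 + v e1 e2 f3)%N
    & rank ([[gmul e2 e1]] * f) = (v e1 e2 f3 + v e1 e2 e3)%N].
Proof.
have spl3 X : stab [[f3]] X -> rank X = (rank ([[e3]] * X) + rank ([[f3]] * X))%N.
  by apply: (rk_cycle_split _ char2 HR); vm_compute.
have spl2 X : stab [[f2]] X -> rank X = (rank ([[e2]] * X) + rank ([[f2]] * X))%N.
  by apply: (rk_cycle_split _ char2 HR); vm_compute.
have spl1 X : stab [[f1]] X -> rank X = (rank ([[e1]] * X) + rank ([[f1]] * X))%N.
  by apply: (rk_cycle_split _ char2 HR); vm_compute.
have st p q : [&& ok_gring 9 true p, ok_gring 9 true q
    & gcheck 9 2 true (gmul p q) (gmul q p)] -> stab [[p]] ([[q]] * f).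
  exact: (stab_geval char2 HR relf).
have st2 p q : ok_gring 9 true p -> ok_gring 9 true q ->
    gcheck 9 2 true (gmul p q) (gmul q p) -> stab [[p]] ([[q]] * f).
  by move=> okp okq c; apply: st; rewrite okp okq.
have st0 p : ok_gring 9 true p -> stab [[p]] f.
  by move=> okp; apply/stab_comm/(rel_geval relf).
have vE x y z : ok_gring 9 true x -> ok_gring 9 true y -> ok_gring 9 true z ->
    rank ([[x]] * ([[y]] * ([[z]] * f))) = v x y z.
  by move=> okx oky okz; rewrite (gevalM HR) ?ok_gmul // (gevalM HR) // !mulrA.
have st3 p q q' : ok_gring 9 true p -> ok_gring 9 true q -> ok_gring 9 true q' ->
    gcheck 9 2 true (gmul p (gmul q q')) (gmul (gmul q q') p) ->
    stab [[p]] ([[q]] * ([[q']] * f)).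
  by move=> okp okq okq' c; rewrite mulrA -(gevalM HR) //; apply: st2 => //; exact: ok_gmul.
have two y z : ok_gring 9 true y -> ok_gring 9 true z ->
    gcheck 9 2 true (gmul f1 (gmul y z)) (gmul (gmul y z) f1) ->
    rank ([[y]] * ([[z]] * f)) = (v e1 y z + v f1 y z)%N.
  by move=> oky okz c; rewrite (spl1 _ (st3 _ _ _ _ _ _ c)) // !vE.
have one z : ok_gring 9 true z -> gcheck 9 2 true (gmul f2 z) (gmul z f2) ->
    gcheck 9 2 true (gmul f1 (gmul e2 z)) (gmul (gmul e2 z) f1) ->
    gcheck 9 2 true (gmul f1 (gmul f2 z)) (gmul (gmul f2 z) f1) ->
    rank ([[z]] * f) = (v e1 e2 z + v f1 e2 z + (v e1 f2 z + v f1 f2 z))%N.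
  by move=> okz c c1 c2; rewrite (spl2 _ (st2 _ _ _ _ c)) // !two.
have cj w x y z x' y' z' : [&& ok_word 9 true w, ok_gring 9 true (prod3 x y z),
    ok_gring 9 true (prod3 x' y' z') & gcheck 9 2 true (gmul (gw w) (prod3 x y z))
      (gmul (prod3 x' y' z') (gw w))] -> v x y z = v x' y' z'.
  by move=> chk; apply: (rk_gconj rf char2 HR chk relf).
have a1 : v f1 e2 f3 = v e1 f2 f3 by apply: (cj (bitransp 0 3 1 4 ++ bitransp 2 5 6 7)); vm_compute.
have a2 : v f1 f2 e3 = v e1 f2 f3 by apply: (cj (bitransp 0 6 1 7 ++ bitransp 2 8 3 4)); vm_compute.
have a3 : v e1 f2 e3 = v e1 e2 f3 by apply: (cj (bitransp 3 6 4 7 ++ bitransp 5 8 0 1)); vm_compute.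
have a4 : v f1 e2 e3 = v e1 e2 f3 by apply: (cj (bitransp 0 6 1 7 ++ bitransp 2 8 3 4)); vm_compute.
have r3 : rank ([[e3]] * f) = (v e1 f2 f3 + 2 * v e1 e2 f3 + v e1 e2 e3)%N.
  by rewrite one ?a1 ?a2 ?a3 ?a4; try (by vm_compute); lia.
have s3 : rank ([[f3]] * f) = (v f1 f2 f3 + 2 * v e1 f2 f3 + v e1 e2 f3)%N.
  by rewrite one ?a1 ?a2 ?a3 ?a4; try (by vm_compute); lia.
have pair p x y : ok_gring 9 true p -> ok_gring 9 true (prod3 x y e3) ->
    ok_gring 9 true (prod3 x y f3) -> gcheck 9 2 true (gmul f3 p) (gmul p f3) ->
    gcheck 9 2 true (gmul e3 p) (prod3 x y e3) ->
    gcheck 9 2 true (gmul f3 p) (prod3 x y f3) ->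
    rank ([[p]] * f) = (v x y e3 + v x y f3)%N.
  move=> okp ok1 ok2 c c1 c2; rewrite (spl3 _ (st2 _ _ _ _ c)) // !mulrA -!(gevalM HR) //.
  by rewrite (gcheckP HR char2 c1) (gcheckP HR char2 c2).
split=> //.
- by have -> := spl3 f (st0 f3 isT); rewrite r3 s3; lia.
- by rewrite (pair _ e1 f2) ?a3; try (by vm_compute); lia.
- by rewrite (pair _ e1 e2); try (by vm_compute); lia.
Qed.

End NinePoints.

Section SevenPointsSym.
Variables (E : pzRingType) (rf : rank_function E) (R : word -> E).
Hypothesis char2 : 2%:R = 0 :> E.
Hypothesis HR : word_rep 7 false R.
Local Notation rank := (rk rf).
Local Notation "[[ p ]]" := (geval R p) (format "[[ p ]]").

Let e1 := ecyc 0 1 2. Let f1 := fcyc 0 1 2.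
Let e2 := ecyc 3 4 5. Let f2 := fcyc 3 4 5.

Definition fpf_sym_words : seq word :=
  [:: cycle3 0 1 2; cycle3 0 2 1; cycle3 3 4 5; cycle3 3 5 4; [:: (0, 1)]%N; [:: (3, 4)]%N].

(** In the symmetric group a transposition inverts one of the two cycles and commutes with the
    other, so no further points are needed. *)
Lemma dvd4_rank F : stab_words R fpf_sym_words F -> [[gmul e1 e2]] * F = F ->
  (4 %| rank F)%N.
Proof.
move=> sF eF; rewrite -eF.
rewrite (rk_even_split rf char2 HR (u := [:: (0, 1)]%N)
  (p := gadd (gw (cycle3 0 1 2)) (gw [:: (0, 1)]%N))
  (q := gadd (gw (cycle3 0 2 1)) (gw [:: (0, 1)]%N)) sF); try by vm_compute.
rewrite (rk_even_split rf char2 HR (u := [:: (3, 4)]%N)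
  (p := gadd (gw (cycle3 3 4 5)) (gw [:: (3, 4)]%N))
  (q := gadd (gw (cycle3 3 5 4)) (gw [:: (3, 4)]%N)) sF); try by vm_compute.
by rewrite mulnA dvdn_mulr.
Qed.

Variable f : E.
Hypothesis relf : rel_rep 7 false R f.

(** The index counts how many of the two disjoint 3-cycles act on the part through [ecyc]. *)
Lemma seven_sym_split : exists t0 t1 t2,
  [/\ rank f = (t0 + 2 * t1 + t2)%N, rank ([[e2]] * f) = (t1 + t2)%N,
      rank ([[gmul e2 e1]] * f) = t2,
      rank ([[gmul e1 f2]] * f) = t1 & (2 %| t1)%N && (4 %| t2)%N].
Proof.
have spl2 X : stab [[f2]] X -> rank X = (rank ([[e2]] * X) + rank ([[f2]] * X))%N.
  by apply: (rk_cycle_split _ char2 HR); vm_compute.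
have spl1 X : stab [[f1]] X -> rank X = (rank ([[e1]] * X) + rank ([[f1]] * X))%N.
  by apply: (rk_cycle_split _ char2 HR); vm_compute.
have vE x y z : ok_gring 7 false x -> ok_gring 7 false y -> gcheck 7 2 false (gmul x y) z ->
    rank ([[x]] * ([[y]] * f)) = rank ([[z]] * f).
  by move=> okx oky c; rewrite mulrA -(gevalM HR) // (gcheckP HR char2 c).
exists (rank ([[gmul f1 f2]] * f)), (rank ([[gmul e1 f2]] * f)), (rank ([[gmul e2 e1]] * f)).
have cj : rank ([[gmul f1 e2]] * f) = rank ([[gmul e1 f2]] * f).
  by apply: (rk_gconj rf char2 HR (w := [:: (0, 3); (1, 4); (2, 5)]%N) _ relf); vm_compute.
have r2 : rank ([[e2]] * f) = (rank ([[gmul e2 e1]] * f) + rank ([[gmul e1 f2]] * f))%N.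
  rewrite spl1; last by apply: (stab_geval char2 HR relf); vm_compute.
  by rewrite (vE _ _ (gmul e2 e1)) // (vE _ _ (gmul f1 e2)) // cj.
have s2 : rank ([[f2]] * f) = (rank ([[gmul e1 f2]] * f) + rank ([[gmul f1 f2]] * f))%N.
  rewrite spl1; last by apply: (stab_geval char2 HR relf); vm_compute.
  by rewrite (vE _ _ (gmul e1 f2)) // (vE _ _ (gmul f1 f2)).
have d1 : (2 %| rank ([[gmul e1 f2]] * f))%N.
  pose u : word := [:: (0, 1)]%N.
  have sws : stab_words R [:: cycle3 0 1 2; cycle3 0 2 1; u; rev u] f.
    by apply: rel_stab relf _; vm_compute.
  rewrite (rk_even_split rf char2 HR (u := u) (p := gadd (gw (cycle3 0 1 2)) (gw u))
    (q := gadd (gw (cycle3 0 2 1)) (gw u)) sws); try by vm_compute.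
  exact: dvdn_mulr.
have d2 : (4 %| rank ([[gmul e2 e1]] * f))%N.
  apply: dvd4_rank; first by apply: (stab_comm_check char2 HR relf); vm_compute.
  rewrite mulrA -(gevalM HR) //; congr (_ * f).
  by apply: (gcheckP HR char2); vm_compute.
split=> //; last by rewrite d1 d2.
- have sf : stab [[f2]] f by apply/stab_comm/(rel_geval relf).
  by rewrite (spl2 f sf) r2 s2; lia.
- by rewrite r2 addnC.
Qed.

End SevenPointsSym.

(** * The Klein group next to 3-cycles without fixed points, characteristic 2 *)

Section FixedPointFree.
Variables (E : pzRingType) (rf : rank_function E) (R : word -> E) (k : nat) (ev : bool).
Hypothesis char2 : 2%:R = 0 :> E.
Hypothesis HR : word_rep k ev R.
Local Notation rank := (rk rf).
Local Notation "[[ p ]]" := (geval R p) (format "[[ p ]]").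

Let b1 := bitransp 0 1 2 3.
Let b2 := bitransp 0 2 1 3.
Let b3 := bitransp 0 3 1 2.
Let c := cycle3 0 1 2.
Let d := cycle3 0 2 1.

(** Frobenius' inequality for [x], [y], [x]: the image of [x] lies in its kernel. *)
Lemma rk_square_zero (x y : E) : x * x = 0 -> x * y = y * x -> (2 * rank (x * y) <= rank y)%N.
Proof.
move=> xx xy; rewrite mul2n -addnn; have := @rk_frobenius0 _ rf x y x.
by rewrite -mulrA -xy mulrA xx mul0r; apply.
Qed.

Lemma ok_word_even w : ok_word k true w -> ok_word k ev w.
Proof. by move=> /andP[wfw /= evw]; rewrite /ok_word wfw evw implybT. Qed.

Lemma word_rep_even : word_rep k true R.
Proof.
split=> [|w w' okw okw'|w w' okw okw'].
- exact: wr_nil HR.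
- by apply: (wr_cat HR); exact: ok_word_even.
by apply: (wr_key HR); exact: ok_word_even.
Qed.

(* If (1 - b1)(1 - b2) kills X and c acts on it without fixed points, then    *)
(* 1 - b1 is semilinear for the structure defined by c.                       *)
Lemma klein_semilinear X : (4 <= k)%N ->
  rel_rep 4 true R X -> [[ecyc 0 1 2]] * X = X ->
  [[gmul (gminus b1) (gminus b2)]] * X = 0 ->
  [[gw c]] * ([[gminus b1]] * X) = [[gminus b1]] * X * [[gw d]].
Proof.
move=> k4 relX eX nX; have HR4 := word_rep_restrict word_rep_even k4.
have okX p : ok_gring 4 true p -> [[p]] * X = X * [[p]] by apply: rel_geval.
(* Modulo 2, c (1 - b1) + (1 - b1) c^-1 is [P c + Q c] plus the norm (1 - b1)(1 - b2). [P] is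
   annihilated by c + c^-1, which is 1 on [X]; [Q] ends with 1 + c + c^-1, which is 0 on [X]; the
   norm kills [X] by hypothesis. *)
pose P := gadd (gminus b1) (gadd (gmul (gminus b2) (gw c)) (gmul (gminus b3) (gw d))).
pose Q := gmul (gadd (gminus b1) (gminus b2)) (fcyc 0 1 2).
have PX : [[P]] * X = 0.
  rewrite okX // -eX -mulrA -okX // mulrA -(gevalM HR4) //.
  by rewrite (gcheckP (q := [::]) HR4 char2) ?(geval0, mul0r) //; vm_compute.
have QX : [[gmul Q (gw c)]] * X = 0.
  have fX : [[fcyc 0 1 2]] * X = 0.
    rewrite /fcyc gevalD mulrDl eX (geval1 HR4) mul1r -mulr2n -mulr_natl char2.
    exact: mul0r.
  rewrite (gevalM HR4) // -mulrA okX // (gevalM HR4) // -!mulrA (mulrA _ X) fX.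
  by rewrite mul0r mulr0.
have PcX : [[gmul P (gw c)]] * X = 0.
  by rewrite (gevalM HR4) // -mulrA okX // mulrA PX mul0r.
rewrite -[RHS]mulrA -okX // !mulrA -!(gevalM HR4) //.
have : [[gadd (gmul (gw c) (gminus b1)) (gmul (gminus b1) (gw d))]] * X = 0.
  rewrite (gcheckP (q := gadd (gmul P (gw c)) (gadd (gmul Q (gw c))
    (gmul (gminus b1) (gminus b2)))) HR4 char2); last by vm_compute.
  by rewrite !(gevalD _ (gmul _ _)) !mulrDl PcX QX nX !addr0.
rewrite (gevalD _ (gmul _ _)) mulrDl => /eqP; rewrite addr_eq0 => /eqP ->.
by apply/eqP; rewrite -subr_eq0 -opprD -mulr2n -mulr_natl char2 mul0r oppr0.
Qed.

Definition klein_norm : gring := gmul (gminus b1) (gminus b2).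

(* A group in which all multiplicities are divisible by D leaves no room for  *)
(* the Klein group to act on a module of rank less than 2D.                   *)
Lemma klein_trivial_fpf D Y ws f X : (4 <= k)%N -> X = [[Y]] * f ->
  rel_rep k ev R f -> rel_rep 4 true R X -> [[ecyc 0 1 2]] * X = X ->
  (forall F, stab_words R ws F -> [[ecyc 0 1 2]] * F = F -> [[Y]] * F = F ->
     (D %| rank F)%N) ->
  [&& ok_gring k ev Y, gcheck k 2 ev (gmul Y Y) Y,
      comm_check k ev Y [:: b1; b2], comm_check k ev (gmul klein_norm Y) ws
    & all (fun w => [|| w == c, w == d | comm_check k ev (gmul (gminus b1) Y) [:: w] ]) ws] ->
  (rank X < 2 * D)%N -> [[gminus b1]] * X = 0.
Proof.
move=> k4 XE relf relX eX HD /and5P[okY /(gcheckP HR char2) YY].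
move=> /andP[_ /and3P[/andP[_ cb1] /andP[_ cb2] _] ] cN /allP cM ltX.
have HR4 := word_rep_restrict word_rep_even k4.
have okX p : ok_gring 4 true p -> [[p]] * X = X * [[p]] by apply: rel_geval.
have widen w : ok_word 4 true w -> ok_word k ev w.
  by move=> okw; apply/ok_word_even/(ok_word_widen k4).
have okg w : ok_word 4 true w -> ok_gring k ev (gw w) by move=> /widen; rewrite /= => ->.
have okm w : ok_word 4 true w -> ok_gring k ev (gminus w).
  by move=> /widen okw; rewrite /ok_gring /= okw /ok_word /wf_word /= implybT.
have Yb w : ok_word 4 true w -> gcheck k 2 ev (gmul (gw w) Y) (gmul Y (gw w)) ->
    [[Y]] * [[gminus w]] = [[gminus w]] * [[Y]].
  move=> okw cw; rewrite (gevalB _ gone) (geval1 HR) mulrBl mulrBr mul1r mulr1.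
  by congr (_ - _); apply/esym/(gcommP HR char2); rewrite okY okg.
have YX : [[Y]] * X = X by rewrite XE mulrA -(gevalM HR) // YY.
have sq w : ok_word 4 true w -> gcheck 4 2 true (gmul (gminus w) (gminus w)) [::] ->
    [[gminus w]] * [[gminus w]] = 0.
  move=> okw cw; have okm4 : ok_gring 4 true (gminus w) by rewrite /= okw.
  by rewrite -(gevalM HR4) // (gcheckP HR4 char2 cw) geval0.
have m1 := sq b1 isT isT; have m2 := sq b2 isT isT.
have m12 : [[gminus b1]] * [[gminus b2]] = [[gminus b2]] * [[gminus b1]].
  by apply: (gcommP HR4 char2); vm_compute.
have e12 : [[ecyc 0 1 2]] * [[klein_norm]] = [[klein_norm]] * [[ecyc 0 1 2]].
  by apply: (gcommP HR4 char2); vm_compute.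
have NE : [[klein_norm]] = [[gminus b1]] * [[gminus b2]] by rewrite (gevalM HR4).
have leM : (2 * rank ([[gminus b1]] * X) <= rank X)%N.
  by apply: rk_square_zero m1 _; apply: okX.
(* Two successive square-zero factors leave at most a quarter of the rank of [X]; this is below [D]
   and divisible by [D]. *)
have NX : [[klein_norm]] * X = 0.
  have le1 : (2 * rank ([[gminus b2]] * X) <= rank X)%N.
    by apply: rk_square_zero m2 _; apply: okX.
  have le2 : (2 * rank ([[klein_norm]] * X) <= rank ([[gminus b2]] * X))%N.
    rewrite NE -mulrA; apply: rk_square_zero m1 _.
    by rewrite mulrA m12 -!mulrA okX.
  apply/(rk_eq0 rf); have : (D %| rank ([[klein_norm]] * X))%N.
    apply: HD.
    - rewrite XE mulrA -(gevalM HR) //; first exact: (stab_comm_check char2 HR relf).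
      by rewrite ok_gmul // okm.
    - by rewrite mulrA e12 -mulrA eX.
    by rewrite mulrA NE mulrA Yb // -(mulrA _ [[Y]]) Yb // !mulrA -(mulrA _ _ X) YX -mulrA.
  case: (rank ([[klein_norm]] * X)) le2 => // n0 le2 /dvdn_leq => /(_ isT).
  by move: le1 le2 ltX; move: (rank (_ * X)) (rank X) => *; lia.
have semi := klein_semilinear k4 relX eX NX.
(* By semilinearity the image of 1 - b1 is again stable under [c] and [c + c^-1] is 1 on it, so its
   rank, at most half that of [X], is a multiple of [D] smaller than [D]. *)
apply/(rk_eq0 rf); have : (D %| rank ([[gminus b1]] * X))%N.
  have cd : [[gw c]] * [[gw c]] = [[gw d]] by apply: (gwM char2 HR4); vm_compute.
  have dd : [[gw d]] * [[gw d]] = [[gw c]] by apply: (gwM char2 HR4); vm_compute.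
  have semi' : [[gw d]] * ([[gminus b1]] * X) = [[gminus b1]] * X * [[gw c]].
    by rewrite -cd -mulrA semi mulrA semi -mulrA dd.
  apply: HD.
  - move=> w wws; have /or3P := cM w wws; case=> [/eqP->|/eqP->|cw].
    + by exists [[gw d]]; rewrite -gevalw.
    + by exists [[gw c]]; rewrite -gevalw.
    rewrite XE mulrA -(gevalM HR) ?okm //.
    by apply: (stab_comm_check char2 HR relf cw); rewrite inE.
  - rewrite /ecyc gevalD mulrDl semi semi' -!mulrA -mulrDr -!okX // -mulrDl addrC.
    by rewrite -gevalD eX.
  by rewrite mulrA Yb // -mulrA YX.
by case: (rank ([[gminus b1]] * X)) leM => // n0 leM /dvdn_leq => /(_ isT); lia.
Qed.

End FixedPointFree.

Section EqualCycles.
Variables (E : pzRingType) (R : word -> E) (k : nat) (ev : bool).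
Hypothesis char2 : 2%:R = 0 :> E.
Hypothesis HR : word_rep k ev R.
Local Notation "[[ p ]]" := (geval R p) (format "[[ p ]]").
Variable f : E.
Hypothesis relf : rel_rep k ev R f.

Lemma bitransp_conj_trivial s w Y Y' X :
  [[gminus (bitransp 0 1 2 3)]] * ([[Y]] * f) = 0 -> [[Y']] * f = X ->
  [&& ok_word k ev s, ok_gring k ev (gminus (bitransp 0 1 2 3)), ok_gring k ev Y,
      ok_gring k ev (gminus w), ok_gring k ev Y'
    & gcheck k 2 ev (gmul (gw s) (gmul (gminus (bitransp 0 1 2 3)) Y))
                    (gmul (gmul (gminus w) Y') (gw s))] ->
  R w * X = X.
Proof.
move=> bY YX /and5P[oks okb okY okw /andP[okY' chk] ].
apply/(gminus_eq0 HR); rewrite -YX mulrA -(gevalM HR) //.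
apply: (conj_null char2 HR relf (s := s) (p := gmul (gminus (bitransp 0 1 2 3)) Y)).
  by rewrite oks chk !ok_gmul.
by rewrite (gevalM HR) // -mulrA.
Qed.

(* The 3-cycle (0 1 2) is a product of two bitranspositions. *)
Lemma cycle_trivial X : (5 <= k)%N ->
  R (bitransp 0 1 3 4) * X = X -> R (bitransp 3 4 0 2) * X = X ->
  [[ecyc 0 1 2]] * X = X -> X = 0.
Proof.
move=> k5 b1X b2X eX.
have HR5 : word_rep 5 true R := word_rep_restrict (word_rep_even HR) k5.
have cX : R (cycle3 0 1 2) * X = X.
  by rewrite (wr_key HR5 (w' := bitransp 0 1 3 4 ++ bitransp 3 4 0 2)) // (wr_cat HR5) // -mulrA b2X.
have dX : R (cycle3 0 2 1) * X = X.
  by rewrite (wr_key HR5 (w' := cycle3 0 1 2 ++ cycle3 0 1 2)) // (wr_cat HR5) // -mulrA !cX.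
rewrite -eX gevalD !gevalw mulrDl cX dX -mulr2n -mulr_natl char2.
exact: mul0r.
Qed.

Hypothesis null : [[gmul (ecyc 0 1 2) (fcyc 3 4 5)]] * f = 0.

(** Modulo 2, [fcyc] is 1 minus [ecyc], so a conjugate of [null] says that the second idempotent is
    the identity on what the first one retains of [f]. *)
Lemma ecyc_absorb s a b c a' b' c' :
  [&& ok_word k ev s, ok_gring k ev (gmul (ecyc 0 1 2) (fcyc 3 4 5)),
      ok_gring k ev (ecyc a b c), ok_gring k ev (fcyc a' b' c')
    & gcheck k 2 ev (gmul (gw s) (gmul (ecyc 0 1 2) (fcyc 3 4 5)))
                   (gmul (gmul (ecyc a b c) (fcyc a' b' c')) (gw s))] ->
  [[ecyc a b c]] * ([[ecyc a' b' c']] * f) = [[ecyc a b c]] * f.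
Proof.
move=> /and5P[oks ok0 oke okf chk].
have : [[gmul (ecyc a b c) (fcyc a' b' c')]] * f = 0.
  by apply: (conj_null char2 HR relf _ null (s := s)); rewrite oks ok0 chk ok_gmul.
rewrite (gevalM HR) // -mulrA (gevalD _ gone) (geval1 HR) mulrDl mul1r mulrDr.
move=> /eqP; rewrite addr_eq0 => /eqP ->.
by apply/eqP; rewrite -subr_eq0 opprK -mulr2n -mulr_natl char2 mul0r.
Qed.

Lemma ecyc_equal s s' a b c a' b' c' :
  [&& ok_word k ev s, ok_gring k ev (gmul (ecyc 0 1 2) (fcyc 3 4 5)),
      ok_gring k ev (ecyc a b c), ok_gring k ev (fcyc a' b' c')
    & gcheck k 2 ev (gmul (gw s) (gmul (ecyc 0 1 2) (fcyc 3 4 5)))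
                   (gmul (gmul (ecyc a b c) (fcyc a' b' c')) (gw s))] &&
  [&& ok_word k ev s', ok_gring k ev (gmul (ecyc 0 1 2) (fcyc 3 4 5)),
      ok_gring k ev (ecyc a' b' c'), ok_gring k ev (fcyc a b c)
    & gcheck k 2 ev (gmul (gw s') (gmul (ecyc 0 1 2) (fcyc 3 4 5)))
                   (gmul (gmul (ecyc a' b' c') (fcyc a b c)) (gw s'))] &&
  gcheck k 2 ev (gmul (ecyc a b c) (ecyc a' b' c')) (gmul (ecyc a' b' c') (ecyc a b c)) ->
  [[ecyc a b c]] * f = [[ecyc a' b' c']] * f.
Proof.
move=> /andP[/andP[chk chk'] com].
rewrite -[LHS](ecyc_absorb chk) -[RHS](ecyc_absorb chk') !mulrA; congr (_ * f).
have /and5P[_ _ oke _ _] := chk; have /and5P[_ _ oke' _ _] := chk'.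
by apply: (gcommP HR char2); rewrite oke oke'.
Qed.

End EqualCycles.

(** * Disjoint 3-cycles in characteristic 2 *)

Section Key2.
Variables (T : finType) (E : pzRingType) (rf : rank_function E) (r : {perm T} -> E).
Hypothesis char2 : 2%:R = 0 :> E.
Local Notation rank := (rk rf).

Definition disjoint_ecyc_null (S : {set T}) (f : E) :=
  forall x, points 6 S x ->
  geval (word_op r x) (ecyc 3 4 5) * (geval (word_op r x) (ecyc 0 1 2) * f) = 0.

Lemma stab_words_comp z s ws F :
  stab_words (word_op r z) [seq [seq (s ij.1, s ij.2) | ij <- w] | w : word <- ws] F ->
  stab_words (word_op r (z \o s)) ws F.
Proof.
by move=> st w wws; rewrite /word_op word_perm_map; apply: st; apply: map_f.
Qed.

(** By divisibility [t2] is 0, which is the claim, or 4 with [t1 = 0]. In the second case disjoint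
    3-cycles have the same idempotent on [f], of rank 4. [klein_trivial_fpf] with [D = 4] makes the
    double transpositions trivial on its image, hence the 3-cycles too, which contradicts the
    rank. *)
Lemma sym_seven_key (S : {set T}) f : perm_rep false r -> (7 <= #|S|)%N -> (rank f <= 7)%N ->
  rel_set false r S f -> disjoint_ecyc_null S f.
Proof.
move=> HP leS rf7 relS x px.
have [|z pz zx] := points_extend (k' := 7) px; first by rewrite leS.
have xz i : (i < 6)%N -> x i = z i by move=> lti; rewrite zx.
rewrite !(geval_shift r xz) //; set R := word_op r z.
have HR : word_rep 7 false R := points_rep HP pz.
have relf : rel_rep 7 false R f := rel_points pz relS.
have [t0 [t1 [t2 [rE r2 r12 r1 /andP[d1 d2]]]]] := seven_sym_split rf char2 HR relf.
have [t20|t2_gt0] := posnP t2.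
  by rewrite mulrA -(gevalM HR) //; apply/(rk_eq0 rf); rewrite r12.
have t2E : t2 = 4%N by move: d2 t2_gt0 rf7 => /dvdnP[j]; lia.
have t10 : t1 = 0%N by move: d1 rf7 => /dvdnP[j]; lia.
have null : geval R (gmul (ecyc 0 1 2) (fcyc 3 4 5)) * f = 0.
  by apply/(rk_eq0 rf); rewrite r1.
have eqd := ecyc_equal char2 HR relf null.
(* Chains of disjoint triples such as 456, 013, 256 show that [X] is also cut out by cycles that
   avoid the double transpositions used below. *)
have e1 : geval R (ecyc 4 5 6) * f = geval R (ecyc 0 1 3) * f.
  by apply: (eqd [:: (0, 4); (1, 5); (2, 6)] [:: (2, 6); (3, 2)])%N; vm_compute.
have e2 : geval R (ecyc 2 5 6) * f = geval R (ecyc 0 1 3) * f.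
  by apply: (eqd [:: (0, 5); (1, 4); (1, 6)] [:: (2, 3); (4, 6)])%N; vm_compute.
have e3 : geval R (ecyc 4 5 6) * f = geval R (ecyc 0 2 3) * f.
  by apply: (eqd [:: (0, 4); (1, 6); (2, 5)] [:: (1, 6); (3, 1)])%N; vm_compute.
have e4 : geval R (ecyc 1 5 6) * f = geval R (ecyc 0 2 3) * f.
  by apply: (eqd [:: (0, 5); (2, 4); (2, 6)] [:: (1, 3); (4, 6)])%N; vm_compute.
pose X := geval R (ecyc 4 5 6) * f.
have rX : rank X = 4%N.
  rewrite -t2E -[t2]add0n -t10 -r2.
  by apply: (rk_gconj rf char2 HR (w := [:: (3, 4); (3, 5); (3, 6)]%N) _ relf); vm_compute.
have absorb : geval R (ecyc 0 1 2) * X = X.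
  have com : geval R (ecyc 0 1 2) * geval R (ecyc 4 5 6) =
             geval R (ecyc 4 5 6) * geval R (ecyc 0 1 2).
    by apply: (gcommP HR char2); vm_compute.
  rewrite /X mulrA com -mulrA.
  by apply: (ecyc_absorb char2 HR relf null (s := [:: (0, 4); (1, 5); (2, 3); (2, 6)]%N)); vm_compute.
have b1X : geval R (gminus (bitransp 0 1 2 3)) * X = 0.
  pose s := nth 0%N [:: 0; 1; 2; 4; 5; 6; 3]%N.
  have pzs : points 7 S (z \o s) by apply: points_comp pz _.
  have HRs : word_rep 7 false (word_op r (z \o s)) := points_rep HP pzs.
  apply: (klein_trivial_fpf (rf := rf) (D := 4) (k := 7) (ev := false) char2 HR (Y := ecyc 4 5 6)
    (ws := [seq [seq (s ij.1, s ij.2) | ij <- w] | w : word <- fpf_sym_words]) _ (erefl X)) => //.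
  - move=> w okw; apply: (rel_high HR (isT : 4 <= 7)%N relf) => //; exact: ok_word_even okw.
  - move=> F sF eF YF; apply: (dvd4_rank rf char2 HRs); first exact: stab_words_comp.
    have -> : geval (word_op r (z \o s)) (gmul (ecyc 0 1 2) (ecyc 3 4 5)) =
       geval R (ecyc 0 1 2) * geval R (ecyc 4 5 6).
      by rewrite (geval_map r z s) -(gevalM HR).
    by rewrite -mulrA YF eF.
  by rewrite rX.
have b2X : word_op r z (bitransp 0 1 3 4) * X = X.
  apply: (bitransp_conj_trivial char2 HR relf b1X (s := [:: (2, 4); (3, 2)]%N) (Y' := ecyc 2 5 6)).
    by rewrite e2 -e1.
  by vm_compute.
have b3X : word_op r z (bitransp 3 4 0 2) * X = X.
  apply: (bitransp_conj_trivial char2 HR relf b1X (s := [:: (1, 4); (2, 1); (3, 2)]%N) (Y' := ecyc 1 5 6)).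
    by rewrite e4 -e3.
  by vm_compute.
by have := rX; rewrite (cycle_trivial char2 HR _ b2X b3X absorb) // (rk0 rf).
Qed.

Lemma points_rest n k k' (S : {set T}) z s s' : points n S z ->
  [&& all (fun i => s i < n)%N (iota 0 k), uniq [seq s i | i <- iota 0 k],
      all (fun i => s' i < n)%N (iota 0 k')
    & all (fun i => all (fun j => s i != s' j) (iota 0 k')) (iota 0 k)] ->
  points k (S :\: point_set k' (z \o s')) (z \o s).
Proof.
move=> pz /and4P[lts us lts' /allP ne].
have [injs sS] : points k S (z \o s) by apply: points_comp pz _; rewrite lts us.
split=> // i lti; rewrite inE sS // andbT; apply/negP => /imsetP[j _ e].
have [injz _] := pz.
have mem l m : (l < m)%N -> l \in iota 0 m by move=> ltlm; rewrite mem_iota.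
have mi := mem i k lti; have mj := mem j k' (ltn_ord j).
have /eqP := allP (ne i mi) j mj; apply; apply: injz e.
  exact: (allP lts i mi).
exact: (allP lts' j mj).
Qed.

Lemma perm_rep_even : perm_rep false r -> perm_rep true r.
Proof. by move=> [r1 rM]; split=> // g h _ _; apply: rM. Qed.

Lemma rel_set_even S f : rel_set false r S f -> rel_set true r S f.
Proof. by move=> rf0 g _; apply: rf0. Qed.

(** If [u3 = 0], then [u2], a multiple of 4 with [3 u2] at most 8, is 0 as well. Otherwise [u3 = 8]
    exhausts [f], and c + c^-1 is 1 on it for every 3-cycle. The square-zero element 1 - (7 8)
    halves the rank, so [sym_seven_key] on the other seven points kills its image; transpositions,
    and with them 3-cycles, become trivial, and [f] is 0. *)
Lemma sym_nine_key (S : {set T}) f : perm_rep false r -> (9 <= #|S|)%N -> (rank f <= 8)%N ->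
  rel_set false r S f -> disjoint_ecyc_null S f.
Proof.
move=> HP leS rf8 relS x px.
have [|z pz zx] := points_extend (k' := 9) px; first by rewrite leS.
have xz i : (i < 6)%N -> x i = z i by move=> lti; rewrite zx // ltnW // ltnW.
rewrite !(geval_shift r xz) //; set R := word_op r z.
have HRf : word_rep 9 false R := points_rep HP pz.
have HR : word_rep 9 true R := points_rep (perm_rep_even HP) pz.
have relff : rel_rep 9 false R f := rel_points pz relS.
have relf : rel_rep 9 true R f := rel_points pz (rel_set_even relS).
have := nine_split rf char2 HR relf; have := nine_dvd4 rf char2 HR relf.
have := nine_dvd8 rf char2 HR relf; have := nine_even rf char2 HR relf.
set u1 := rank (geval R (prod3 (ecyc 0 1 2) (fcyc 3 4 5) (fcyc 6 7 8)) * f).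
set u2 := rank (geval R (prod3 (ecyc 0 1 2) (ecyc 3 4 5) (fcyc 6 7 8)) * f).
set u3 := rank (geval R (prod3 (ecyc 0 1 2) (ecyc 3 4 5) (ecyc 6 7 8)) * f).
set u0 := rank (geval R (prod3 (fcyc 0 1 2) (fcyc 3 4 5) (fcyc 6 7 8)) * f).
move=> /dvdnP[v1 E1] /dvdnP[v3 E3] /dvdnP[v2 E2] [rE _ rf3 _ r12].
have [u30|u3_gt0] := posnP u3.
  by rewrite mulrA -(gevalM HR) //; apply/(rk_eq0 rf); rewrite r12 u30; lia.
have f3 : geval R (fcyc 6 7 8) * f = 0 by apply/(rk_eq0 rf); rewrite rf3; lia.
have fcyc0 s a b c : [&& ok_word 9 true s, ok_gring 9 true (fcyc 6 7 8), ok_gring 9 true (fcyc a b c)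
    & gcheck 9 2 true (gmul (gw s) (fcyc 6 7 8)) (gmul (fcyc a b c) (gw s))] ->
    geval R (ecyc a b c) * f = f.
  move=> chk; have := conj_null char2 HR relf chk f3.
  rewrite (gevalD _ gone) (geval1 HR) mulrDl mul1r => /eqP; rewrite addrC addr_eq0 => /eqP ->.
  by apply/eqP; rewrite -subr_eq0 -opprD -mulr2n -mulr_natl char2 mul0r oppr0.
have e1f : geval R (ecyc 0 1 2) * f = f.
  by apply: (fcyc0 (bitransp 0 6 1 7 ++ bitransp 2 8 3 4)); vm_compute.
have e2f : geval R (ecyc 3 4 5) * f = f.
  by apply: (fcyc0 (bitransp 3 6 4 7 ++ bitransp 5 8 0 1)); vm_compute.
have e3f : geval R (ecyc 6 7 8) * f = f.
  by apply: (fcyc0 [::]); vm_compute.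
pose t : word := [:: (7, 8)]%N; pose N := geval R (gminus t).
have Nf : N * f = f * N by apply: (rel_geval relff).
have NN : N * N = 0.
  rewrite -(gevalM HRf) // (gcheckP (q := [::]) HRf char2) ?geval0 //.
have rN : (2 * rank (N * f) <= rank f)%N by apply: rk_square_zero NN Nf.
pose y := z \o addn 7.
have py : points 2 S y by apply: points_comp pz _.
have NE : N = geval (word_op r y) (gminus [:: (0, 1)]%N) by rewrite (geval_map r z (addn 7)).
pose S' := S :\: point_set 2 y.
have NX : N * f = 0.
  have cS' : (7 <= #|S'|)%N by rewrite (card_rest py); lia.
  have relN : rel_set false r S' (N * f).
    rewrite NE; apply: (rel_mul_disjoint HP (points_point_set py) (disjoint_rest 2 S y) _
      (subsetDl _ _) relS); by vm_compute.
  have := sym_seven_key HP cS' _ relN; move/(_ _ (z \o id)).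
  have -> : geval (word_op r (z \o id)) = geval R by [].
  have comm p : ok_gring 9 false p && gcheck 9 2 false (gmul p (gminus t)) (gmul (gminus t) p) ->
      geval R p * (N * f) = N * (geval R p * f).
    move=> /andP[okp c]; rewrite !mulrA; congr (_ * f).
    by apply: (gcommP HRf char2); rewrite okp c.
  rewrite comm // e1f comm // e2f; apply; first by lia.
  exact: (points_rest pz).
have tf : R t * f = f by apply/(gminus_eq0 HRf).
have tf' s w : [&& ok_word 9 false s, ok_gring 9 false (gminus t), ok_gring 9 false (gminus w)
    & gcheck 9 2 false (gmul (gw s) (gminus t)) (gmul (gminus w) (gw s))] -> R w * f = f.
  by move=> chk; apply/(gminus_eq0 HRf); apply: (conj_null char2 HRf relff chk NX).
have t1 : R [:: (6, 7)]%N * f = f by apply: (tf' [:: (6, 8)]%N); vm_compute.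
have t2 : R [:: (6, 8)]%N * f = f by apply: (tf' [:: (6, 7)]%N); vm_compute.
have c3 : R (cycle3 6 7 8) * f = f.
  by rewrite (wr_key HRf (w' := [:: (6, 7)] ++ [:: (6, 8)]%N)) // (wr_cat HRf) // -mulrA t2 t1.
have d3 : R (cycle3 6 8 7) * f = f.
  by rewrite (wr_key HRf (w' := [:: (6, 8)] ++ [:: (6, 7)]%N)) // (wr_cat HRf) // -mulrA t1 t2.
rewrite e1f e2f -e3f gevalD !gevalw mulrDl c3 d3 -mulr2n -mulr_natl char2.
exact: mul0r.
Qed.

Section Alternating.
Hypothesis HP : perm_rep true r.
Variables (S : {set T}) (z : nat -> T) (f : E).
Hypotheses (pz : points 10 S z) (relS : rel_set true r S f).
Local Notation R := (word_op r z).
Local Notation "[[ p ]]" := (geval R p) (format "[[ p ]]").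
Let HR : word_rep 10 true R := points_rep HP pz.
Let relf : rel_rep 10 true R f := rel_points pz relS.
Hypothesis null : [[gmul (ecyc 0 1 2) (fcyc 3 4 5)]] * f = 0.

Let eA := ecyc 0 1 2. Let eB := ecyc 4 5 6. Let eC := ecyc 7 8 9.

Lemma alt_absorb :
  [/\ [[eA]] * ([[eC]] * f) = [[eA]] * f, [[eC]] * ([[eA]] * f) = [[eC]] * f,
      [[eC]] * ([[eB]] * f) = [[eC]] * f, [[eB]] * ([[eC]] * f) = [[eB]] * f
    & [[eB]] * ([[eA]] * f) = [[eB]] * f].
Proof.
have ab := ecyc_absorb char2 HR relf null; split.
- by apply: (ab [:: (3, 6); (4, 8); (5, 9); (3, 7)]%N); vm_compute.
- by apply: (ab [:: (0, 3); (1, 4); (2, 5); (0, 7); (1, 8); (2, 9)]%N); vm_compute.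
- by apply: (ab [:: (0, 7); (1, 8); (2, 9); (3, 6)]%N); vm_compute.
- by apply: (ab [:: (0, 8); (1, 9); (2, 6); (3, 7); (4, 0); (5, 1)]%N); vm_compute.
- by apply: (ab [:: (0, 4); (1, 5); (2, 3); (2, 6)]%N); vm_compute.
Qed.

Lemma alt_comm p q : [&& ok_gring 10 true p, ok_gring 10 true q
    & gcheck 10 2 true (gmul p q) (gmul q p)] ->
  [[p]] * ([[q]] * f) = [[q]] * ([[p]] * f).
Proof.
move=> /and3P[okp okq c]; rewrite !mulrA; congr (_ * f).
by apply: (gcommP HR char2); rewrite okp okq c.
Qed.

Lemma alt_equal : [[eA]] * f = [[eC]] * f /\ [[eB]] * f = [[eC]] * f.
Proof.
have [AC CA CB BC _] := alt_absorb; split.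
  by rewrite -AC -[RHS]CA; apply: alt_comm; vm_compute.
by rewrite -BC -[RHS]CB; apply: alt_comm; vm_compute.
Qed.

Lemma alt_fpf : [[gminus (bitransp 0 1 2 3)]] * ([[eC]] * f) = 0 -> [[eA]] * f = 0.
Proof.
move=> b1X; have [AC _ _ _ _] := alt_absorb; have [eqAC _] := alt_equal.
rewrite eqAC; apply: (cycle_trivial char2 HR); rewrite ?AC //.
  by apply: (bitransp_conj_trivial char2 HR relf b1X (s := [:: (0, 1); (2, 4)]%N) (erefl _)); vm_compute.
by apply: (bitransp_conj_trivial char2 HR relf b1X (s := [:: (0, 3); (1, 4)]%N) (erefl _)); vm_compute.
Qed.

(** [klein_trivial_fpf] with [D = 8]: the divisibility comes from [dvd8_rank] for the cycles of
    [eB], [eC] and [eA], the last of which meets the Klein group. *)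
Lemma alt_fpf_small : (rank f < 16)%N ->
  [[gminus (bitransp 0 1 2 3)]] * ([[eC]] * f) = 0.
Proof.
move=> rf16; have [AC CA CB BC BA] := alt_absorb; have [eqAC eqBC] := alt_equal.
pose s := nth 0%N [:: 4; 5; 6; 7; 8; 9; 0; 1; 2]%N.
have pzs : points 9 S (z \o s) by apply: points_comp pz _.
have HRs : word_rep 9 true (word_op r (z \o s)) := points_rep HP pzs.
have XE : [[eC]] * f = [[gmul eB eC]] * f by rewrite (gevalM HR) // -mulrA BC.
apply: (klein_trivial_fpf (rf := rf) (D := 8) (k := 10) (ev := true) char2 HR (Y := gmul eB eC)
  (ws := [seq [seq (s ij.1, s ij.2) | ij <- w] | w : word <- fpf_words]) _ XE) => //.
- by move=> w okw; apply: (rel_high HR (isT : 4 <= 10)%N relf).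
- by rewrite AC eqAC.
- move=> F sF eF YF; apply: (dvd8_rank rf char2 HRs); first exact: stab_words_comp.
  have -> : geval (word_op r (z \o s)) (gmul (gmul (ecyc 0 1 2) (ecyc 3 4 5)) (ecyc 6 7 8)) =
     [[gmul eB eC]] * [[eA]].
    by rewrite (geval_map r z s) -(gevalM HR).
  by rewrite -mulrA eF.
exact: leq_ltn_trans (rkMl rf _ _) rf16.
Qed.

(** 1 - b1 is square-zero and so halves the rank; the induction hypothesis applies to [g] on the
    points outside the Klein group, and by [alt_absorb] what it kills is (1 - b1) [eC] f. *)
Lemma alt_fpf_large :
  (forall g, (2 * rank g <= rank f)%N -> rel_set true r (S :\: point_set 4 z) g ->
     disjoint_ecyc_null (S :\: point_set 4 z) g) ->
  [[gminus (bitransp 0 1 2 3)]] * ([[eC]] * f) = 0.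
Proof.
move=> IH; have [AC CA CB BC BA] := alt_absorb; have [eqAC eqBC] := alt_equal.
pose M := [[gminus (bitransp 0 1 2 3)]].
have rM : (2 * rank (M * ([[eC]] * f)) <= rank f)%N.
  apply: leq_trans (_ : rank ([[eC]] * f) <= _)%N; last exact: rkMl.
  apply: rk_square_zero.
    by rewrite -(gevalM HR) // (gcheckP (q := [::]) HR char2) ?geval0 //; vm_compute.
  have -> : M * ([[eC]] * f) = [[eC]] * (M * f) by apply: alt_comm.
  by rewrite /M (rel_geval relf) // mulrA.
pose g := M * ([[eA]] * f).
have pz4 : points 4 S z by apply: pointsW pz.
have relg : rel_set true r (S :\: point_set 4 z) g.
  have -> : g = [[gmul (gminus (bitransp 0 1 2 3)) eA]] * f by rewrite /g (gevalM HR) // mulrA.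
  apply: (rel_mul_disjoint HP (points_point_set pz4) (disjoint_rest 4 S z) _
    (subsetDl _ _) relS); by vm_compute.
have rg : (2 * rank g <= rank f)%N by rewrite /g eqAC.
have py : points 6 (S :\: point_set 4 z) (z \o addn 4).
  exact: (points_rest (s' := id) pz).
have := IH g rg relg _ py; rewrite !(geval_map r z (addn 4)) -[gmap _ (ecyc 3 4 5)]/eC.
rewrite -[gmap _ (ecyc 0 1 2)]/eB /g.
have cm p : ok_gring 10 true p && gcheck 10 2 true (gmul p (gminus (bitransp 0 1 2 3)))
    (gmul (gminus (bitransp 0 1 2 3)) p) -> forall X, [[p]] * (M * X) = M * ([[p]] * X).
  move=> /andP[okp c] X; rewrite !mulrA; congr (_ * X).
  by apply: (gcommP HR char2); rewrite okp c.
by rewrite cm // BA cm // CB.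
Qed.

End Alternating.

(** Induction on the size of [S]. Two situations can be settled directly: [small], where no part
    involves two moving cycles, and [fpf], where disjoint 3-cycles move the same part of [f]. For
    more than 12 points, [f] is cut by a third 3-cycle and both pieces are treated on three points
    fewer. If one of them is too large for that, the other has rank at most 2, and divisibility
    leads back to [fpf] or [small]. *)
Lemma alt_key (S : {set T}) f : perm_rep true r -> (10 <= #|S|)%N -> (rank f < #|S|)%N ->
  rel_set true r S f -> disjoint_ecyc_null S f.
Proof.
move=> HP; elim: {S}_.+1 {-2}S f (ltnSn #|S|) => // n IH S f; rewrite ltnS => leSn leS rfS relS x px.
have [|z pz zx] := points_extend (k' := 10) px; first by rewrite leS.
have xz i : (i < 6)%N -> x i = z i by move=> lti; rewrite zx.
rewrite !(geval_shift r xz) //; set R := word_op r z.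
have HR : word_rep 9 true R := points_rep HP (pointsW (isT : 9 <= 10)%N (subxx S) pz).
have relf : rel_rep 9 true R f := rel_points (pointsW (isT : 9 <= 10)%N (subxx S) pz) relS.
have := nine_split rf char2 HR relf; have := nine_dvd4 rf char2 HR relf.
have := nine_dvd8 rf char2 HR relf; have := nine_even rf char2 HR relf.
set u1 := rank (geval R (prod3 (ecyc 0 1 2) (fcyc 3 4 5) (fcyc 6 7 8)) * f).
set u2 := rank (geval R (prod3 (ecyc 0 1 2) (ecyc 3 4 5) (fcyc 6 7 8)) * f).
set u3 := rank (geval R (prod3 (ecyc 0 1 2) (ecyc 3 4 5) (ecyc 6 7 8)) * f).
set u0 := rank (geval R (prod3 (fcyc 0 1 2) (fcyc 3 4 5) (fcyc 6 7 8)) * f).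
move=> /dvdnP[v1 E1] /dvdnP[v3 E3] /dvdnP[v2 E2] [rE re3 rf3 r1 r12].
have small : (u2 + u3)%N = 0%N -> geval R (ecyc 3 4 5) * (geval R (ecyc 0 1 2) * f) = 0.
  by move=> u0_; rewrite mulrA -(gevalM HR) //; apply/(rk_eq0 rf); rewrite r12.
have fpf : (u1 + u2)%N = 0%N -> geval R (ecyc 3 4 5) * (geval R (ecyc 0 1 2) * f) = 0.
  move=> u12; have null : geval R (gmul (ecyc 0 1 2) (fcyc 3 4 5)) * f = 0.
    by apply/(rk_eq0 rf); rewrite r1.
  rewrite (alt_fpf HP pz relS null) ?mulr0 //.
  have [lt16|ge16] := ltnP (rank f) 16; first exact: (alt_fpf_small HP pz relS null).
  apply: (alt_fpf_large HP pz relS null) => g rg relg.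
  have cS3 := card_rest (pointsW (isT : 4 <= 10)%N (subxx S) pz).
  by apply: IH relg; rewrite cS3; lia.
have [le12|gt12] := leqP #|S| 12.
  have [/small//|u23] := eqVneq (u2 + u3)%N 0%N.
  (* Here the rank is at most 11: 4 divides [u2], so [u2 = 0]; then [u3] is at least 8, and the even
     number [u1] is 0. *)
  by apply: fpf; lia.
pose S' := S :\: point_set 3 (z \o addn 6).
have cS' : #|S'| = (#|S| - 3)%N.
  by apply: card_rest; apply: points_comp pz _.
have pz6 : points 6 S' (z \o id) by apply: (points_rest (s' := addn 6) pz).
have p6 : points 3 S (z \o addn 6) by apply: points_comp pz _.
have relS' p : ok_gring 3 true p -> rel_set true r S' (geval R (gmap (addn 6) p) * f).
  move=> okp; rewrite -(geval_map r z (addn 6)).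
  exact: (rel_mul_disjoint HP (points_point_set p6) (disjoint_rest 3 S _) _ (subsetDl _ _) relS).
have key p : ok_gring 3 true p -> (rank (geval R (gmap (addn 6) p) * f) < #|S| - 3)%N ->
    geval R (ecyc 3 4 5) * (geval R (ecyc 0 1 2) * (geval R (gmap (addn 6) p) * f)) = 0.
  move=> okp ltr; apply: (IH S') pz6; [lia|lia| |exact: relS'].
  by rewrite cS'.
have [lt_e|ge_e] := ltnP (rank (geval R (ecyc 6 7 8) * f)) (#|S| - 3); last first.
  by apply: fpf; lia.
have [lt_f|ge_f] := ltnP (rank (geval R (fcyc 6 7 8) * f)) (#|S| - 3); last first.
  by apply: small; lia.
have k1 := key (ecyc 0 1 2) isT lt_e; have k2 := key (fcyc 0 1 2) isT lt_f.
have sum1 : geval R (ecyc 6 7 8) + geval R (fcyc 6 7 8) = 1.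
  rewrite /fcyc (gevalD _ gone) (geval1 HR) addrCA -mulr2n -mulr_natl char2.
  by rewrite mul0r addr0.
by rewrite -[f]mul1r -sum1 mulrDl !mulrDr k1 k2 addr0.
Qed.

Lemma ecyc_cycles_null : (exists ev, perm_rep ev r) ->
  disjoint_ecyc_null [set: T] 1 -> disjoint_cycles_null r 1.
Proof.
move=> [ev HP] key x px; have HR := points_rep HP px.
have absorb a b c : ok_gring 6 true (ecyc a b c) -> ok_gring 6 true (gminus (cycle3 a b c)) ->
    gcheck 6 2 true (gminus (cycle3 a b c)) (gmul (gminus (cycle3 a b c)) (ecyc a b c)) ->
    geval (word_op r x) (gminus (cycle3 a b c)) =
    geval (word_op r x) (gminus (cycle3 a b c)) * geval (word_op r x) (ecyc a b c).
  have HR6 := word_rep_even HR.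
  by move=> ok1 ok2 /(gcheckP HR6 char2) e; rewrite {1}e (gevalM HR6).
have HR6 := word_rep_even HR.
rewrite (absorb 3 4 5)%N // (absorb 0 1 2)%N //.
have com : geval (word_op r x) (ecyc 3 4 5) * geval (word_op r x) (gminus (cycle3 0 1 2)) =
    geval (word_op r x) (gminus (cycle3 0 1 2)) * geval (word_op r x) (ecyc 3 4 5).
  by apply: (gcommP HR6 char2); vm_compute.
by rewrite -!mulrA (mulrA (geval _ (ecyc 3 4 5))) com -!mulrA key // !mulr0.
Qed.

Lemma even_key ev : perm_rep ev r -> (7 <= #|T|)%N -> (ev -> (10 <= #|T|)%N) ->
  (rank 1%R < #|T|)%N -> disjoint_cycles_null r 1.
Proof.
move=> HP n7 n10 rk1; apply: ecyc_cycles_null; first by exists ev.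
have HPt : perm_rep true r by case: ev HP {n10} => // /perm_rep_even.
have [ge10|lt10] := leqP 10 #|T|.
  by apply: alt_key; rewrite ?cardsT //; apply: rel_set1.
have HPf : perm_rep false r.
  by case: ev HP n10 {HPt} => // _ /(_ isT); rewrite leqNgt lt10.
have [ge9|lt9] := leqP 9 #|T|.
  apply: sym_nine_key; rewrite ?cardsT //; last exact: rel_set1.
  by rewrite -ltnS (leq_trans rk1).
apply: sym_seven_key; rewrite ?cardsT //; last exact: rel_set1.
by rewrite -ltnS (leq_trans rk1).
Qed.

End Key2.

(** * Subgroups, dimension and dim-connectedness in a modular universe *)

Lemma gensubE (A : zmodType) (P : A -> Prop) : P 0 ->
  (forall x y, P x -> P y -> P (x - y)) -> forall x, x \in gensub P <-> P x.
Proof.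
move=> P0 PB x; split=> [/asboolP H|]; last exact: mem_gensub.
pose Q : pred A := [pred y | `[< P y >]].
have QP : zmod_closed Q.
  by split=> [|y z /asboolP Py /asboolP Pz]; apply/asboolP => //; apply: PB.
by apply/asboolP; apply: (H (mksub QP)) => y Py; apply/asboolP.
Qed.

Section Subgroups.
Variables (A B : zmodType).

Definition zerosub : zmodClosed A := gensub (fun x => x = 0).
Definition imsub (V : zmodClosed A) (f : A -> B) : zmodClosed B :=
  gensub (fun y => exists2 x, x \in V & y = f x).
Definition kersub (V : zmodClosed A) (f : A -> B) : zmodClosed A :=
  gensub (fun x => x \in V /\ f x = 0).
Definition capsub (X Y : zmodClosed A) : zmodClosed A :=
  gensub (fun x => x \in X /\ x \in Y).
Definition sumsub (X Y : zmodClosed A) : zmodClosed A :=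
  gensub (fun z => exists x y, [/\ x \in X, y \in Y & z = x + y]).

Lemma mem_zerosub x : x \in zerosub <-> x = 0.
Proof. by apply: gensubE => // ? ? -> ->; rewrite subrr. Qed.

Lemma mem_capsub X Y x : x \in capsub X Y <-> x \in X /\ x \in Y.
Proof.
apply: gensubE => [|y z [? ?] [? ?]]; first by rewrite !rpred0.
by rewrite !rpredB.
Qed.

Lemma mem_sumsub X Y z : z \in sumsub X Y <-> exists x y, [/\ x \in X, y \in Y & z = x + y].
Proof.
apply: gensubE => [|_ _ [x [y [Xx Yy ->]]] [x' [y' [Xx' Yy' ->]]]].
  by exists 0, 0; rewrite !rpred0 addr0.
by exists (x - x'), (y - y'); rewrite !rpredB // opprD addrACA.
Qed.

End Subgroups.
Arguments zerosub {A}.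

Section Universe.
Variables (U : modular_universe) (dim : additive_dimension U).

Section Arrow.
Variables (A B : zmodType) (V : zmodClosed A) (W : zmodClosed B) (f : A -> B).
Hypothesis arf : Ar U V W f.

Lemma ar_obl : Ob U V. Proof. by case: (mu_arrow arf). Qed.
Lemma ar_obr : Ob U W. Proof. by case: (mu_arrow arf). Qed.
Lemma ar_mem x : x \in V -> f x \in W.
Proof. by have [_ _ fW _] := mu_arrow arf => /fW. Qed.
Lemma arD : {in V &, {morph f : x y / x + y}}.
Proof. by case: (mu_arrow arf). Qed.
Lemma ar0 : f 0 = 0.
Proof. by apply: (addIr (f 0)); rewrite -arD ?rpred0 // !add0r. Qed.
Lemma arN x : x \in V -> f (- x) = - f x.
Proof. by move=> Vx; apply: (addIr (f x)); rewrite -arD ?rpredN // !addNr ar0. Qed.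
Lemma arB : {in V &, {morph f : x y / x - y}}.
Proof. by move=> x y Vx Vy; rewrite arD ?rpredN // arN. Qed.

Lemma mem_imsub y : y \in imsub V f <-> exists2 x, x \in V & y = f x.
Proof.
apply: gensubE => [|_ _ [x Vx ->] [x' Vx' ->]]; first by exists 0; rewrite ?rpred0 ?ar0.
by exists (x - x'); rewrite ?rpredB ?arB.
Qed.

Lemma mem_kersub x : x \in kersub V f <-> x \in V /\ f x = 0.
Proof.
apply: gensubE => [|y z [Vy fy] [Vz fz]]; first by rewrite rpred0 ar0.
by rewrite rpredB // arB // fy fz subrr.
Qed.

Lemma imsubP : is_image V f (imsub V f). Proof. exact: mem_imsub. Qed.
Lemma kersubP : is_kernel V f (kersub V f). Proof. exact: mem_kersub. Qed.

Lemma ob_imsub : Ob U (imsub V f). Proof. exact: mu_im arf imsubP. Qed.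
Lemma ob_kersub : Ob U (kersub V f). Proof. exact: mu_ker arf kersubP. Qed.

Lemma dim_ker_im : dim A V = (dim A (kersub V f) + dim B (imsub V f))%N.
Proof. exact (dimension_additive dim arf kersubP imsubP). Qed.

Lemma imsub_sub : {subset imsub V f <= W}.
Proof. by move=> y /mem_imsub[x Vx ->]; apply: ar_mem. Qed.

End Arrow.

Lemma ar_restrict (A B : zmodType) (V X : zmodClosed A) (W : zmodClosed B) f :
  Ar U V W f -> Ob U X -> {subset X <= V} -> Ar U X W f.
Proof.
move=> arf obX XV; have arX := mu_incl obX (ar_obl arf) XV.
exact: mu_comp arX arf.
Qed.

Lemma ar_add (A B : zmodType) (V : zmodClosed A) (W : zmodClosed B) f g :
  Ar U V W f -> Ar U V W g -> Ar U V W (fun x => f x + g x).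
Proof.
move=> arf arg; have ard := mu_diag 1 (ar_obl arf).
exact: mu_comp (mu_comp ard (mu_prod_map arf arg)) (mu_add (ar_obr arf)).
Qed.

Lemma ar_mulz (A B : zmodType) (V : zmodClosed A) (W : zmodClosed B) f (k : int) :
  Ar U V W f -> Ar U V W (fun x => f x *~ k).
Proof. move=> arf; exact: mu_comp arf (mu_mulz k (ar_obr arf)). Qed.

Lemma ar_opp (A B : zmodType) (V : zmodClosed A) (W : zmodClosed B) f :
  Ar U V W f -> Ar U V W (fun x => - f x).
Proof.
by move=> arf; apply: mu_ext (ar_mulz (-1) arf) => x _; rewrite mulrN1z.
Qed.

Lemma ar_zero (A B : zmodType) (V : zmodClosed A) (W : zmodClosed B) f :
  Ar U V W f -> Ar U V W (fun=> 0).
Proof. by move=> arf; apply: mu_ext (ar_mulz 0 arf) => x _; rewrite mulr0z. Qed.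

Lemma ar_sum (A B : zmodType) (V : zmodClosed A) (W : zmodClosed B) I (s : seq I) F f0 :
  Ar U V W f0 -> (forall i, Ar U V W (F i)) -> Ar U V W (fun x => \sum_(i <- s) F i x).
Proof.
move=> ar0 arF; elim: s => [|i s IH].
  by apply: mu_ext (ar_zero ar0) => x _; rewrite big_nil.
by apply: mu_ext (ar_add (arF i) IH) => x _; rewrite big_cons.
Qed.

Section Dim.
Variable (A : zmodType).
Implicit Types X Y Z V : zmodClosed A.

Lemma pi_eq0 X x : \pi_(quotZ X) x = 0 <-> x \in X.
Proof.
have -> : (0 : quotZ X) = \pi_(quotZ X) 0 by rewrite raddf0.
rewrite -{2}[x]subr0 Quotient.idealrBE; split=> [->|/eqP//].
exact: eqxx.
Qed.

Lemma proj_ker X V : Ob U X -> Ob U V -> {subset X <= V} ->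
  is_kernel V \pi_(quotZ X) X.
Proof.
move=> obX obV XV x; rewrite pi_eq0; split=> [Xx|[]] //.
by split=> //; apply: XV.
Qed.

Lemma dim_le X V : Ob U X -> Ob U V -> {subset X <= V} -> (dim A X <= dim A V)%N.
Proof.
move=> obX obV XV; have arp := mu_proj obX obV XV.
rewrite (dimension_additive dim arp (proj_ker obX obV XV) (imsubP arp)).
exact: leq_addr.
Qed.

Lemma dim_eq X Y : Ob U X -> Ob U Y -> X =i Y -> dim A X = dim A Y.
Proof.
move=> obX obY eqXY; apply/eqP; rewrite eqn_leq !dim_le // => x; by rewrite eqXY.
Qed.

Lemma ob_zero V : Ob U V -> Ob U (@zerosub A).
Proof.
move=> obV; apply: (mu_ker (K := zerosub) (mu_id obV)) => x.
by rewrite mem_zerosub; split=> [->|[]//]; rewrite rpred0.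
Qed.

Lemma dim_zero V : Ob U V -> dim A zerosub = 0%N.
Proof.
move=> obV; have ob0 := ob_zero obV.
have := dimension_additive dim (K := zerosub) (I := zerosub) (mu_id ob0).
suff [k i] : is_kernel (@zerosub A) id zerosub /\ is_image (@zerosub A) id zerosub.
  by move=> /(_ k i); lia.
split=> x; rewrite !mem_zerosub; first by split=> [->|[]].
by split=> [->|[y /mem_zerosub -> ->]] //; exists 0 => //; apply/mem_zerosub.
Qed.

Lemma ob_cap X Y V : Ob U V -> Ob U X -> Ob U Y -> {subset X <= V} -> {subset Y <= V} ->
  Ob U (capsub X Y).
Proof.
move=> obV obX obY XV YV.
have arp := ar_restrict (mu_proj obY obV YV) obX XV.
apply: (mu_ker arp) => x; rewrite mem_capsub.
have kerY := proj_ker obY obV YV x.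
split=> [[Xx Yx]|[Xx px]]; first by have [_ ->] := kerY.1 Yx.
by split=> //; apply/kerY; split=> //; apply: XV.
Qed.

Lemma ob_sum X Y V : Ob U V -> Ob U X -> Ob U Y -> {subset X <= V} -> {subset Y <= V} ->
  Ob U (sumsub X Y).
Proof.
move=> obV obX obY XV YV.
have ara := mu_comp (mu_prod_map (mu_incl obX obV XV) (mu_incl obY obV YV)) (mu_add obV).
apply: (mu_im ara) => z; rewrite mem_sumsub; split=> [[x [y [Xx Yy ->]]]|[[x y]]].
  by exists (x, y) => //; rewrite inE /= Xx Yy.
by rewrite inE /= => /andP[Xx Yy] ->; exists x, y.
Qed.

Lemma sub_sumsub X Y V : {subset X <= V} -> {subset Y <= V} -> {subset sumsub X Y <= V}.
Proof. by move=> XV YV z /mem_sumsub[x [y [/XV Vx /YV Vy ->]]]; rewrite rpredD. Qed.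

Lemma sumsubl X Y : {subset X <= sumsub X Y}.
Proof. by move=> x Xx; apply/mem_sumsub; exists x, 0; rewrite rpred0 addr0. Qed.

Lemma sumsubr X Y : {subset Y <= sumsub X Y}.
Proof. by move=> y Yy; apply/mem_sumsub; exists 0, y; rewrite rpred0 add0r. Qed.

(** Second isomorphism theorem: [X] and X + Y have the same image modulo [Y], with kernels the
    intersection and [Y]. *)
Lemma dim_sum X Y V : Ob U V -> Ob U X -> Ob U Y -> {subset X <= V} -> {subset Y <= V} ->
  (dim A (sumsub X Y) + dim A (capsub X Y) = dim A X + dim A Y)%N.
Proof.
move=> obV obX obY XV YV; have obS := ob_sum obV obX obY XV YV.
have arp := mu_proj obY obS (@sumsubr X Y).
have arX := ar_restrict arp obX (@sumsubl X Y).
rewrite (dimension_additive dim arp (proj_ker obY obS (@sumsubr X Y)) (imsubP arp)).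
have kX : is_kernel X \pi_(quotZ Y) (capsub X Y).
  move=> x; rewrite mem_capsub; have kerY := proj_ker obY obS (@sumsubr X Y) x.
  split=> [[Xx Yx]|[Xx px]]; first by have [_ ->] := kerY.1 Yx.
  by split=> //; apply/kerY; split=> //; apply: sumsubl.
have iX : is_image X \pi_(quotZ Y) (imsub (sumsub X Y) \pi_(quotZ Y)).
  move=> q; rewrite (mem_imsub arp); split=> [[z /mem_sumsub[x [y [Xx Yy ->]]] ->]|[x Xx ->]].
    exists x => //; rewrite raddfD /=.
    by have [_ ->] := (proj_ker obY obS (@sumsubr X Y) y).1 Yy; rewrite addr0.
  by exists x => //; apply: sumsubl.
by rewrite [X in (_ = X + _)%N](dimension_additive dim arX kX iX); rewrite -addnA addnC [(_ + dim A (capsub X Y))%N]addnC.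
Qed.

(** By [dim_sum], a submodule [Z] of full dimension meets [X] in full dimension, so it contains [X],
    and likewise [Y]. *)
Lemma dc_sum X Y V : Ob U V -> Ob U X -> Ob U Y -> {subset X <= V} -> {subset Y <= V} ->
  dim_connected dim X -> dim_connected dim Y -> dim_connected dim (sumsub X Y).
Proof.
move=> obV obX obY XV YV dcX dcY Z [obZ ZS] nSZ; rewrite ltnNge; apply/negP => leSZ.
have obS := ob_sum obV obX obY XV YV.
have sub (X' : zmodClosed A) : Ob U X' -> {subset X' <= sumsub X Y} ->
    dim_connected dim X' -> {subset X' <= Z}.
  move=> obX' X'S dcX'; apply: contrapT => nX'Z.
  have obC := ob_cap obS obX' obZ X'S ZS.
  have ltC : (dim A (capsub X' Z) < dim A X')%N.
    apply: dcX'; first by split=> // x /mem_capsub[].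
    by move=> X'C; apply: nX'Z => x /X'C/mem_capsub[].
  have := dim_sum obS obX' obZ X'S ZS.
  have := dim_le (ob_sum obS obX' obZ X'S ZS) obS (sub_sumsub X'S ZS).
  move: leSZ ltC; move: (dim A Z) (dim A X') (dim A (capsub X' Z)).
  by move: (dim A (sumsub X' Z)) (dim A (sumsub X Y)) => *; lia.
apply: nSZ; apply: sub_sumsub; apply: sub => //; [exact: sumsubl|exact: sumsubr].
Qed.

Lemma dc_zero X : Ob U X -> dim_connected dim X -> dim A X = 0%N -> {in X, forall x, x = 0}.
Proof.
move=> obX dcX dX x Xx; apply/mem_zerosub; move: x Xx.
apply: contrapT => nX0; suff : (dim A zerosub < dim A X)%N by rewrite dX.
apply: dcX => //; split; first exact: ob_zero obX.
by move=> x /mem_zerosub->; rewrite rpred0.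
Qed.

End Dim.

(** The preimage of a proper submodule of the image is proper in [V] and contains the kernel; its
    loss of dimension is passed on to the image. *)
Lemma dc_im (A B : zmodType) (V : zmodClosed A) (W : zmodClosed B) f :
  Ar U V W f -> dim_connected dim V -> dim_connected dim (imsub V f).
Proof.
move=> arf dcV Z [obZ ZI] nIZ.
have obI := ob_imsub arf; have obW := ar_obr arf.
have ZW : {subset Z <= W} by move=> z /ZI /(imsub_sub arf).
have arc := mu_comp arf (mu_proj obZ obW ZW).
pose P := kersub V (\pi_(quotZ Z) \o f).
have memP x : x \in P <-> x \in V /\ f x \in Z.
  rewrite (mem_kersub arc) /=; have kZ := proj_ker obZ obW ZW (f x).
  split=> [[Vx px]|[Vx /kZ[_ ->]]] //; split=> //.
  by apply/kZ; split=> //; apply: ar_mem arf _ Vx.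
have obP : Ob U P := ob_kersub arc.
have PV : {subset P <= V} by move=> x /memP[].
have ltP : (dim A P < dim A V)%N.
  apply: dcV; first by split.
  move=> VP; apply: nIZ => y /(mem_imsub arf)[x /VP/memP[_ fxZ] ->] //.
have kP : is_kernel P f (kersub V f).
  move=> x; rewrite (mem_kersub arf) memP; split=> [[Vx fx0]|[[Vx _] fx0]] //.
  by rewrite fx0 rpred0.
have iP : is_image P f Z.
  move=> y; split=> [Zy|[x /memP[_ fxZ] ->]] //.
  have /(mem_imsub arf)[x Vx yE] := ZI _ Zy.
  by exists x => //; apply/memP; rewrite -yE.
have := dimension_additive dim (ar_restrict arf obP PV) kP iP.
have := dim_ker_im arf; lia.
Qed.

Lemma dim_inj (A B : zmodType) (V : zmodClosed A) (W : zmodClosed B) f :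
  Ar U V W f -> {in V, forall x, f x = 0 -> x = 0} -> dim B (imsub V f) = dim A V.
Proof.
move=> arf injf; rewrite (dim_ker_im arf) (dim_eq (Y := zerosub) (ob_kersub arf)) ?(dim_zero (ar_obl arf)) //.
  exact: ob_zero (ar_obl arf).
move=> x; apply/idP/idP => [/(mem_kersub arf)[Vx /injf]|/mem_zerosub->].
  by move=> x0; apply/mem_zerosub/x0.
by apply/(mem_kersub arf); rewrite rpred0 (ar0 arf).
Qed.

End Universe.

(** * The ring of compatible endomorphisms and its rank function *)

Definition ext_fun (A : zmodType) (V : zmodClosed A) (f : subZ V -> subZ V) (a : A) : A :=
  val (f (insubd 0 a)).

Section Endo.
Variables (U : modular_universe) (A : zmodType) (V : zmodClosed A) (obV : Ob U V).

(** Arrows are functions on the ambient group whose values outside [V] are arbitrary. Storing a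
    function on [subZ V] makes equality extensional, so that the ring axioms hold as equalities. *)
Record endo := Endo { efun : subZ V -> subZ V; endoP : Ar U V V (ext_fun efun) }.

Lemma endo_eq (f g : endo) : efun f =1 efun g -> f = g.
Proof.
case: f g => [f pf] [g pg] /= /funext e; subst g.
by congr Endo; apply: Prop_irrelevance.
Qed.

HB.instance Definition _ := gen_eqMixin endo.
HB.instance Definition _ := gen_choiceMixin endo.

Lemma ext_funE (f : subZ V -> subZ V) (v : subZ V) : ext_fun f (val v) = val (f v).
Proof. by rewrite /ext_fun valKd. Qed.

(* The endomorphism induced by an arrow between the ambient groups. *)
Lemma endo_of_subproof (g : A -> A) : Ar U V V g ->
  Ar U V V (ext_fun (fun v : subZ V => insubd (0 : subZ V) (g (val v)))).
Proof.
move=> arg; apply: (mu_ext _ arg) => x Vx; rewrite /ext_fun insubdK; last first.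
  by rewrite insubdK //; exact: ar_mem arg _ Vx.
by rewrite insubdK.
Qed.

Definition endo_of g (arg : Ar U V V g) : endo := Endo (endo_of_subproof arg).

Lemma endo_ofE g (arg : Ar U V V g) v : val (efun (endo_of arg) v) = g (val v).
Proof. by rewrite insubdK //; apply: ar_mem arg _ (valP v). Qed.

Lemma endo_ar (f : endo) (g : A -> A) : (forall v : subZ V, g (val v) = val (efun f v)) ->
  Ar U V V g.
Proof.
move=> gE; apply: (mu_ext _ (endoP f)) => x Vx.
by rewrite /ext_fun -gE (insubdK (0 : subZ V) Vx).
Qed.

Lemma efunD (f : endo) v w : efun f (v + w) = efun f v + efun f w.
Proof.
apply: val_inj; rewrite -(ext_funE (efun f)) GRing.valD (arD (endoP f)) ?(valP v) ?(valP w) //.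
by rewrite GRing.valD -!(ext_funE (efun f)).
Qed.

Definition endo0 := endo_of (ar_zero (mu_id obV)).
Definition endo1 := endo_of (mu_id obV).
Definition endo_add (f g : endo) := endo_of (ar_add (endoP f) (endoP g)).
Definition endo_opp (f : endo) := endo_of (ar_opp (endoP f)).
Definition endo_mul (f g : endo) := endo_of (mu_comp (endoP g) (endoP f)).

Lemma endo0E v : efun endo0 v = 0. Proof. by apply: val_inj; rewrite endo_ofE. Qed.
Lemma endo1E v : efun endo1 v = v. Proof. by apply: val_inj; rewrite endo_ofE. Qed.
Lemma endo_addE f g v : efun (endo_add f g) v = efun f v + efun g v.
Proof. by apply: val_inj; rewrite endo_ofE !ext_funE. Qed.
Lemma endo_oppE f v : efun (endo_opp f) v = - efun f v.
Proof. by apply: val_inj; rewrite endo_ofE !ext_funE. Qed.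
Lemma endo_mulE f g v : efun (endo_mul f g) v = efun f (efun g v).
Proof.
by apply: val_inj; rewrite endo_ofE -[LHS]/(ext_fun _ (ext_fun _ _)) !ext_funE.
Qed.

(* The zero and the unit of this ring need a proof that V is an object. *)
Definition endo_ring (_ : Ob U V) := endo.
HB.instance Definition _ := Choice.on (endo_ring obV).

Lemma endo_addA : associative (endo_add : endo_ring obV -> endo_ring obV -> endo_ring obV).
Proof. by move=> f g h; apply: endo_eq => v; rewrite !endo_addE addrA. Qed.
Lemma endo_addC : commutative (endo_add : endo_ring obV -> endo_ring obV -> endo_ring obV).
Proof. by move=> f g; apply: endo_eq => v; rewrite !endo_addE addrC. Qed.
Lemma endo_add0 : left_id (endo0 : endo_ring obV) endo_add.
Proof. by move=> f; apply: endo_eq => v; rewrite !endo_addE endo0E add0r. Qed.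
Lemma endo_addN : left_inverse (endo0 : endo_ring obV) endo_opp endo_add.
Proof. by move=> f; apply: endo_eq => v; rewrite !endo_addE endo_oppE endo0E addNr. Qed.
Lemma endo_mulA : associative (endo_mul : endo_ring obV -> endo_ring obV -> endo_ring obV).
Proof. by move=> f g h; apply: endo_eq => v; rewrite !endo_mulE. Qed.
Lemma endo_mul1l : left_id (endo1 : endo_ring obV) endo_mul.
Proof. by move=> f; apply: endo_eq => v; rewrite !endo_mulE endo1E. Qed.
Lemma endo_mul1r : right_id (endo1 : endo_ring obV) endo_mul.
Proof. by move=> f; apply: endo_eq => v; rewrite !endo_mulE endo1E. Qed.
Lemma endo_mulDl : left_distributive (endo_mul : endo_ring obV -> endo_ring obV -> endo_ring obV) endo_add.
Proof. by move=> f g h; apply: endo_eq => v; rewrite !(endo_mulE, endo_addE). Qed.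
Lemma endo_mulDr : right_distributive (endo_mul : endo_ring obV -> endo_ring obV -> endo_ring obV) endo_add.
Proof. by move=> f g h; apply: endo_eq => v; rewrite !(endo_mulE, endo_addE) efunD. Qed.

HB.instance Definition _ := GRing.isPzRing.Build (endo_ring obV)
  endo_addA endo_addC endo_add0 endo_addN endo_mulA endo_mul1l endo_mul1r
  endo_mulDl endo_mulDr.

Lemma erD (f g : endo_ring obV) v : efun (f + g) v = efun f v + efun g v.
Proof. exact: endo_addE. Qed.
Lemma erN (f : endo_ring obV) v : efun (- f) v = - efun f v.
Proof. exact: endo_oppE. Qed.
Lemma erM (f g : endo_ring obV) v : efun (f * g) v = efun f (efun g v).
Proof. exact: endo_mulE. Qed.
Lemma er1 v : efun (1 : endo_ring obV) v = v. Proof. exact: endo1E. Qed.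
Lemma er0 v : efun (0 : endo_ring obV) v = 0. Proof. exact: endo0E. Qed.

End Endo.

Section EndoRank.
Variables (U : modular_universe) (dim : additive_dimension U).
Variables (A : zmodType) (V : zmodClosed A) (obV : Ob U V).
Hypothesis dcV : dim_connected dim V.
Local Notation E := (endo_ring obV).

Definition endo_im (f : E) : zmodClosed A := imsub V (ext_fun (efun f)).
Definition endo_rank (f : E) : nat := dim A (endo_im f).
Arguments endo_rank f%_R.

Lemma mem_endo_im (f : E) y : y \in endo_im f <-> exists v, y = val (efun f v).
Proof.
rewrite (mem_imsub (endoP f)); split=> [[x Vx ->]|[v ->]].
  by exists (insubd 0 x).
by exists (val v); [exact: valP|rewrite ext_funE].
Qed.

Lemma ob_endo_im f : Ob U (endo_im f). Proof. exact: ob_imsub (endoP f). Qed.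
Lemma endo_im_sub f : {subset endo_im f <= V}. Proof. exact: imsub_sub (endoP f). Qed.
Lemma dc_endo_im f : dim_connected dim (endo_im f). Proof. exact: dc_im (endoP f) dcV. Qed.

Lemma endo_rank_eq0 f : endo_rank f = 0%N <-> f = 0.
Proof.
split=> [r0|->].
  apply: endo_eq => v; rewrite er0; apply: val_inj.
  have /(_ (val (efun f v))) := dc_zero (ob_endo_im f) (dc_endo_im (f := f)) r0.
  by apply; apply/mem_endo_im; exists v.
rewrite /endo_rank -[RHS](dim_zero dim obV); apply: dim_eq; [exact: ob_endo_im|exact: ob_zero obV|].
move=> y; apply/idP/idP => [/mem_endo_im[v ->]|/mem_zerosub ->]; last exact: rpred0.
by apply/mem_zerosub; rewrite er0.
Qed.

Lemma endo_rankD (f g : E) : (endo_rank (f + g) <= endo_rank f + endo_rank g)%N.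
Proof.
have obf := ob_endo_im f; have obg := ob_endo_im g.
have := dim_sum dim obV obf obg (@endo_im_sub f) (@endo_im_sub g).
move=> e; rewrite /endo_rank -e; apply: leq_trans (leq_addr _ _).
apply: dim_le; [exact: ob_endo_im|exact: ob_sum obV obf obg (@endo_im_sub f) (@endo_im_sub g)|].
move=> y /mem_endo_im[v ->]; apply/mem_sumsub; rewrite erD.
by exists (val (efun f v)), (val (efun g v)); split=> //; apply/mem_endo_im; exists v.
Qed.

Definition endo_ker_im (f g : E) : zmodClosed A :=
  kersub (endo_im g) (ext_fun (efun f)).
Arguments endo_ker_im (f g)%_R.

Lemma endo_rankM (f g : E) : endo_rank g = (dim A (endo_ker_im f g) + endo_rank (f * g))%N.
Proof.
have arf := ar_restrict (endoP f) (ob_endo_im g) (@endo_im_sub g).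
rewrite {1}/endo_rank (dim_ker_im dim arf); congr (_ + _)%N; apply: dim_eq.
- exact: ob_imsub arf.
- exact: ob_endo_im.
move=> y; apply/idP/idP => [/(mem_imsub arf)[_ /mem_endo_im[v ->] ->]|/mem_endo_im[v ->]].
  by apply/mem_endo_im; exists v; rewrite erM ext_funE.
apply/(mem_imsub arf); exists (val (efun g v)); last by rewrite ext_funE erM.
by apply/mem_endo_im; exists v.
Qed.

(** By [endo_rankM] the two rank losses under [f] are the dimensions of its kernel on the image of
    [g h] and on the image of [g], and the former image lies in the latter. *)
Lemma endo_rank_frobenius (f g h : E) :
  (endo_rank (f * g) + endo_rank (g * h) <= endo_rank g + endo_rank (f * g * h))%N.
Proof.
have := endo_rankM f g; have := endo_rankM f (g * h); rewrite mulrA.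
have sub : {subset endo_im (g * h) <= endo_im g}.
  by move=> y /mem_endo_im[v ->]; apply/mem_endo_im; exists (efun h v); rewrite erM.
have ar1 := ar_restrict (endoP f) (ob_endo_im g) (@endo_im_sub g).
have ar2 := ar_restrict (endoP f) (ob_endo_im (g * h)) (@endo_im_sub (g * h)).
have : (dim A (endo_ker_im f (g * h)) <= dim A (endo_ker_im f g))%N.
  apply: dim_le; [exact: ob_kersub ar2|exact: ob_kersub ar1|].
  by move=> y /(mem_kersub ar2)[/sub my y0]; apply/(mem_kersub ar1).
move: (dim A _) (dim A _) (endo_rank _) (endo_rank _) (endo_rank _) (endo_rank _) => *; lia.
Qed.

Definition endo_rank_function : rank_function E :=
  RankFunction endo_rank_eq0 endo_rankD endo_rank_frobenius.

Lemma endo_rank1 : endo_rank 1 = dim A V.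
Proof.
apply: dim_eq; [exact: ob_endo_im|exact: obV|].
move=> y; apply/idP/idP => [/mem_endo_im[v ->]|Vy]; first exact: valP.
by apply/mem_endo_im; exists (insubd 0 y); rewrite er1 insubdK.
Qed.

(** Doubling maps [V] onto itself, by divisibility if q = 0 and because (q + 1)/2 inverts 2 if q is
    odd; so x + x and x have the same image. *)
Lemma endo_rank_double q : has_characteristic V q -> q != 2%N ->
  forall x, endo_rank (x + x) = endo_rank x.
Proof.
move=> chV q2 x.
have div2 v : v \in V -> exists2 u, u \in V & u + u = v.
  move=> Vv; move: chV; rewrite /has_characteristic; case: eqP => [_ divV|_ [pq _ qV]].
    by have [u Vu <-] := divV 2%N isT v Vv; exists u; rewrite ?mulr2n.
  exists (v *+ (q./2).+1); first by rewrite rpredMn.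
  have oddq : odd q by case: (even_prime pq) => // q2'; rewrite q2' in q2.
  have e : ((q./2).+1.*2 = q.+1)%N by rewrite doubleS -{2}[q]odd_double_half oddq.
  by rewrite -mulr2n -mulrnA muln2 e mulrS qV // addr0.
apply: dim_eq; [exact: ob_endo_im|exact: ob_endo_im|].
move=> y; apply/idP/idP => /mem_endo_im[v ->]; apply/mem_endo_im.
  by exists (v + v); rewrite erD efunD.
have [u Vu uu] := div2 _ (valP v); exists (insubd 0 u).
rewrite erD -efunD; congr (val (efun x _)); apply: val_inj.
by rewrite GRing.valD insubdK.
Qed.

Lemma endo_char2 : has_characteristic V 2 -> 2%:R = 0 :> E.
Proof.
move=> [_ _ V2]; apply: endo_eq => v; rewrite er0 mulr2n erD er1.
by apply: val_inj; rewrite GRing.valD -mulr2n V2 ?(valP v).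
Qed.

End EndoRank.

(** * Disjoint 3-cycles acting on the module *)

Section ModuleKey.
Variables (n d q : nat) (G : {group 'S_n}) (U : modular_universe) (dim : additive_dimension U).
Variables (A : zmodType) (V : zmodClosed A) (rho : 'S_n -> A -> A).
Hypothesis hG : G = ('Alt_('I_n))%g :> {set 'S_n} \/ G = ('Sym_('I_n))%g :> {set 'S_n}.
Hypothesis hV : Mod dim G V rho d q.

Let gm := Mod_gmod hV.
Let obV := gmod_ob gm.

Lemma mem_G_even g : ~~ odd_perm g -> g \in G.
Proof. by move=> evg; case: hG => ->; rewrite ?Alt_even ?inE. Qed.

(** Permutations multiply from left to right and endomorphisms from right to left; the inverse turns
    the action into a multiplicative map. The value 1 outside [G] is a default. *)
Definition G_op (g : 'S_n) : endo_ring obV :=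
  if pselect (g^-1%g \in G) is left H then endo_of (gmod_ar gm H) else 1.

Lemma G_opE g v : g \in G -> val (efun (G_op g) v) = rho g^-1%g (val v).
Proof.
by rewrite /G_op; case: pselect => [H _|H /groupVr //]; rewrite endo_ofE.
Qed.

Definition alt_flag : bool := `[< G = ('Alt_('I_n))%g :> {set 'S_n} >].

Lemma in_classE g : in_class alt_flag g = (g \in G).
Proof.
rewrite /in_class /alt_flag; case: asboolP => [->|nA]; first by rewrite Alt_even.
by case: hG => // ->; rewrite inE.
Qed.

Lemma G_op_rep : perm_rep alt_flag G_op.
Proof.
split=> [|g h]; first apply: endo_eq => v; last rewrite !in_classE => Gg Gh.
  apply: val_inj; rewrite G_opE // invg1 (gmod1 gm) ?(valP v) //.
  by rewrite er1.
apply: endo_eq => v; rewrite erM; apply: val_inj; rewrite !G_opE ?groupM // invMg.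
by rewrite (gmodM gm) ?groupV ?(valP v).
Qed.

Lemma G_op_faithful g : faithful_Gmodule G V rho -> g \in G -> G_op g = 1 -> g = 1%g.
Proof.
move=> fa Gg g1; apply: invg_inj; rewrite invg1; apply: (fa _ (groupVr Gg)) => x Vx.
have := G_opE (insubd 0 x) Gg; rewrite g1 er1 insubdK //.
Qed.

Lemma module_cycles_null : (d < n)%N -> (7 <= n)%N ->
  (G = ('Alt_('I_n))%g :> {set 'S_n} -> q = 2%N -> (10 <= n)%N) ->
  disjoint_cycles_null G_op 1.
Proof.
move=> ltdn n7 n10; have dcV := Mod_dc hV; have ch := Mod_char hV.
pose rf := endo_rank_function obV dcV.
have rk1 : (rk rf 1%R < #|'I_n|)%N by rewrite card_ord /= endo_rank1 (Mod_dim hV).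
have [q2|q2] := eqVneq q 2%N.
  rewrite q2 in ch; have c2 := endo_char2 obV ch.
  apply: (even_key c2 G_op_rep _ _ rk1); rewrite card_ord //.
  by move=> /asboolP GA; apply: n10.
have HP : perm_rep true G_op.
  by have := G_op_rep; case: alt_flag => // /perm_rep_even.
apply: (odd_key (rf := rf) HP) => //; last by rewrite card_ord.
exact: endo_rank_double ch q2.
Qed.

Lemma cycle_fixes (x : nat -> 'I_n) v : (d < n)%N -> (7 <= n)%N ->
  (G = ('Alt_('I_n))%g :> {set 'S_n} -> q = 2%N -> (10 <= n)%N) ->
  points 6 [set: 'I_n] x -> v \in V ->
  rho (word_perm x (cycle3 3 4 5)) (v - rho (word_perm x (cycle3 0 1 2)) v) =
  v - rho (word_perm x (cycle3 0 1 2)) v.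
Proof.
move=> ltdn n7 n10 px Vv; have key := module_cycles_null ltdn n7 n10.
(* This relabelling inverts both 3-cycles and so compensates for the inverse in [G_op]. *)
pose s := nth 0%N [:: 0; 2; 1; 3; 5; 4]%N.
have pxs : points 6 [set: 'I_n] (x \o s) by apply: points_comp px _.
have HP : perm_rep true G_op.
  by have := G_op_rep; case: alt_flag => // /perm_rep_even.
have HR := points_rep HP pxs.
have cV a b c : word_perm (x \o s) (cycle3 a b c) \in G -> forall u, u \in V ->
    val (efun (word_op G_op (x \o s) (cycle3 a b c)) (insubd 0 u)) =
    rho (word_perm (x \o s) (cycle3 a b c))^-1%g u.
  by move=> Gc u Vu; rewrite G_opE // insubdK.
have Gc a b c : ok_word 6 true (cycle3 a b c) -> word_perm (x \o s) (cycle3 a b c) \in G.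
  by move=> okw; apply: mem_G_even; have [] := ok_word_class pxs okw.
have inv a b c a' b' c' : s a = a' -> s b = c' -> s c = b' ->
    ((word_perm (x \o s) (cycle3 a b c))^-1 = word_perm x (cycle3 a' b' c'))%g.
  move=> <- <- <-; rewrite /word_perm !big_cons big_nil /= !mulg1 invMg !tpermV.
  by rewrite big_nil mulg1.
have := congr1 (fun f => efun f (insubd 0 v)) (key _ pxs).
rewrite mulr1 er0 !(gevalM1 HR) erM !erD !erN !er1.
set w := insubd 0 v; set cw := efun _ w => /eqP.
have wE : val w = v by rewrite insubdK.
have cwE : val cw = rho (word_perm x (cycle3 0 1 2)) v.
  by rewrite /cw G_opE ?Gc // (inv _ _ _ 0 1 2)%N // wE.
rewrite subr_eq0 => /eqP/(congr1 val).
rewrite G_opE ?Gc // (inv _ _ _ 3 4 5)%N // GRing.valB wE cwE => <-.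
by [].
Qed.

End ModuleKey.

(** * Fixed vectors, the line and its translates *)

Section Generation.
Variable T : finType.

(** Induction on the number of moved points: a 3-cycle through [t], [g t] and a third moved point
    makes [t] fixed. If there is no third moved point, [g] is a transposition, which is odd. *)
Lemma three_cycle_ind (P : {perm T} -> Prop) (D : {set T}) :
  P 1%g -> (forall g h, P g -> P h -> P (g * h)%g) ->
  (forall x y z, x \in D -> y \in D -> z \in D -> x != y -> x != z -> y != z ->
     P (tperm x y * tperm x z)%g) ->
  forall g, perm_on D g -> ~~ odd_perm g -> P g.
Proof.
move=> P1 PM Pc g; elim: {g}_.+1 {-2}g (ltnSn #|[set t | g t != t]|) => // m IH g.
set M := [set t | g t != t] => ltM onD evg.
have MD : {subset M <= D} by move=> t; rewrite inE => gt; apply: (subsetP onD); rewrite inE.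
have [M0|[t tM]] := set_0Vmem M.
  suff -> : g = 1%g by [].
  apply/permP => t; rewrite perm1; apply/eqP/negPn/negP => gt.
  by have := in_set0 t; rewrite -M0 inE gt.
have gt : g t != t by have := tM; rewrite inE.
have uM : g t \in M by rewrite inE (inj_eq perm_inj).
have [z /and3P[zM zt zu]|none] := pickP (fun z => [&& z \in M, z != t & z != g t]).
  pose c := (tperm (g t) t * tperm (g t) z)%g.
  pose c' := (tperm (g t) z * tperm (g t) t)%g.
  have cK : (c * c' = 1)%g by rewrite /c /c' mulgA -(mulgA (tperm (g t) t)) tperm2 mulg1 tperm2.
  have gE : g = (g * c * c')%g by rewrite -mulgA cK mulg1.
  have c_out y : y \notin M -> c y = y.
    move=> yM; rewrite permM !tpermD //; apply: contraNneq yM => <- //.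
  have gct : (g * c)%g t = t.
    by rewrite !permM tpermL tpermD // eq_sym.
  rewrite gE; apply: PM; last first.
    by apply: Pc; rewrite ?MD // eq_sym.
  apply: IH.
  - rewrite -ltnS (leq_trans _ ltM) // ltnS proper_card //; apply/properP; split.
      apply/subsetP => y; rewrite !inE; apply: contraNneq => gy.
      by rewrite permM gy c_out // inE gy eqxx.
    by exists t => //; rewrite inE gct eqxx.
  - apply/subsetP => y; rewrite inE; apply: contraR => yD.
    have yM : y \notin M by apply: contra yD; exact: MD.
    by rewrite permM; have := yM; rewrite inE negbK => /eqP->; rewrite c_out.
  by rewrite !odd_permM !odd_tperm gt (eq_sym _ z) zu addbb addbF.
suff gtp : g = tperm t (g t) by move: evg; rewrite gtp odd_tperm eq_sym gt.
apply/permP => y; case: tpermP => [->//|->|yt yu].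
  have ggt : g (g t) \in M by rewrite inE !(inj_eq perm_inj).
  have := none (g (g t)); rewrite ggt (inj_eq perm_inj) gt andbT /= => /negbT.
  by rewrite negbK => /eqP.
apply/eqP; have := none y; rewrite inE (introN eqP yt) (introN eqP yu) !andbT.
by move/negbT; rewrite negbK.
Qed.

End Generation.

Lemma uniq_points (T : finType) (t : T) (s : seq T) :
  uniq s -> points (size s) [set: T] (nth t s).
Proof.
move=> us; split=> [i j lti ltj /eqP|i _]; last by rewrite inE.
by rewrite nth_uniq // => /eqP.
Qed.

Section Lines.
Variables (n d q : nat) (G : {group 'S_n}) (U : modular_universe) (dim : additive_dimension U).
Variables (A : zmodType) (V : zmodClosed A) (rho : 'S_n -> A -> A).
Hypothesis hG : G = ('Alt_('I_n))%g :> {set 'S_n} \/ G = ('Sym_('I_n))%g :> {set 'S_n}.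
Hypothesis hV : Mod dim G V rho d q.
Hypotheses (ltdn : (d < n)%N) (n7 : (7 <= n)%N).
Hypothesis n10 : G = ('Alt_('I_n))%g :> {set 'S_n} -> q = 2%N -> (10 <= n)%N.

Let gm := Mod_gmod hV.
Let obV := gmod_ob gm.

Lemma rho_mem g v : g \in G -> v \in V -> rho g v \in V.
Proof. by move=> Gg; apply: ar_mem (gmod_ar gm Gg) _. Qed.

Lemma rhoM g h v : g \in G -> h \in G -> v \in V -> rho h (rho g v) = rho (g * h)%g v.
Proof. by move=> Gg Gh Vv; rewrite (gmodM gm). Qed.

Lemma rhoB g u v : g \in G -> u \in V -> v \in V -> rho g (u - v) = rho g u - rho g v.
Proof. by move=> Gg Vu Vv; rewrite (arB (gmod_ar gm Gg)). Qed.

Lemma rhoD g u v : g \in G -> u \in V -> v \in V -> rho g (u + v) = rho g u + rho g v.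
Proof. by move=> Gg Vu Vv; rewrite (arD (gmod_ar gm Gg)). Qed.

Definition cyc (a b c : 'I_n) : 'S_n := (tperm a b * tperm a c)%g.

Lemma odd_cyc a b c : a != b -> a != c -> ~~ odd_perm (cyc a b c).
Proof. by move=> ab ac; rewrite odd_permM !odd_tperm ab ac. Qed.

Lemma cycE a b c : uniq [:: a; b; c] -> [/\ cyc a b c a = b, cyc a b c b = c & cyc a b c c = a].
Proof.
rewrite /= !inE !negb_or andbT => /andP[/andP[ab ac] bc].
rewrite !permM tpermL tpermR tpermL (@tpermD _ a c b) 1?(@tpermD _ a b c) ?tpermR //;
  by rewrite 1?eq_sym.
Qed.

Lemma cyc_out a b c y : y != a -> y != b -> y != c -> cyc a b c y = y.
Proof. by move=> ya yb yc; rewrite permM !tpermD // eq_sym. Qed.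

Let even_mem g (ev : ~~ odd_perm g) : g \in G := mem_G_even hG ev.

Lemma mem_G_odd s t : s \in G -> odd_perm s -> t \in G.
Proof. by case: hG => ->; [rewrite Alt_even => /negPf-> | rewrite !inE]. Qed.

Lemma cyc_mem a b c : a != b -> a != c -> cyc a b c \in G.
Proof. by move=> ab ac; apply/even_mem/odd_cyc. Qed.

Lemma disjoint_cyc a b c a' b' c' v : uniq [:: a; b; c; a'; b'; c'] -> v \in V ->
  rho (cyc a' b' c') (v - rho (cyc a b c) v) = v - rho (cyc a b c) v.
Proof.
move=> us Vv; have px := uniq_points a us.
have := cycle_fixes hG hV ltdn n7 n10 px Vv.
by rewrite /word_perm !big_cons !big_nil /= !mulg1.
Qed.

(* The image of 1 - (a b c) is fixed by the alternating group of the rest. *)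
Lemma commutator_fixed a b c v g : uniq [:: a; b; c] -> v \in V ->
  ~~ odd_perm g -> g a = a -> g b = b -> g c = c ->
  rho g (v - rho (cyc a b c) v) = v - rho (cyc a b c) v.
Proof.
move=> uabc Vv evg ga gb gc; set w := v - _.
have /andP[] := uabc; rewrite !inE !negb_or => /andP[ab ac] /= /andP[bc _].
have Gc : cyc a b c \in G by apply: cyc_mem.
have Vw : w \in V by rewrite rpredB ?rho_mem.
pose P h := ~~ odd_perm h /\ rho h w = w.
suff [] : P g by [].
apply: (@three_cycle_ind _ P (~: [set a; b; c])) => //.
- by split; [rewrite odd_perm1|rewrite (gmod1 gm)].
- move=> h k [evh hw] [evk kw]; split; first by rewrite odd_permM (negPf evh).
  by rewrite -rhoM ?even_mem // hw.
- move=> y z t; rewrite !inE !negb_or => /andP[/andP[ya yb] yc] /andP[/andP[za zb] zc].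
  move=> /andP[/andP[ta tb] tc] yz yt zt; split; first exact: odd_cyc.
  apply: disjoint_cyc => //=; rewrite !inE !negb_or ab ac bc yz yt zt /=.
  by rewrite !(eq_sym _ y) !(eq_sym _ z) !(eq_sym _ t) ya yb yc za zb zc ta tb tc.
apply/subsetP => y; rewrite inE; apply: contraR; rewrite inE negbK !inE.
by move=> /orP[/orP[]|] /eqP->; rewrite ?ga ?gb ?gc.
Qed.

Variable x : nat -> 'I_n.
Hypothesis px : points 7 [set: 'I_n] x.

Lemma xneq i j : [&& i < 7, j < 7 & i != j]%N -> x i != x j.
Proof.
move=> /and3P[lti ltj]; apply: contraNneq => e; have [injx _] := px.
by apply/eqP; apply: injx e.
Qed.

Let a := cyc (x 0) (x 3) (x 4).
Let b := cyc (x 0) (x 1) (x 2).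
Let wv v := v - rho b v.
(** In the standard module, with e_i at [x i], the factor 1 - b leaves only coefficients at e_0,
    e_1, e_2, and 1 - a then returns the e_0-coefficient times e_0 - e_3. *)
Definition line_map v := wv v - rho a (wv v).
Definition line : zmodClosed A := imsub V line_map.

Let Ga : a \in G. Proof. by apply: cyc_mem; apply: xneq. Qed.
Let Gb : b \in G. Proof. by apply: cyc_mem; apply: xneq. Qed.
Let Vw v : v \in V -> wv v \in V. Proof. by move=> Vv; rewrite rpredB ?rho_mem. Qed.

Lemma ar_line_map : Ar U V V line_map.
Proof.
have arw : Ar U V V wv.
  exact: ar_add (mu_id obV) (ar_opp (gmod_ar gm Gb)).
exact: ar_add arw (ar_opp (mu_comp arw (gmod_ar gm Ga))).
Qed.

Lemma mem_line l : l \in line <-> exists2 v, v \in V & l = line_map v.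
Proof. exact: (mem_imsub ar_line_map). Qed.

Lemma ob_line : Ob U line. Proof. exact: ob_imsub ar_line_map. Qed.
Lemma line_sub : {subset line <= V}. Proof. exact: imsub_sub ar_line_map. Qed.
Lemma dc_line : dim_connected dim line. Proof. exact: dc_im ar_line_map (Mod_dc hV). Qed.

Lemma uniq3 i j k : [&& i < 7, j < 7, k < 7, i != j, i != k & j != k]%N ->
  uniq [:: x i; x j; x k].
Proof.
move=> /and5P[li lj lk ij /andP[ik jk]].
by rewrite /= !inE !negb_or !xneq // ?li ?lj ?lk ?ij ?ik ?jk.
Qed.

Lemma wv_fixed v g : v \in V -> ~~ odd_perm g -> g (x 0) = x 0 -> g (x 1) = x 1 ->
  g (x 2) = x 2 -> rho g (wv v) = wv v.
Proof. by move=> Vv; apply: commutator_fixed => //; apply: uniq3. Qed.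

Lemma wv_eq v g h : v \in V -> ~~ odd_perm g -> ~~ odd_perm h -> g (x 0) = h (x 0) ->
  g (x 1) = h (x 1) -> g (x 2) = h (x 2) -> rho g (wv v) = rho h (wv v).
Proof.
move=> Vv evg evh g0 g1 g2; rewrite -[g in LHS](mulgKV h).
have evk : ~~ odd_perm (g * h^-1)%g by rewrite odd_permM odd_permV (negPf evg).
rewrite -rhoM ?even_mem ?Vw // wv_fixed // permM ?g0 ?g1 ?g2 permK //.
Qed.

Lemma cyc_x i j k : [&& i < 7, j < 7, k < 7, i != j, i != k & j != k]%N ->
  [/\ cyc (x i) (x j) (x k) (x i) = x j, cyc (x i) (x j) (x k) (x j) = x k
    & cyc (x i) (x j) (x k) (x k) = x i].
Proof. by move=> /uniq3/cycE. Qed.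

Lemma cyc_x_out i j k m : [&& m < 7, i < 7, j < 7 & k < 7]%N -> [&& m != i, m != j & m != k]%N ->
  cyc (x i) (x j) (x k) (x m) = x m.
Proof.
move=> /and4P[lm li lj lk] /and3P[mi mj mk].
by apply: cyc_out; apply: xneq; apply/and3P.
Qed.

(** The factor 1 - b gives invariance under even permutations fixing [x 0], [x 1], [x 2], [x 3]
    ([fix1]), the factor 1 - a under those fixing [x 0], [x 3], [x 4] ([fix2]). It then suffices to
    bring g (x 4) back to [x 4] by such permutations. *)
Lemma line_fixed l g : l \in line -> ~~ odd_perm g -> g (x 0) = x 0 -> g (x 3) = x 3 ->
  rho g l = l.
Proof.
move=> /mem_line[v Vv ->].
have fix1 h : ~~ odd_perm h -> h (x 0) = x 0 -> h (x 1) = x 1 -> h (x 2) = x 2 ->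
    h (x 3) = x 3 -> rho h (line_map v) = line_map v.
  move=> evh h0 h1 h2 h3; have Gh := even_mem evh.
  rewrite rhoB ?rho_mem ?Vw // wv_fixed // rhoM ?Vw //; congr (_ - _).
  have [a0 _ _] := cyc_x (isT : [&& 0 < 7, 3 < 7, 4 < 7, 0 != 3, 0 != 4 & 3 != 4]%N).
  have eva : ~~ odd_perm a by apply: odd_cyc; apply: xneq.
  have a1 : a (x 1) = x 1 by apply: cyc_x_out.
  have a2 : a (x 2) = x 2 by apply: cyc_x_out.
  have hE j : (j < 3)%N -> (a * h)%g (x j) = a (x j).
    by rewrite permM; case: j => [|[|[|]]] // _; rewrite ?a0 ?a1 ?a2 ?h0 ?h1 ?h2 ?h3.
  by apply: wv_eq; rewrite ?hE // odd_permM (negPf eva).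
have fix2 h : ~~ odd_perm h -> h (x 0) = x 0 -> h (x 3) = x 3 -> h (x 4) = x 4 ->
    rho h (line_map v) = line_map v.
  by move=> evh h0 h3 h4; apply: commutator_fixed; rewrite ?Vw //; apply: uniq3.
have Ll : line_map v \in V by apply: ar_mem ar_line_map _ Vv.
have fixM h k : ~~ odd_perm h -> ~~ odd_perm k -> rho h (line_map v) = line_map v ->
    rho (k * h)%g (line_map v) = line_map v -> rho k (line_map v) = line_map v.
  move=> evh evk hl; rewrite -rhoM ?even_mem // => khl.
  have evh' : ~~ odd_perm h^-1%g by rewrite odd_permV.
  have -> : rho k (line_map v) = rho h^-1%g (rho h (rho k (line_map v))).
    by rewrite rhoM ?rho_mem ?even_mem // mulgV (gmod1 gm) ?rho_mem ?even_mem.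
  by rewrite khl -{1}hl rhoM ?even_mem // mulgV (gmod1 gm).
move=> evg g0 g3; have [y yE] : exists y, g (x 4) = y by exists (g (x 4)).
have y0 : y != x 0 by rewrite -g0 -yE (inj_eq perm_inj) xneq.
have y3 : y != x 3 by rewrite -g3 -yE (inj_eq perm_inj) xneq.
have [y4|y4] := eqVneq y (x 4); first by apply: fix2; rewrite ?yE.
have cycle_case h : ~~ odd_perm h -> rho h (line_map v) = line_map v ->
  h (x 0) = x 0 -> h (x 3) = x 3 -> h y = x 4 -> rho g (line_map v) = line_map v.
  move=> evh hl h0 h3 hy; apply: (fixM h) => //.
  by apply: fix2; rewrite ?permM ?g0 ?g3 ?yE // odd_permM (negPf evg).
have far : y != x 1 -> y != x 2 -> rho g (line_map v) = line_map v.
  move=> y1 y2; have [k [k5 k7' yk]] : exists k, [/\ (5 <= k)%N, (k < 7)%N & y != x k].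
    by have [->|y5] := eqVneq y (x 5); [exists 6; split=> //; apply: xneq | exists 5].
  have k7 i : (i < 5)%N -> x i != x k.
    move=> lti; apply: xneq; rewrite k7' (leq_trans lti) // neq_ltn (leq_trans lti) //.
  have u : uniq [:: y; x 4; x k] by rewrite /= !inE !negb_or y4 yk k7.
  have [cy _ _] := cycE u.
  have evc : ~~ odd_perm (cyc y (x 4) (x k)) by apply: odd_cyc.
  have out i : (i < 4)%N -> y != x i -> cyc y (x 4) (x k) (x i) = x i.
    move=> lti yi; apply: cyc_out; [by rewrite eq_sym| |exact: k7 (ltnW lti)].
    by apply: xneq; rewrite (ltn_trans lti) // neq_ltn lti.
  by apply: (cycle_case (cyc y (x 4) (x k))); rewrite ?out //; apply: fix1; rewrite ?out.
(* No element of [fix1] moves [x 1] or [x 2], so the point is first sent to [x 5] by [h1], covered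
   by [fix2], and then to [x 4] by [h2], covered by [fix1]. *)
have near i : (0 < i < 3)%N -> y = x i -> rho g (line_map v) = line_map v.
  move=> i12 yi; pose h1 := cyc (x i) (x 5) (x 6); pose h2 := cyc (x 5) (x 4) (x 6).
  have c1 : h1 (x i) = x 5.
    rewrite /h1; case: i i12 {h1 yi} => [|[|[|i]]] // _.
      by have [] := cyc_x (isT : [&& 1 < 7, 5 < 7, 6 < 7, 1 != 5, 1 != 6 & 5 != 6]%N).
    by have [] := cyc_x (isT : [&& 2 < 7, 5 < 7, 6 < 7, 2 != 5, 2 != 6 & 5 != 6]%N).
  have ev1 : ~~ odd_perm h1.
    by rewrite /h1; case: i i12 {h1 yi c1} => [|[|[|i]]] // _; apply: odd_cyc; apply: xneq.
  have ev2 : ~~ odd_perm h2 by apply: odd_cyc; apply: xneq.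
  have o1 j : j \in [:: 0; 3; 4]%N -> h1 (x j) = x j.
    rewrite !inE /h1; case: i i12 {h1 yi c1 ev1} => [|[|[|i]]] // _;
      by move=> /or3P[] /eqP->; apply: cyc_x_out.
  have o2 j : (j < 4)%N -> h2 (x j) = x j.
    by case: j => [|[|[|[|j]]]] // _; apply: cyc_x_out.
  have f1 : rho h1 (line_map v) = line_map v by apply: fix2; rewrite ?o1.
  have f2 : rho h2 (line_map v) = line_map v by apply: fix1; rewrite ?o2.
  have [h25 _ _] := cyc_x (isT : [&& 5 < 7, 4 < 7, 6 < 7, 5 != 4, 5 != 6 & 4 != 6]%N).
  apply: (cycle_case (h1 * h2)%g).
  - by rewrite odd_permM (negPf ev1).
  - by rewrite -rhoM ?even_mem // f1.
  - by rewrite permM o1 ?o2.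
  - by rewrite permM o1 ?o2.
  - by rewrite permM yi c1 /h2 h25.
have [y1|y1] := eqVneq y (x 1); first exact: near y1.
have [y2|y2] := eqVneq y (x 2); first exact: near y2.
exact: far.
Qed.

Lemma line_rho l g h : l \in line -> ~~ odd_perm g -> ~~ odd_perm h ->
  g (x 0) = h (x 0) -> g (x 3) = h (x 3) -> rho g l = rho h l.
Proof.
move=> Ll evg evh g0 g3; have Vl := line_sub Ll; rewrite -[g in LHS](mulgKV h).
have evk : ~~ odd_perm (g * h^-1)%g by rewrite odd_permM odd_permV (negPf evg).
by rewrite -rhoM ?even_mem // (line_fixed (g := (g * h^-1)%g)) // permM ?g0 ?g3 permK.
Qed.

Lemma rho_inj g : g \in G -> {in V, forall v, rho g v = 0 -> v = 0}.
Proof.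
move=> Gg v Vv gv0; rewrite -[v](gmod1 gm) // -(mulgV g) -rhoM ?groupV // gv0.
exact: ar0 (gmod_ar gm (groupVr Gg)).
Qed.

(** The transposition of [x 5] and [x 6] corrects the parity; by [line_rho] any other even choice
    acts on the line in the same way. *)
Definition transporter i j : 'S_n :=
  let g := (tperm (x 0) i * tperm (tperm (x 0) i (x 3)) j)%g in
  if odd_perm g then (tperm (x 5) (x 6) * g)%g else g.

Lemma transporterP i j : i != j -> [/\ ~~ odd_perm (transporter i j),
  transporter i j (x 0) = i & transporter i j (x 3) = j].
Proof.
move=> ij; set y := tperm (x 0) i (x 3).
have yi : y != i by rewrite -[i in _ != i](tpermL (x 0) i) (inj_eq perm_inj) xneq.
pose g := (tperm (x 0) i * tperm y j)%g.
have [g0 g3] : g (x 0) = i /\ g (x 3) = j.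
  by rewrite /g !permM tpermL -/y tpermL tpermD // eq_sym.
have [t0 t3] : tperm (x 5) (x 6) (x 0) = x 0 /\ tperm (x 5) (x 6) (x 3) = x 3.
  by rewrite !tpermD // ?xneq.
rewrite /transporter -/y -/g; case: ifP => [og|/negbT eg]; last by split.
by rewrite odd_permM og odd_tperm xneq // !(permM _ g) t0 t3.
Qed.

(** Plays the role of (e_i - e_j) tensored with [l]. *)
Definition pair_map i j l := if i == j then 0 else rho (transporter i j) l.

Lemma pair_map_even g l : l \in line -> ~~ odd_perm g ->
  pair_map (g (x 0)) (g (x 3)) l = rho g l.
Proof.
move=> Ll evg; have ij : g (x 0) != g (x 3) by rewrite (inj_eq perm_inj) xneq.
have [evt t0 t3] := transporterP ij.
by rewrite /pair_map (negPf ij); apply: line_rho.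
Qed.

Lemma pair_map_diag i l : pair_map i i l = 0. Proof. by rewrite /pair_map eqxx. Qed.

Lemma ar_pair_map i j : Ar U line V (pair_map i j).
Proof.
have arL := mu_incl ob_line obV line_sub.
have [->|ij] := eqVneq i j.
  by apply: mu_ext (ar_zero arL) => l _; rewrite pair_map_diag.
have [ev _ _] := transporterP ij.
apply: (mu_ext _ (mu_comp arL (gmod_ar gm (even_mem ev)))) => l Ll.
by rewrite /pair_map (negPf ij).
Qed.

Lemma pair_map_mem i j l : l \in line -> pair_map i j l \in V.
Proof. exact: ar_mem (ar_pair_map i j) _. Qed.

Lemma pair_map_inj i j l : i != j -> l \in line -> pair_map i j l = 0 -> l = 0.
Proof.
move=> ij Ll; rewrite /pair_map (negPf ij); have [ev _ _] := transporterP ij.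
by apply: rho_inj (even_mem ev) _ (line_sub Ll).
Qed.

(** The transposition of [x 5] and [x 6] commutes with [a] and [b], so it preserves the line and
    represents all odd elements of [G] on it. *)
Definition line_twist (s : 'S_n) l := if odd_perm s then rho (tperm (x 5) (x 6)) l else l.

Lemma line_twist_mem s l : s \in G -> l \in line -> line_twist s l \in line.
Proof.
rewrite /line_twist; case: ifP => // os Gs /mem_line[v Vv ->].
set t := tperm _ _; have Gt : t \in G by apply: (mem_G_odd _ Gs os).
have comm g : commute g t -> g \in G -> {in V, forall u, rho t (rho g u) = rho g (rho t u)}.
  by move=> cgt Gg u Vu; rewrite !rhoM // cgt.
have cb : commute b t.
  by apply/commgP/conjg_fixP; rewrite /b /cyc conjMg !tpermJ !tpermD ?xneq.
have ca : commute a t.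
  by apply/commgP/conjg_fixP; rewrite /a /cyc conjMg !tpermJ !tpermD ?xneq.
apply/mem_line; exists (rho t v); first exact: rho_mem.
have tb u : u \in V -> rho t (rho b u) = rho b (rho t u) by move=> Vu; apply: comm.
have ta u : u \in V -> rho t (rho a u) = rho a (rho t u) by move=> Vu; apply: comm.
by rewrite /line_map rhoB ?Vw ?rho_mem ?Vw // ta ?Vw // /wv rhoB ?rho_mem // tb.
Qed.

Lemma line_twistK s l : s \in G -> l \in line -> line_twist s (line_twist s l) = l.
Proof.
rewrite /line_twist; case os: (odd_perm s) => // Gs Ll; set t := tperm _ _.
have Gt : t \in G by apply: (mem_G_odd _ Gs os).
by rewrite rhoM ?line_sub // tperm2 (gmod1 gm) ?line_sub.
Qed.

Lemma ar_line_twist s : s \in G -> Ar U line line (line_twist s).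
Proof.
move=> Gs; rewrite /line_twist; case os: (odd_perm s); last exact: mu_id ob_line.
have Gt : tperm (x 5) (x 6) \in G by apply: (mem_G_odd _ Gs os).
apply: (mu_corestrict (ar_restrict (gmod_ar gm Gt) ob_line line_sub) ob_line) => //.
  by move=> l Ll; have := line_twist_mem Gs Ll; rewrite /line_twist os.
exact: line_sub.
Qed.

Lemma rho_pair_map s i j l : s \in G -> l \in line ->
  rho s (pair_map i j l) = pair_map (s i) (s j) (line_twist s l).
Proof.
move=> Gs Ll; have Vl := line_sub Ll; have [->|ij] := eqVneq i j.
  by rewrite !pair_map_diag (ar0 (gmod_ar gm Gs)).
have [ev t0 t3] := transporterP ij; set g := transporter i j in ev t0 t3 *.
rewrite {1}/pair_map (negPf ij) -/g rhoM // ?(even_mem ev) // /line_twist.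
case: ifP => os; last first.
  have evs : ~~ odd_perm (g * s)%g by rewrite odd_permM (negPf ev) os.
  by rewrite -(pair_map_even Ll evs) !permM t0 t3.
set t := tperm _ _; have Gt : t \in G by apply: (mem_G_odd _ Gs os).
have Lt : rho t l \in line by have := line_twist_mem Gs Ll; rewrite /line_twist os.
have [y0 y3] : t (x 0) = x 0 /\ t (x 3) = x 3 by rewrite !tpermD // ?xneq.
have evk : ~~ odd_perm (t * (g * s))%g.
  by rewrite !odd_permM (negPf ev) os odd_tperm xneq.
have /= := pair_map_even Lt evk; rewrite !permM y0 y3 t0 t3 => ->.
by rewrite rhoM // ?(even_mem evk) // mulgA tperm2 mul1g.
Qed.

Lemma rho_pair_map_even s i j l : ~~ odd_perm s -> l \in line ->
  rho s (pair_map i j l) = pair_map (s i) (s j) l.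
Proof. by move=> ev Ll; rewrite rho_pair_map ?even_mem // /line_twist (negPf ev). Qed.

(** For l = w - a w, the even permutation (x0 x3)(x5 x6) exchanges [w] and [a w], so it is -1 on the
    line. *)
Lemma pair_mapN i j l : l \in line -> pair_map j i l = - pair_map i j l.
Proof.
move=> Ll; have [->|ij] := eqVneq i j; first by rewrite pair_map_diag oppr0.
pose s : 'S_n := (tperm (x 0) (x 3) * tperm (x 5) (x 6))%g.
have evs : ~~ odd_perm s by rewrite odd_permM !odd_tperm !xneq.
have s1 k : (0 < k < 3)%N -> s (x k) = x k.
  by case: k => [|[|[|k]]] // _; rewrite permM !tpermD ?xneq.
have s0 : s (x 0) = x 3 by rewrite permM tpermL tpermD ?xneq.
have s3 : s (x 3) = x 0 by rewrite permM tpermR tpermD ?xneq.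
have eva : ~~ odd_perm a by apply: odd_cyc; apply: xneq.
have [a0 _ _] := cyc_x (isT : [&& 0 < 7, 3 < 7, 4 < 7, 0 != 3, 0 != 4 & 3 != 4]%N).
have a1 k : (0 < k < 3)%N -> a (x k) = x k.
  by case: k => [|[|[|k]]] // _; apply: cyc_x_out.
have sl : rho s l = - l.
  have /mem_line[v Vv ->] := Ll; have Vwv := Vw Vv.
  have aw : rho s (wv v) = rho a (wv v) by apply: wv_eq; rewrite // ?s0 ?a0 ?s1 ?a1.
  have as_ : rho s (rho a (wv v)) = wv v.
    rewrite rhoM ?even_mem // -[RHS](gmod1 gm) //.
    apply: wv_eq => //; rewrite ?odd_perm1 // ?perm1; first by rewrite odd_permM (negPf eva).
    - by rewrite permM a0.
    - by rewrite permM a1 ?s1.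
    - by rewrite permM a1 ?s1.
  by rewrite /line_map rhoB ?rho_mem ?even_mem // as_ aw opprB.
have [evg g0 g3] := transporterP ij; set g := transporter i j in evg g0 g3.
have evsg : ~~ odd_perm (s * g)%g by rewrite odd_permM (negPf evs).
have /= := pair_map_even Ll evsg; rewrite !(permM s g) s0 s3 g0 g3 => ->.
rewrite -rhoM ?even_mem ?line_sub // sl (arN (gmod_ar gm (even_mem evg))) ?line_sub //.
by rewrite -pair_map_even // g0 g3.
Qed.

Lemma three_transitive i j k : uniq [:: i; j; k] ->
  exists2 g : 'S_n, ~~ odd_perm g & [/\ g (x 0) = i, g (x 3) = j & g (x 5) = k].
Proof.
rewrite /= !inE !negb_or andbT => /andP[/andP[ij ik] jk].
have [_ t0 t3] := transporterP ij; set t := transporter i j in t0 t3.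
pose g := (t * tperm (t (x 5)) k)%g.
have [g0 [g3 g5]] : g (x 0) = i /\ g (x 3) = j /\ g (x 5) = k.
  rewrite !permM tpermL t0 t3 !tpermD 1?eq_sym // 1?eq_sym //.
    by rewrite -t3 (inj_eq perm_inj) xneq.
  by rewrite -t0 (inj_eq perm_inj) xneq.
pose u : 'S_n := tperm (x 4) (x 6).
have ux m : m \in [:: 0; 3; 5]%N -> u (x m) = x m.
  by rewrite !inE => /or3P[] /eqP->; rewrite tpermD ?xneq.
have [og|eg] := boolP (odd_perm g); last by exists g.
exists (u * g)%g; first by rewrite odd_permM og odd_tperm xneq.
by split; rewrite (permM u g) ux.
Qed.

(** By transitivity only [x 0], [x 3], [x 5] matter. With c = (x0 x3 x5), which acts on [w] as [a]
    does, l = w - c w, and the three terms l, c l, c^2 l telescope because c^3 w = w. *)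
Lemma pair_map_cocycle i j k l : l \in line ->
  pair_map i j l + pair_map j k l = pair_map i k l.
Proof.
move=> Ll; have [->|ij] := eqVneq i j; first by rewrite pair_map_diag add0r.
have [->|jk] := eqVneq j k; first by rewrite pair_map_diag addr0.
have [->|ik] := eqVneq i k; first by rewrite (pair_mapN k j) // pair_map_diag subrr.
have [|g evg [g0 g3 g5]] := @three_transitive i j k; first by rewrite /= !inE negb_or ij ik jk.
suff E : pair_map (x 0) (x 3) l + pair_map (x 3) (x 5) l = pair_map (x 0) (x 5) l.
  have := congr1 (rho g) E; rewrite rhoD ?even_mem ?pair_map_mem //.
  by rewrite !rho_pair_map_even // g0 g3 g5.
pose c := cyc (x 0) (x 3) (x 5).
have evc : ~~ odd_perm c by apply: odd_cyc; apply: xneq.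
have [c0 c3 c5] := cyc_x (isT : [&& 0 < 7, 3 < 7, 5 < 7, 0 != 3, 0 != 5 & 3 != 5]%N).
have c1 m : (0 < m < 3)%N -> c (x m) = x m.
  by case: m => [|[|[|m]]] // _; apply: cyc_x_out.
have l0 : pair_map (x 0) (x 3) l = l.
  have := @pair_map_even 1%g l Ll; rewrite odd_perm1 !perm1 => -> //.
  by rewrite (gmod1 gm) ?line_sub.
have l1 : pair_map (x 3) (x 5) l = rho c l.
  by rewrite -[in RHS]l0 rho_pair_map_even // c0 c3.
have l2 : pair_map (x 5) (x 0) l = rho c (rho c l).
  by rewrite -l1 rho_pair_map_even // c3 c5.
rewrite (pair_mapN (x 5) (x 0)) // l0 l1 l2; apply/eqP; rewrite -subr_eq0 opprK.
have Gc := even_mem evc.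
have /mem_line[v Vv lE] := Ll; have Vwv := Vw Vv; set w := wv v in Vwv.
have [a0 _ _] := cyc_x (isT : [&& 0 < 7, 3 < 7, 4 < 7, 0 != 3, 0 != 4 & 3 != 4]%N).
have a1 m : (0 < m < 3)%N -> a (x m) = x m.
  by case: m => [|[|[|m]]] // _; apply: cyc_x_out.
have eva : ~~ odd_perm a by apply: odd_cyc; apply: xneq.
have -> : l = w - rho c w.
  by rewrite lE; congr (_ - _); apply: wv_eq => //; rewrite ?a0 ?c0 // a1 ?c1.
have ccc : rho c (rho c (rho c w)) = w.
  rewrite (rhoM Gc Gc) ?rho_mem // (rhoM Gc (groupM Gc Gc)) // -[w in RHS](gmod1 gm) //.
  apply: wv_eq => //; rewrite ?odd_perm1 // ?perm1.
  - by rewrite (odd_permM c) (odd_permM c c) (negPf evc).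
  - by rewrite (permM c) (permM c c) c0 c3 c5.
  - by rewrite (permM c) (permM c c) !c1.
  - by rewrite (permM c) (permM c c) !c1.
move: w Vwv ccc => w Vwv ccc; rewrite !rhoB ?rho_mem // ccc.
by rewrite !subrKA subrr.
Qed.

(** If (1 - a)(1 - b) were 0, so would be (1 - b)(1 - a), by a conjugation exchanging [a] and [b].
    Then the two 3-cycles would commute on [V], hence in [G], but their products in the two orders
    differ at [x 0]. *)
Lemma line_neq0 : faithful_Gmodule G V rho -> exists2 l, l \in line & l != 0.
Proof.
move=> fa; apply: contrapT => none.
have map0 v : v \in V -> v - rho b v = rho a v - rho (b * a)%g v.
  move=> Vv; have Ll : line_map v \in line by apply/mem_line; exists v.
  have /eqP : line_map v = 0.
    by apply/eqP/negPn/negP => l0; apply: none; exists (line_map v).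
  by rewrite /line_map subr_eq0 /wv => /eqP ->; rewrite rhoB ?rho_mem // rhoM.
pose s : 'S_n := (tperm (x 1) (x 3) * tperm (x 2) (x 4))%g.
have evs : ~~ odd_perm s by rewrite odd_permM !odd_tperm !xneq.
have Gs := even_mem evs.
have sx : [/\ s (x 0) = x 0, s (x 1) = x 3, s (x 2) = x 4, s (x 3) = x 1 & s (x 4) = x 2].
  split; rewrite permM ?tpermL ?tpermR.
  - by rewrite !tpermD ?xneq.
  - by rewrite tpermD ?xneq.
  - by rewrite (@tpermD _ _ _ (x 2)) ?tpermL ?xneq.
  - by rewrite tpermD ?xneq.
  - by rewrite (@tpermD _ _ _ (x 4)) ?tpermR ?xneq.
have [sx0 sx1 sx2 sx3 sx4] := sx.
have bJ : (b ^ s)%g = a by rewrite /b /cyc conjMg !tpermJ sx0 sx1 sx2.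
have aJ : (a ^ s)%g = b by rewrite /a /cyc conjMg !tpermJ sx0 sx3 sx4.
have Gba : (b * a)%g \in G := groupM Gb Ga.
have Gab : (a * b)%g \in G := groupM Ga Gb.
have map1 v : v \in V -> v - rho a v = rho b v - rho (a * b)%g v.
  move=> Vv; have Vu : rho s^-1%g v \in V by rewrite rho_mem ?groupV.
  have conj g : g \in G -> rho s (rho g (rho s^-1%g v)) = rho (g ^ s)%g v.
    by move=> Gg; rewrite (rhoM Gg Gs) ?rho_mem ?groupV // (rhoM (groupVr Gs) (groupM Gg Gs)).
  have sv : rho s (rho s^-1%g v) = v by rewrite rhoM ?groupV // mulVg (gmod1 gm).
  move: (rho s^-1%g v) Vu conj sv => u Vu conj sv.
  have E : rho s (u - rho b u) = v - rho a v by rewrite (rhoB Gs) ?rho_mem // conj // sv bJ.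
  rewrite -E map0 // (rhoB Gs) ?(rho_mem Gba) ?rho_mem // (conj _ Ga) (conj _ Gba) aJ.
  by rewrite conjMg bJ aJ.
have comm : (a * b)%g = (b * a)%g.
  apply/eqP; rewrite eq_mulVg1; apply/eqP; apply: fa; first by rewrite groupM ?groupV.
  move=> v Vv; have Vu : rho (a * b)^-1%g v \in V by rewrite rho_mem ?groupV.
  rewrite -rhoM ?groupV //.
  have <- : rho (a * b)%g (rho (a * b)^-1%g v) = rho (b * a)%g (rho (a * b)^-1%g v).
    move: (rho (a * b)^-1%g v) Vu => u Vu.
    have e0 := map0 _ Vu; have e1 := map1 _ Vu.
    have -> : rho (a * b)%g u = rho b u - (u - rho a u) by rewrite e1 subKr.
    have -> : rho (b * a)%g u = rho a u - (u - rho b u) by rewrite e0 subKr.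
    by rewrite !opprB addrA [RHS]addrA (addrC (rho b u)).
  by rewrite rhoM ?groupV // mulVg (gmod1 gm).
have [a0 _ _] := cyc_x (isT : [&& 0 < 7, 3 < 7, 4 < 7, 0 != 3, 0 != 4 & 3 != 4]%N).
have [b0 _ _] := cyc_x (isT : [&& 0 < 7, 1 < 7, 2 < 7, 0 != 1, 0 != 2 & 1 != 2]%N).
have a1 : a (x 1) = x 1 by apply: cyc_x_out.
have b3 : b (x 3) = x 3 by apply: cyc_x_out.
have := congr1 (fun g : 'S_n => g (x 0)) comm; rewrite /= (permM a) (permM b) a0 b3 b0 a1.
by apply/eqP; apply: xneq.
Qed.

End Lines.

Lemma fresh_ord n (s : seq 'I_n) : (size s < n)%N -> exists y, y \notin s.
Proof.
move=> lts; apply: contrapT => none; have : (#|'I_n| <= size s)%N.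
  apply: leq_trans (card_size s).
  apply: subset_leq_card; apply/subsetP => y _.
  by apply/negPn/negP => ys; apply: none; exists y.
by rewrite card_ord leqNgt lts.
Qed.

(** * Families of maps that behave like the roots e_i - e_j *)

Section Family.
Variables (n : nat) (U : modular_universe) (dim : additive_dimension U).
Variables (A : zmodType) (V L : zmodClosed A) (mu : 'I_n -> 'I_n -> A -> A).
Variable rho : 'S_n -> A -> A.
Hypothesis n7 : (7 <= n)%N.
Hypothesis ar_mu : forall i j, Ar U L V (mu i j).
Hypothesis mu_diag : forall i l, mu i i l = 0.
Hypothesis mu_cocycle : forall i j k l, l \in L -> mu i j l + mu j k l = mu i k l.
Hypothesis mu_inj : forall i j l, i != j -> l \in L -> mu i j l = 0 -> l = 0.
Hypothesis ar_rho : forall s, ~~ odd_perm s -> Ar U V V (rho s).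
Hypothesis rho_mu : forall (s : 'S_n) i j l, ~~ odd_perm s -> l \in L ->
  rho s (mu i j l) = mu (s i) (s j) l.

Let obL : Ob U L.
Proof.
have [|i _] := @fresh_ord n [::]; first exact: leq_trans n7.
exact: ar_obl (ar_mu i i).
Qed.

Let obV : Ob U V.
Proof.
have [|i _] := @fresh_ord n [::]; first exact: leq_trans n7.
exact: ar_obr (ar_mu i i).
Qed.

Lemma mu_mem i j l : l \in L -> mu i j l \in V.
Proof. exact: ar_mem (ar_mu i j) _. Qed.

Lemma muN i j l : l \in L -> mu j i l = - mu i j l.
Proof. by move=> Ll; apply/eqP; rewrite -addr_eq0 mu_cocycle ?mu_diag. Qed.

Lemma ar_big_sum (B C : zmodType) (X : zmodClosed B) (Y : zmodClosed C) f I (r : seq I) (P : pred I) F :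
  Ar U X Y f -> (forall i, F i \in X) ->
  f (\sum_(i <- r | P i) F i) = \sum_(i <- r | P i) f (F i).
Proof.
move=> arf FX; elim: r => [|i r IH]; first by rewrite !big_nil (ar0 arf).
by rewrite !big_cons; case: (P i) => //; rewrite (arD arf) ?IH // rpred_sum.
Qed.

Lemma mu_sum_base z z' f : (forall i, f i \in L) ->
  \sum_i mu i z' (f i) = \sum_i mu i z (f i) + mu z z' (\sum_i f i).
Proof.
move=> fL; rewrite (ar_big_sum _ _ (ar_mu _ _)) // -big_split /=.
by apply: eq_bigr => i _; rewrite mu_cocycle.
Qed.

Lemma rho_mu_sum s z f : ~~ odd_perm s -> (forall i, f i \in L) ->
  rho s (\sum_i mu i z (f i)) = \sum_i mu (s i) (s z) (f i).
Proof.
move=> evs fL; rewrite (ar_big_sum _ _ (ar_rho evs)); last by move=> i; apply: mu_mem.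
by apply: eq_bigr => i _; rewrite rho_mu.
Qed.

(** Subtracting the relation from its image under (a b)(c d) leaves a relation in [f b - f a] and
    [f d - f c]. An even permutation that fixes [a], [b], [d] and moves [c] gives a second such
    relation; their difference isolates [f d - f c], and injectivity finishes. *)
Lemma mu_sum_const z f : (forall i, f i \in L) -> \sum_i mu i z (f i) = 0 ->
  forall a b, a != z -> b != z -> f a = f b.
Proof.
move=> fL f0 a b az bz; have [->//|ab] := eqVneq a b.
have [|c] := @fresh_ord n [:: z; a; b]; first exact: leq_trans n7.
rewrite !inE !negb_or => /and3P[cz ca cb].
have [|d] := @fresh_ord n [:: z; a; b; c]; first exact: leq_trans n7.
rewrite !inE !negb_or => /and4P[dz da db dc].
have [|e] := @fresh_ord n [:: a; b; c; d]; first exact: leq_trans n7.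
rewrite !inE !negb_or => /and4P[ea eb ec ed].
have [|g] := @fresh_ord n [:: a; b; c; d; e]; first exact: leq_trans n7.
rewrite !inE !negb_or => /and5P[ga gb gc gd ge].
pose s : 'S_n := (tperm a b * tperm c d)%g.
have evs : ~~ odd_perm s by rewrite odd_permM !odd_tperm ab eq_sym dc.
have [sa sb sc sd] : [/\ s a = b, s b = a, s c = d & s d = c].
  split; rewrite permM.
  - by rewrite tpermL tpermD.
  - by rewrite tpermR tpermD.
  - by rewrite (@tpermD _ a b c) 1?eq_sym // tpermL.
  - by rewrite (@tpermD _ a b d) 1?eq_sym // tpermR.
have s_out i : i != a -> i != b -> i != c -> i != d -> s i = i.
  by move=> *; rewrite permM !tpermD // eq_sym.
have sz : s z = z by apply: s_out; rewrite eq_sym.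
have fB i j : f i - f j \in L by rewrite rpredB.
have fst : mu b a (f b - f a) + mu d c (f d - f c) = 0.
  have : \sum_i mu (s i) z (f (s i) - f i) = 0.
    have f0' : \sum_i mu (s i) z (f (s i)) = 0.
      by rewrite -[RHS]f0 [RHS](reindex_inj (@perm_inj _ s)).
    under eq_bigr do rewrite (arB (ar_mu _ _)) //.
    rewrite sumrB f0'.
    have := rho_mu_sum z evs fL; rewrite f0 sz => <-.
    by rewrite (ar0 (ar_rho evs)) subrr.
  rewrite (bigD1 a) //= (bigD1 b) 1?eq_sym //= (bigD1 c) ?ca ?cb //= (bigD1 d) ?da ?db ?dc //=.
  rewrite big1 ?addr0; last first.
    by move=> i /andP[/andP[/andP[ia ib] ic] id]; rewrite s_out // subrr (ar0 (ar_mu _ _)).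
  rewrite sa sb sc sd -(opprB (f b)) -(opprB (f d)) !(arN (ar_mu _ _)) // -!muN //.
  by rewrite addrA !mu_cocycle // -addrA mu_cocycle.
pose s' := cyc c e g.
have evs' : ~~ odd_perm s' by apply: odd_cyc; rewrite eq_sym.
have s'c : s' c = e.
  by have [] // := @cycE _ c e g; rewrite /= !inE !negb_or !(eq_sym c) (eq_sym e g) ec gc ge.
have s'_out i : i \in [:: a; b; d] -> s' i = i.
  by rewrite !inE => /or3P[] /eqP->; apply: cyc_out; rewrite // eq_sym.
have snd : mu b a (f b - f a) + mu d e (f d - f c) = 0.
  rewrite -[RHS](ar0 (ar_rho evs')) -fst (arD (ar_rho evs')) ?mu_mem // !rho_mu //.
  by rewrite s'c !s'_out // !inE eqxx ?orbT.
have dc0 : f d - f c = 0.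
  apply: (@mu_inj c e); rewrite // 1?eq_sym //; apply: (addrI (mu d c (f d - f c))).
  rewrite mu_cocycle // addr0; apply: (addrI (mu b a (f b - f a))).
  by rewrite fst snd.
have := fst; rewrite dc0 (ar0 (ar_mu _ _)) addr0 => /mu_inj ba0.
by apply/esym/eqP; rewrite -subr_eq0; apply/eqP/ba0; rewrite // eq_sym.
Qed.

Lemma even_moves z z' : exists2 s : 'S_n, ~~ odd_perm s & s z = z'.
Proof.
have [->|zz'] := eqVneq z z'; first by exists 1%g; rewrite ?odd_perm1 ?perm1.
have [|c] := @fresh_ord n [:: z; z']; first exact: leq_trans n7.
rewrite !inE !negb_or => /andP[cz cz'].
have [|d] := @fresh_ord n [:: z; z'; c]; first exact: leq_trans n7.
rewrite !inE !negb_or => /and3P[dz dz' dc].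
exists (tperm z z' * tperm c d)%g; first by rewrite odd_permM !odd_tperm zz' eq_sym dc.
by rewrite permM tpermL tpermD.
Qed.

Lemma ar_diag_sum z : Ar U L V (fun l => \sum_i mu i z l).
Proof. exact: ar_sum (ar_mu z z) (fun i => ar_mu i z). Qed.

(** The values of the constant tuples killed by the covering map; this becomes the K of the
    conclusion. *)
Definition kernel z : zmodClosed A := kersub L (fun l => \sum_i mu i z l).

Lemma mem_kernel z l : l \in kernel z <-> l \in L /\ \sum_i mu i z l = 0.
Proof. exact: (mem_kersub (ar_diag_sum z)). Qed.

(** An even permutation moves [z] to [z'], so the sum vanishes for both bases, while the two sums
    differ by n times [mu z z' l]. *)
Lemma kernel_torsion z l : l \in kernel z -> l *+ n = 0.
Proof.
move=> /mem_kernel[Ll l0]; have [|z'] := @fresh_ord n [:: z]; first exact: leq_trans n7.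
rewrite inE => zz'; have [s evs sz] := even_moves z z'.
have := rho_mu_sum z evs (fun=> Ll); rewrite l0 (ar0 (ar_rho evs)) sz.
have -> : \sum_i mu (s i) z' l = \sum_i mu i z' l by rewrite [RHS](reindex_inj (@perm_inj _ s)).
rewrite (mu_sum_base z z') // l0 add0r sumr_const card_ord => /esym.
by apply: mu_inj; rewrite 1?eq_sym // rpredMn.
Qed.

Definition spans (L' : zmodClosed A) z y :=
  exists f, (forall i, f i \in L') /\ y = \sum_i mu i z (f i).

Section Span.
Variable L' : zmodClosed A.
Hypotheses (obL' : Ob U L') (L'L : {subset L' <= L}) (dcL' : dim_connected dim L').

Let ar_mu' i j : Ar U L' V (mu i j). Proof. exact: ar_restrict. Qed.

Definition span z (r : seq 'I_n) : zmodClosed A :=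
  foldr (fun i W => sumsub (imsub L' (mu i z)) W) zerosub r.

Lemma span_cons z i r : span z (i :: r) = sumsub (imsub L' (mu i z)) (span z r).
Proof. by []. Qed.

Lemma span_good z r :
  [/\ Ob U (span z r), {subset span z r <= V} & dim_connected dim (span z r)].
Proof.
elim: r => [|i r [obW WV dcW]] /=.
  split; [exact: ob_zero obV|by move=> y /mem_zerosub->; rewrite rpred0|].
  by move=> W [obW WZ] []; move=> y /mem_zerosub->; rewrite rpred0.
have obI := ob_imsub (ar_mu' i z); have IV := imsub_sub (ar_mu' i z).
split; [exact: ob_sum obV obI obW IV WV|exact: sub_sumsub IV WV|].
exact: dc_sum obV obI obW IV WV (dc_im (ar_mu' i z) dcL') dcW.
Qed.

Lemma mem_span z r y : uniq r -> y \in span z r <->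
  exists f, (forall i, f i \in L') /\ y = \sum_(i <- r) mu i z (f i).
Proof.
elim: r y => [|i r IH] y.
  rewrite [span z [::]]/(zerosub) mem_zerosub; split=> [->|[f [_ ->]]]; last by rewrite big_nil.
  by exists (fun=> 0); rewrite big_nil; split=> // i; rewrite rpred0.
rewrite span_cons mem_sumsub => /andP[ir ur].
split=> [[_ [_ [/(mem_imsub (ar_mu' i z))[l Ll ->] /(IH _ ur)[f [fL ->]] ->]]]|[f [fL ->]]].
  exists (fun j => if j == i then l else f j); split=> [j|]; first by case: ifP.
  rewrite big_cons eqxx; congr (_ + _); rewrite !big_seq; apply: eq_bigr => j jr.
  by case: eqP => // ji; rewrite -ji jr in ir.
exists (mu i z (f i)), (\sum_(j <- r) mu j z (f j)); rewrite big_cons; split=> //.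
  by apply/(mem_imsub (ar_mu' i z)); exists (f i).
by apply/IH => //; exists f.
Qed.

Lemma spans_submodule z : exists W : zmodClosed A,
  [/\ submodule U V W, dim_connected dim W & forall y, y \in W <-> spans L' z y].
Proof.
exists (span z (index_enum 'I_n)).
have [obW WV dcW] := span_good z (index_enum 'I_n).
by split=> // y; rewrite mem_span // index_enum_uniq.
Qed.

(** Changing the base adds [mu z z'] of the total of the coefficients, which is absorbed by the
    coefficient at [z']. *)
Lemma spans_base z z' y : spans L' z' y -> spans L' z y.
Proof.
case=> f [fL ->]; exists (fun i => f i - (if i == z' then \sum_j f j else 0)).
have sL : \sum_j f j \in L' by apply: rpred_sum.
split=> [i|]; first by rewrite rpredB //; case: ifP; rewrite ?rpred0.
rewrite (mu_sum_base z) => [|i]; last exact: L'L.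
under [RHS]eq_bigr => i _.
  rewrite (arB (ar_mu' _ _)) //; last by case: ifP; rewrite ?rpred0.
  over.
rewrite sumrB; congr (_ + _); rewrite [X in - X](bigD1 z') //= eqxx [X in - (_ + X)]big1 ?addr0; last first.
  by move=> i /negPf->; rewrite (ar0 (ar_mu' _ _)).
by rewrite (muN z' z) // L'L.
Qed.

End Span.

Section Dimension.
Hypothesis spanV : forall z y, y \in V -> spans L z y.
Hypothesis dcL : dim_connected dim L.

Let span_ob z r : Ob U (span L z r). Proof. by have [] := @span_good L obL (fun x Hx => Hx) dcL z r. Qed.
Let span_sub z r : {subset span L z r <= V}.
Proof. by have [] := @span_good L obL (fun x Hx => Hx) dcL z r. Qed.

Let mem_spanL z r y (ur : uniq r) := @mem_span L obL (fun x Hx => Hx) z r y ur.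

Lemma span_relation z i r l : z != i -> uniq (i :: r) -> z \notin r -> l \in L ->
  mu i z l \in span L z r -> exists2 f, (forall j, f j \in L) &
    [/\ f i = l, forall j, j \notin i :: r -> f j = 0 & \sum_j mu j z (f j) = 0].
Proof.
move=> zi /= /andP[ir ur] zr Ll /(mem_spanL _ _ ur)[f [fL e]].
pose g j := if j == i then l else if j \in r then - f j else 0.
have gL j : g j \in L by rewrite /g; do 2?case: ifP => _; rewrite ?rpredN ?rpred0.
exists g => //; split=> //; first by rewrite /g eqxx.
  by move=> j; rewrite inE negb_or /g => /andP[/negPf-> /negPf->].
rewrite (bigD1 i) //= {1}/g eqxx.
rewrite (bigID (mem r)) /= [X in _ + (_ + X)]big1 => [|j /andP[/negPf ji /negPf jr]]; last first.
  by rewrite /g ji jr (ar0 (ar_mu _ _)).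
rewrite e addr0; apply/eqP; rewrite addr_eq0 -sumrN; apply/eqP.
rewrite big_uniq // (eq_bigl (fun j => (j != i) && (j \in r))) => [|j]; last first.
  by have [->|//] := eqVneq j i; rewrite (negPf ir).
apply: eq_bigr => j /andP[/negPf ji jr]; rewrite /g ji jr.
by rewrite (arN (ar_mu _ _)) // opprK.
Qed.

Lemma dim_span z r : uniq r -> z \notin r -> (size r + 2 <= n)%N ->
  dim A (span L z r) = (size r * dim A L)%N.
Proof.
elim: r => [_ _ _|i r IH]; first exact: (dim_zero dim obV).
rewrite cons_uniq inE negb_or span_cons => /andP[ir ur] /andP[zi zr] ltr.
have arI := ar_mu i z; have iz : i != z by rewrite eq_sym.
have obI := ob_imsub arI; have IV := imsub_sub arI.
have cap0 : capsub (imsub L (mu i z)) (span L z r) =i @zerosub A.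
  move=> y; apply/idP/idP; last by move=> /mem_zerosub->; rewrite rpred0.
  case/mem_capsub => /(mem_imsub arI)[l Ll ->] /(span_relation zi _ zr Ll).
  case=> [|f fL [fi f0 fs]]; first by rewrite /= ir.
  have [|b] := @fresh_ord n (z :: i :: r); first by rewrite /= -addn2.
  rewrite inE negb_or => /andP[bz bir]; apply/mem_zerosub.
  by rewrite -fi (mu_sum_const fL fs iz bz) f0 // (ar0 arI).
have obC := ob_cap obV obI (span_ob z r) IV (@span_sub z r).
have := dim_sum dim obV obI (span_ob z r) IV (@span_sub z r).
rewrite (dim_eq dim obC (ob_zero obV) cap0) (dim_zero dim obV) addn0 => ->.
rewrite (dim_inj dim arI) => [|l Ll]; last exact: mu_inj.
by rewrite IH // ltnW.
Qed.

(** Of the n - 1 terms of the sum, n - 2 are independent, and the last one meets their sum in the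
    image of the kernel, by the constant relations. *)
Lemma dim_family z : (dim A V + dim A (kernel z) = n.-1 * dim A L)%N.
Proof.
have [|i] := @fresh_ord n [:: z]; first exact: leq_trans n7.
rewrite inE => iz; have zi : z != i by rewrite eq_sym.
pose r := [seq j <- enum 'I_n | (j != z) && (j != i)].
have ur : uniq r by rewrite filter_uniq ?enum_uniq.
have mem_r j : j \in r = (j != z) && (j != i) by rewrite mem_filter mem_enum andbT.
have zr : z \notin r by rewrite mem_r eqxx.
have ir : i \notin r by rewrite mem_r eqxx andbF.
have sr : (size r + 2 = n)%N.
  have u : uniq (z :: i :: r) by rewrite /= inE negb_or zi zr ir.
  have := card_uniqP u; rewrite /= -addn2 => <-; rewrite -[RHS]card_ord.
  by apply: eq_card => j; rewrite !inE mem_r; do 2!case: eqP.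
have sum_r (F : 'I_n -> A) : F z = 0 -> \sum_j F j = F i + \sum_(j <- r) F j.
  move=> Fz; rewrite (bigD1 z) //= Fz add0r (bigD1 i) //=; congr (_ + _).
  by rewrite big_uniq //; apply: eq_bigl => j; rewrite mem_r.
have arI := ar_mu i z.
have obI := ob_imsub arI; have IV := imsub_sub arI.
have KL : {subset kernel z <= L} by move=> l /mem_kernel[].
have arK := ar_restrict arI (ob_kersub (ar_diag_sum z)) KL.
have capK : capsub (imsub L (mu i z)) (span L z r) =i imsub (kernel z) (mu i z).
  move=> y; apply/idP/idP => [/mem_capsub[/(mem_imsub arI)[l Ll ->]]|/(mem_imsub arK)[l Kl ->]].
    move=> /(span_relation zi _ zr Ll)[|f fL [fi _ fs]]; first by rewrite /= ir.
    apply/(mem_imsub arK); exists l => //; apply/mem_kernel; split=> //.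
    rewrite -[RHS]fs; apply: eq_bigr => j _; have [->|jz] := eqVneq j z; first by rewrite !mu_diag.
    by rewrite -fi (mu_sum_const fL fs jz iz).
  have /mem_kernel[Ll l0] := Kl; apply/mem_capsub; split.
    by apply/(mem_imsub arI); exists l.
  apply/(mem_spanL _ _ ur); exists (fun=> - l); split=> [j|]; first by rewrite rpredN.
  apply/eqP; rewrite -subr_eq0 -sumrN; apply/eqP; rewrite -[RHS]l0 sum_r //; congr (_ + _).
  by apply: eq_bigr => j _; rewrite (arN (ar_mu _ _)) // opprK.
have sumV : sumsub (imsub L (mu i z)) (span L z r) =i V.
  move=> y; apply/idP/idP => [/(sub_sumsub IV (@span_sub z r))//|Vy].
  have [f [fL ->]] := spanV z Vy; rewrite sum_r => [|//].
  apply/mem_sumsub; exists (mu i z (f i)), (\sum_(j <- r) mu j z (f j)); split=> //.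
    by apply/(mem_imsub arI); exists (f i).
  by apply/(mem_spanL _ _ ur); exists f.
have obC := ob_cap obV obI (span_ob z r) IV (@span_sub z r).
have := dim_sum dim obV obI (span_ob z r) IV (@span_sub z r).
rewrite (dim_eq dim obC (ob_imsub arK) capK).
rewrite (dim_eq dim (ob_sum obV obI (span_ob z r) IV (@span_sub z r)) obV sumV).
rewrite (dim_inj dim arK) => [|l /mem_kernel[Ll _]]; last exact: mu_inj.
rewrite (dim_inj dim arI) => [|l Ll]; last exact: mu_inj.
rewrite dim_span ?sr // => ->; rewrite -mulSn; congr (_ * _)%N.
by rewrite -[in RHS]sr addn2.
Qed.

End Dimension.

End Family.

(** * Coordinates on the standard module *)

Section TensorInduction.
Variables (M N : zmodType).

Lemma tensor_ind (S : zmodClosed (tensor M N)) :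
  (forall m x, tens m x \in S) -> forall t, t \in S.
Proof.
move=> Stens t; rewrite -[t]reprK -(freeg_sumE (repr t)) raddf_sum rpred_sum // => -[m x] _.
rewrite -[coeff _ _]intz -freegU_mulz raddfMz rpredMz //.
exact: Stens.
Qed.

Lemma tensor_eq (P : zmodType) (f g : tensor M N -> P) :
  zmod_morphism f -> zmod_morphism g ->
  (forall m x, f (tens m x) = g (tens m x)) -> f =1 g.
Proof.
move=> fB gB fg t; pose S : pred (tensor M N) := [pred u | f u == g u].
have SP : zmod_closed S.
  split=> [|u v]; rewrite !inE; last by move=> /eqP fu /eqP fv; rewrite fB gB fu fv.
  by rewrite -(subrr (0 : tensor M N)) fB gB !subrr.
by apply/eqP; apply: (tensor_ind (S := mksub SP)) => m x; rewrite inE /= fg.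
Qed.

Lemma tens_morphl x : zmod_morphism ((@tens M N)^~ x).
Proof.
move=> m m' /=; apply: (addIr (tens m' x)).
by rewrite subrK -(tensDl x (m - m') m') subrK.
Qed.

Lemma tens_morphr m : zmod_morphism (@tens M N m).
Proof. by move=> x x'; apply: (addIr (tens m x')); rewrite subrK -tensDr subrK. Qed.

HB.instance Definition _ m := GRing.isZmodMorphism.Build N (tensor M N) (@tens M N m) (tens_morphr m).

Definition tensl x m : tensor M N := tens m x.
HB.instance Definition _ x := GRing.isZmodMorphism.Build M (tensor M N) (tensl x) (tens_morphl x).

End TensorInduction.

Section Coordinates.
Variables (n : nat) (L : zmodType).
Implicit Types (t : std n L).

Definition coord_pair i (c : subZ (stdZ n)) (l : L) : L := l *~ val c 0 i.

Lemma coord_pairDl i l : {morph (coord_pair i)^~ l : c c' / c + c'}.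
Proof. by move=> c c'; rewrite /coord_pair GRing.valD mxE mulrzDr. Qed.
Lemma coord_pairDr i c : {morph coord_pair i c : l l' / l + l'}.
Proof. by move=> l l'; rewrite /coord_pair mulrzDl. Qed.

Definition coord i : std n L -> L := tens_lift (coord_pair i).

Lemma coord_tens i c l : coord i (tens c l) = l *~ val c 0 i.
Proof. exact: (tens_lift_tens (@coord_pairDl i) (@coord_pairDr i)). Qed.

Lemma coord_is_zmod_morphism i : zmod_morphism (coord i).
Proof. exact: (tens_lift_is_zmod_morphism (@coord_pairDl i) (@coord_pairDr i)). Qed.

HB.instance Definition _ i := GRing.isZmodMorphism.Build (std n L) L (coord i) (coord_is_zmod_morphism i).
HB.instance Definition _ s := GRing.isZmodMorphism.Build (std n L) (std n L) (@std_act n L s) (std_act_is_zmod_morphism s).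

Lemma val_stdZ_act s (c : subZ (stdZ n)) i : val (stdZ_act s c) 0 (s i) = val c 0 i.
Proof. by rewrite /= -[s in perm_mx s]invgK -col_permE mxE permK. Qed.

Lemma coord_act (s : 'S_n) i t : coord (s i) (std_act s t) = coord i t.
Proof.
apply: (tensor_eq (f := coord (s i) \o std_act s)) => [||c l]; try exact: raddfB.
by rewrite /= std_act_tens !coord_tens val_stdZ_act.
Qed.

Lemma sum_coord t : \sum_i coord i t = 0.
Proof.
apply: (tensor_eq (f := fun t => \sum_i coord i t) (g := fun=> 0)) => [u v|u v|c l].
- by rewrite -sumrB; apply: eq_bigr => i _; rewrite raddfB.
- by rewrite subr0.
under eq_bigr do rewrite coord_tens; rewrite -mulrz_sumr.
by have /eqP-> := valP c; rewrite mulr0z.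
Qed.

Lemma stdZ_diff i z : (delta_mx 0 i - delta_mx 0 z : 'rV[int]_n) \in stdZ n.
Proof.
rewrite inE /=; apply/eqP; under eq_bigr do rewrite !mxE /=.
rewrite sumrB (bigD1 i) //= (bigD1 (F := fun j => (j == z)%:R : int) z) //= !eqxx.
rewrite !big1 ?subrr // => j /negPf; rewrite ?[j == _]eq_sym => -> //.
Qed.

Definition stdZ_gen i z : subZ (stdZ n) := Sub (delta_mx 0 i - delta_mx 0 z) (stdZ_diff i z).

Definition std_of z (k : 'I_n -> L) : std n L := \sum_i tens (stdZ_gen i z) (k i).

Lemma stdZ_decomposition z (c : subZ (stdZ n)) : c = \sum_i stdZ_gen i z *~ val c 0 i.
Proof.
apply: val_inj; rewrite raddf_sum; apply/rowP => j.
rewrite summxE (eq_bigr (fun i => val c 0 i *+ (j == i) - val c 0 i *+ (j == z))); last first.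
  by move=> i _; rewrite raddfMz /= -scaler_int !mxE /= intz mulrBr !mulr_natr.
rewrite sumrB sumrMnl; have /eqP-> := valP c; rewrite mul0rn subr0.
by rewrite (bigD1 j) //= eqxx big1 ?addr0 // => i; rewrite eq_sym => /negPf->.
Qed.

Lemma std_of_coord z t : std_of z (coord^~ t) = t.
Proof.
apply: (tensor_eq (f := fun t => std_of z (coord^~ t)) (g := id)) => [u v|//|c l].
  by rewrite /std_of -sumrB; apply: eq_bigr => i _; rewrite !raddfB.
rewrite [in RHS](stdZ_decomposition z c) -[RHS]/(tensl l (\sum_i stdZ_gen i z *~ val c 0 i)) raddf_sum.
by apply: eq_bigr => i _; rewrite coord_tens raddfMz [in RHS]raddfMz.
Qed.

Lemma coord_inj t t' : (0 < n)%N -> (forall i, coord i t = coord i t') -> t = t'.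
Proof.
move=> n0 eqc; rewrite -(std_of_coord (Ordinal n0) t) -(std_of_coord (Ordinal n0) t').
by apply: eq_bigr => i _; rewrite eqc.
Qed.

Lemma coord_std_of z k : \sum_i k i = 0 -> forall i, coord i (std_of z k) = k i.
Proof.
move=> k0 i; rewrite /std_of raddf_sum.
rewrite (eq_bigr (fun j => k j *+ (i == j) - k j *+ (i == z))); last first.
  by move=> j _; rewrite /= coord_tens /= !mxE /= mulrzBr !natz -!pmulrn.
rewrite sumrB sumrMnl k0 mul0rn subr0 (bigD1 i) //= eqxx big1 ?addr0 // => j.
by rewrite eq_sym => /negPf->.
Qed.

Lemma mem_std_fix t : (0 < n)%N -> t \in std_fix n L <-> forall i j, coord i t = coord j t.
Proof.
move=> n0; split=> [/forallP fx i j|eqc].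
  by rewrite -(coord_act (tperm i j)) tpermL (eqP (fx _)).
apply/forallP => s; apply/eqP/coord_inj => // i.
by rewrite -{1}(permKV s i) coord_act.
Qed.

End Coordinates.

Definition additive_of (M N : zmodType) (f : M -> N) (fB : zmod_morphism f) : {additive M -> N} :=
  HB.pack_for {additive M -> N} f (GRing.isZmodMorphism.Build M N f fB).

(** The last coordinate differs from the others by a multiple of n, so tensoring with an n-torsion
    element gives a constant tuple. *)
Lemma std_vectorE n (j : 'I_n) : std_vector n 0 j = 1 - n%:Z *+ (j == n.-1 :> nat).
Proof.
rewrite summxE (eq_bigr (fun i : nat => (i == j)%:R - (n.-1 == j)%:R)); last first.
  by move=> i _; rewrite !mxE.
have n1 : n = n.-1.+1 by case: (n) j => [[]|].
have lejn : (j <= n.-1)%N by rewrite -ltnS -n1.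
rewrite sumrB sumr_const_nat subn0 (eq_sym n.-1) -natr_sum.
have -> : (\sum_(0 <= i < n.-1) (i == j :> nat))%N = (j < n.-1)%N :> nat.
  rewrite big_mkord; case: ltnP => [ltj|lej].
    by rewrite (bigD1 (Ordinal ltj)) //= eqxx big1 // => i; rewrite -val_eqE => /negPf->.
  by rewrite big1 // => i _; rewrite ltn_eqF // (leq_trans (ltn_ord i)).
move: lejn; rewrite leq_eqVlt => /orP[/eqP jn|ltj].
  by rewrite -jn eqxx ltnn jn {2}n1; lia.
by rewrite ltj ltn_eqF // mulr0n; lia.
Qed.

(** * The covering map from the standard module and its kernel *)

Definition sign_act n (M : zmodType) (b : bool) (act : 'S_n -> M -> M) :=
  if b then sgn_twist act else act.

Section Cover.
Variables (n : nat) (G : {group 'S_n}) (U : modular_universe) (dim : additive_dimension U).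
Variables (A : zmodType) (V L : zmodClosed A) (mu : 'I_n -> 'I_n -> A -> A).
Variables (rho : 'S_n -> A -> A) (b : bool) (z : 'I_n).
Hypothesis n7 : (7 <= n)%N.
Hypothesis ar_mu : forall i j, Ar U L V (mu i j).
Hypothesis mu_diag : forall i l, mu i i l = 0.
Hypothesis mu_cocycle : forall i j k l, l \in L -> mu i j l + mu j k l = mu i k l.
Hypothesis mu_inj : forall i j l, i != j -> l \in L -> mu i j l = 0 -> l = 0.
Hypothesis even_mem : forall s, ~~ odd_perm s -> s \in G.
Hypothesis ar_rho : forall s, s \in G -> Ar U V V (rho s).
Hypothesis rho_mu : forall (s : 'S_n) i j l, s \in G -> l \in L ->
  rho s (mu i j l) = mu (s i) (s j) (if b && odd_perm s then - l else l).
Hypothesis spanV : forall y, y \in V -> spans mu L z y.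

Let ar_rho_even s (evs : ~~ odd_perm s) : Ar U V V (rho s) := ar_rho (even_mem evs).

Let rho_mu_even (s : 'S_n) i j l : ~~ odd_perm s -> l \in L -> rho s (mu i j l) = mu (s i) (s j) l.
Proof. by move=> evs Ll; rewrite rho_mu ?even_mem // (negPf evs) andbF. Qed.

(** The coordinates add up to 0, so the base [z] does not matter ([cover_base]); equivariance rests
    on this. *)
Definition cover (t : std n (subZ L)) : A := \sum_i mu i z (val (coord i t)).

Lemma coord_mem i (t : std n (subZ L)) : val (coord i t) \in L.
Proof. exact: valP. Qed.

Lemma cover_is_zmod_morphism : zmod_morphism cover.
Proof.
move=> t t'; rewrite /cover -sumrB; apply: eq_bigr => i _.
by rewrite coord_is_zmod_morphism GRing.valB (arB (ar_mu _ _)) ?coord_mem.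
Qed.

Lemma cover_mem t : cover t \in V.
Proof. by apply: rpred_sum => i _; apply: ar_mem (ar_mu i z) _ (coord_mem _ _). Qed.

Lemma cover_base z' t : cover t = \sum_i mu i z' (val (coord i t)).
Proof.
rewrite (mu_sum_base ar_mu mu_cocycle z z') => [|i]; last exact: coord_mem.
by rewrite -raddf_sum sum_coord raddf0 (ar0 (ar_mu z z')) addr0.
Qed.

Lemma coord_sign_act (s : 'S_n) i t :
  coord (s i) (sign_act b (@std_act n (subZ L)) s t) =
  if b && odd_perm s then - coord i t else coord i t.
Proof.
rewrite /sign_act; case: b => /=; last exact: coord_act.
rewrite /sgn_twist raddfMz /= coord_act; case: (odd_perm s); first by rewrite expr1 mulrN1z.
by rewrite expr0 mulr1z.
Qed.

Lemma cover_equivariant : equivariant G rho (sign_act b (@std_act n (subZ L))) cover.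
Proof.
move=> s Gs t; rewrite (cover_base (s z)) /cover.
rewrite (ar_big_sum _ _ (ar_rho Gs)) => [|i]; last exact: ar_mem (ar_mu i z) _ (coord_mem _ _).
rewrite [LHS](reindex_inj (@perm_inj _ s)); apply: eq_bigr => i _ /=.
by rewrite coord_sign_act rho_mu ?coord_mem //; case: ifP.
Qed.

Lemma cover_onto : onto_V V cover.
Proof.
split=> [t|v /spanV[f [fL ->]]]; first exact: cover_mem.
pose g i : subZ L := insubd 0 (f i).
(* As [mu z z] is 0, the coordinate at [z] is free; it is chosen to make the total 0. *)
pose k i := if i == z then - (\sum_(j | j != z) g j) else g i.
have k0 : \sum_i k i = 0.
  rewrite (bigD1 z) //= {1}/k eqxx; apply/eqP; rewrite addrC addr_eq0 opprK; apply/eqP.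
  by apply: eq_bigr => i /negPf iz; rewrite /k iz.
exists (std_of z k); apply: eq_bigr => i _; rewrite coord_std_of //.
have [->|iz] := eqVneq i z; first by rewrite !mu_diag.
by rewrite /k (negPf iz) insubdK.
Qed.

Lemma cover_compatible : compatible U V cover.
Proof.
move=> c; have arL := mu_id (ar_obl (ar_mu z z)).
have arF i : Ar U L V (fun l => mu i z (l *~ val c 0 i)).
  exact: mu_comp (ar_mulz _ arL) (ar_mu i z).
apply: mu_ext (ar_sum (index_enum 'I_n) (ar_mu z z) arF) => l Ll.
by apply: eq_bigr => i _; rewrite coord_tens raddfMz -[in LHS](insubdK (0 : subZ L) Ll).
Qed.

(** Any two coordinates can be compared by [mu_sum_const] after moving the base away from both. *)
Lemma cover_eq0 t : cover t = 0 <->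
  exists2 l, l \in kernel L mu z & forall i, val (coord i t) = l.
Proof.
have tL i := coord_mem i t.
split=> [t0|[l Kl tl]]; last first.
  have [_ /= <-] := (mem_kernel ar_mu z l).1 Kl.
  by apply: eq_bigr => i _; rewrite tl.
have all i j : val (coord i t) = val (coord j t).
  have [|z'] := @fresh_ord n [:: i; j]; first exact: leq_trans n7.
  rewrite !inE negb_or => /andP[iz jz].
  have tz' : \sum_i mu i z' (val (coord i t)) = 0 by rewrite -cover_base.
  have := mu_sum_const n7 ar_mu mu_diag mu_cocycle mu_inj ar_rho_even rho_mu_even tL tz'.
  by apply; rewrite eq_sym.
exists (val (coord z t)) => //; apply/(mem_kernel ar_mu); split=> //.
by rewrite -[RHS]t0; apply: eq_bigr => i _; rewrite (all z i).
Qed.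

Definition kernel_sub : zmodClosed (subZ L) := gensub (fun l => val l \in kernel L mu z).

Lemma mem_kernel_sub l : l \in kernel_sub <-> val l \in kernel L mu z.
Proof. by apply: gensubE => [|l1 l2 *]; rewrite ?rpred0 // GRing.valB rpredB. Qed.

Lemma kernel_sub_Omega : {subset kernel_sub <= Omega n (subZ L)}.
Proof.
move=> l /mem_kernel_sub Kl; apply/eqP/val_inj; rewrite raddfMn.
exact: (kernel_torsion n7 ar_mu mu_cocycle mu_inj ar_rho_even rho_mu_even Kl).
Qed.

Definition std_generator : subZ (stdZ n) := Sub (std_vector n) (std_vector_stdZ n).

Lemma coord_generator (l : subZ L) i : l \in kernel_sub -> coord i (tens std_generator l) = l.
Proof.
move=> /kernel_sub_Omega/eqP nl; rewrite coord_tens /= std_vectorE mulrzBr mulr1z.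
by case: eqP => _; rewrite ?mulr1n -?pmulrn ?nl ?mulr0z subr0.
Qed.

Lemma cover_kernel t : cover t = 0 <-> t \in tensub (std_line n) kernel_sub.
Proof.
split=> [/cover_eq0[l Kl tl]|].
  have Ll : l \in L by have [] := (mem_kernel ar_mu z l).1 Kl.
  have Kl' : insubd 0 l \in kernel_sub by apply/mem_kernel_sub; rewrite insubdK.
  have -> : t = tens std_generator (insubd 0 l).
    apply: coord_inj => [|i]; first exact: leq_trans n7.
    by apply: val_inj; rewrite coord_generator // tl insubdK.
  apply: mem_gensub; exists std_generator, (insubd 0 l); split=> //.
  exact: mem_gensub.
pose S : pred (std n (subZ L)) := [pred u | cover u == 0].
have cB := cover_is_zmod_morphism.
have SP : zmod_closed S.
  split=> [|u v]; rewrite !inE; last by move=> /eqP fu /eqP fv; rewrite cB fu fv subrr.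
  by rewrite -(subrr (0 : std n (subZ L))) cB subrr.
move=> /asboolP/(_ (mksub SP)) St; apply/eqP; apply: St => _ [c [l [cS Kl ->]]].
pose T : pred (subZ (stdZ n)) := [pred u | cover (tens u l) == 0].
have TP : zmod_closed T.
  split=> [|u v]; rewrite !inE.
    by rewrite -[tens _ _]/(tensl l 0) raddf0; case: SP.
  rewrite -![tens _ l]/(tensl l _) raddfB => *.
  by case: SP => _; apply.
move/asboolP: cS => /(_ (mksub TP)); apply=> v vE.
have -> : v = std_generator by apply: val_inj.
apply/eqP/cover_eq0; exists (val l) => [|i]; first exact/mem_kernel_sub.
by rewrite coord_generator.
Qed.

Section Quotient.
Hypothesis torsion_kernel : forall l, l \in L -> l *+ n = 0 -> l \in kernel L mu z.

(** Fixed elements are the constant tuples; since their coordinates add up to 0, the value is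
    n-torsion and so in the kernel by hypothesis. *)
Lemma cover_fix t : cover t = 0 <-> t \in std_fix n (subZ L).
Proof.
have n0 : (0 < n)%N by exact: leq_trans n7.
rewrite cover_eq0 (mem_std_fix t n0); split=> [[l _ tl] i j|eqc].
  by apply: val_inj; rewrite !tl.
exists (val (coord z t)) => [|i]; last by rewrite (eqc i z).
apply: torsion_kernel; first exact: coord_mem.
have e : coord z t *+ n = 0.
  by rewrite -[RHS](sum_coord t) (eq_bigr (fun=> coord z t)) // sumr_const card_ord.
by rewrite -raddfMn e.
Qed.

Definition quotient_cover (y : stdbar n (subZ L)) : A := cover (repr y).

Lemma quotient_cover_pi t : quotient_cover (\pi_(stdbar n (subZ L)) t) = cover t.
Proof.
apply/eqP; rewrite -subr_eq0 -cover_is_zmod_morphism; apply/eqP/cover_fix.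
by rewrite Quotient.idealrBE reprK.
Qed.

Lemma quotient_cover_is_zmod_morphism : zmod_morphism quotient_cover.
Proof.
move=> y y'; rewrite -[y]reprK -[y']reprK -raddfB !quotient_cover_pi.
exact: cover_is_zmod_morphism.
Qed.

Lemma quotient_cover_iso :
  isomorphic_to_stdbar G U V rho (sign_act b (@stdbar_act n (subZ L))).
Proof.
exists (additive_of quotient_cover_is_zmod_morphism); split.
- move=> y y' /= /eqP; rewrite -subr_eq0 -quotient_cover_is_zmod_morphism.
  rewrite -[y - y']reprK quotient_cover_pi => /eqP/cover_fix.
  by move=> /pi_eq0 e; apply/eqP; rewrite -subr_eq0 -[y - y']reprK e.
- have [onV surj] := cover_onto; split=> [y|v /surj[t <-]]; first exact: onV.
  by exists (\pi_(stdbar n (subZ L)) t); rewrite /= quotient_cover_pi.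
- move=> s Gs y /=; rewrite -[y]reprK; move: (repr y) => t.
  rewrite (quotient_cover_pi t) -cover_equivariant // -quotient_cover_pi.
  congr quotient_cover; rewrite /sign_act; case: b; last exact: stdbar_act_pi.
  by rewrite /sgn_twist raddfMz stdbar_act_pi.
move=> c; apply: mu_ext (cover_compatible c) => l _ /=.
by rewrite quotient_cover_pi.
Qed.

End Quotient.

End Cover.

(** * Recognition of the irreducible module *)

Section Recognition.
Variables (n d q : nat) (G : {group 'S_n}) (U : modular_universe) (dim : additive_dimension U).
Variables (A : zmodType) (V : zmodClosed A) (rho : 'S_n -> A -> A).
Hypothesis hG : G = ('Alt_('I_n))%g :> {set 'S_n} \/ G = ('Sym_('I_n))%g :> {set 'S_n}.
Hypothesis hV : Mod dim G V rho d q.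
Hypothesis hfaithful : faithful_Gmodule G V rho.
Hypothesis hirr : dc_irreducible dim G V rho.
Hypotheses (ltdn : (d < n)%N) (n7 : (7 <= n)%N).
Hypothesis n10 : G = ('Alt_('I_n))%g :> {set 'S_n} -> q = 2%N -> (10 <= n)%N.
Variable x : nat -> 'I_n.
Hypothesis px : points 7 [set: 'I_n] x.

Let gm := Mod_gmod hV.
Let obV := gmod_ob gm.
Let ar_rho s (Gs : s \in G) := gmod_ar gm Gs.
Let L := line V rho x.
Let mu := pair_map rho x.
Let tw := line_twist rho x.
Let z := x 0.

Let even_mem s (ev : ~~ odd_perm s) : s \in G := mem_G_even hG ev.
Let ar_rho_even s (ev : ~~ odd_perm s) : Ar U V V (rho s) := ar_rho (even_mem ev).
Let obL : Ob U L := ob_line hG hV px.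
Let LV : {subset L <= V} := line_sub hG hV px.
Let dcL : dim_connected dim L := dc_line hG hV px.
Let ar_mu i j : Ar U L V (mu i j) := ar_pair_map hG hV px i j.
Let mu_diag i l : mu i i l = 0 := pair_map_diag rho x i l.
Let mu_cocycle i j k l (Ll : l \in L) : mu i j l + mu j k l = mu i k l :=
  pair_map_cocycle hG hV ltdn n7 n10 px i j k Ll.
Let mu_inj i j l (ij : i != j) (Ll : l \in L) (l0 : mu i j l = 0) : l = 0 :=
  pair_map_inj hG hV px ij Ll l0.
Let rho_mu_tw s i j l (Gs : s \in G) (Ll : l \in L) :
  rho s (mu i j l) = mu (s i) (s j) (tw s l) := rho_pair_map hG hV ltdn n7 n10 px i j Gs Ll.
Let rho_mu_even (s : 'S_n) i j l (ev : ~~ odd_perm s) (Ll : l \in L) :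
  rho s (mu i j l) = mu (s i) (s j) l := rho_pair_map_even hG hV ltdn n7 n10 px i j ev Ll.
Let twE s s' l : odd_perm s = odd_perm s' -> tw s l = tw s' l.
Proof. by rewrite /tw /line_twist => ->. Qed.
Let tw_even s l : ~~ odd_perm s -> tw s l = l.
Proof. by rewrite /tw /line_twist => /negPf->. Qed.

(** Stability under the twist makes the span [G]-stable, as a permutation only relabels the
    translates and moves the base; then dc-irreducibility decides. *)
Lemma spans_stable (L' : zmodClosed A) : Ob U L' -> {subset L' <= L} ->
  dim_connected dim L' -> (forall s l, s \in G -> l \in L' -> tw s l \in L') ->
  (forall y, spans mu L' z y -> y = 0) \/ (forall y, y \in V -> spans mu L' z y).
Proof.
move=> obL' L'L dcL' twL'.
have [W [sW dcW memW]] := spans_submodule n7 ar_mu obL' L'L dcL' z.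
have stW : Gstable G rho W.
  move=> s Gs y /memW[f [fL ->]]; apply/memW.
  apply: (spans_base ar_mu mu_diag mu_cocycle obL' L'L z (z' := s z)).
  exists (fun i => tw s (f (s^-1%g i))); split=> [i|]; first exact: twL'.
  rewrite (ar_big_sum _ _ (ar_rho Gs)) => [|i]; last first.
    by apply: ar_mem (ar_mu i z) _ _; apply: L'L.
  rewrite [RHS](reindex_inj (@perm_inj _ s)); apply: eq_bigr => i _.
  by rewrite permK rho_mu_tw //; apply: L'L.
have [W0|WV] := hirr sW stW dcW; [left=> y /memW|right=> y /WV/memW //].
exact: W0.
Qed.

Lemma spans_single (L' : zmodClosed A) i l : {subset L' <= L} -> l \in L' ->
  spans mu L' z (mu i z l).
Proof.
move=> L'L Ll; exists (fun j => if j == i then l else 0); split=> [j|].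
  by case: ifP => // _; rewrite rpred0.
rewrite (bigD1 i) //= eqxx big1 ?addr0 // => j /negPf->.
exact: ar0 (ar_mu j z).
Qed.

Lemma line_spans y : y \in V -> spans mu L z y.
Proof.
have [l Ll l0] := line_neq0 hG hV px hfaithful.
have twL s l' : s \in G -> l' \in L -> tw s l' \in L.
  by move=> Gs; apply: (line_twist_mem hG hV px Gs).
have [span0|//] := spans_stable obL (fun _ H => H) dcL twL; last exact.
have [|i] := @fresh_ord n [:: z]; first exact: leq_trans n7.
rewrite inE => iz; case/eqP: l0; apply: (mu_inj iz Ll); apply: span0.
exact: spans_single.
Qed.

(** The twist of an odd element is an involution on [L] and fixes P = (1 + tw) L pointwise. By
    [spans_stable], [P] spans 0, so that the twist is -1, or it spans [V], and then P = L and the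
    twist is 1. *)
Lemma line_twist_sign : exists b : bool, forall s l, s \in G -> l \in L ->
  tw s l = if b && odd_perm s then - l else l.
Proof.
have [[s0 Gs0 os0]|noodd] := pselect (exists2 s, s \in G & odd_perm s); last first.
  exists false => s l Gs Ll /=; rewrite tw_even //.
  by apply/negP => os; apply: noodd; exists s.
have ar_tw := ar_line_twist hG hV px Gs0; rewrite -/L -/tw in ar_tw.
have ar_plus : Ar U L L (fun l => l + tw s0 l) by apply: ar_add (mu_id obL) ar_tw.
have twK l : l \in L -> tw s0 (tw s0 l) = l by apply: (line_twistK hG hV px Gs0).
have Ltw l : l \in L -> tw s0 l \in L by apply: (line_twist_mem hG hV px Gs0).
pose P := imsub L (fun l => l + tw s0 l).
have PL : {subset P <= L} := imsub_sub ar_plus.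
have Pfix l : l \in P -> tw s0 l = l.
  move=> /(mem_imsub ar_plus)[k Lk ->].
  by rewrite (arD ar_tw) ?Ltw // twK // addrC.
have twP s l : s \in G -> l \in P -> tw s l \in P.
  move=> Gs Pl; have [os|evs] := boolP (odd_perm s); last by rewrite tw_even.
  by rewrite (@twE s s0) ?os // Pfix.
have dcP : dim_connected dim P := dc_im ar_plus dcL.
have [P0|PV] := spans_stable (ob_imsub ar_plus) PL dcP twP.
  exists true => s l Gs Ll /=; have [os|evs] := boolP (odd_perm s); last exact: tw_even.
  rewrite (@twE s s0) ?os //; apply/eqP; rewrite -addr_eq0 addrC; apply/eqP.
  have [|i] := @fresh_ord n [:: z]; first exact: leq_trans n7.
  rewrite inE => iz; apply: (mu_inj iz); first by rewrite rpredD ?Ltw.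
  by apply: P0; apply: spans_single => //; apply/(mem_imsub ar_plus); exists l.
exists false => s l Gs Ll /=; have [os|evs] := boolP (odd_perm s); last exact: tw_even.
have [|i] := @fresh_ord n [:: z]; first exact: leq_trans n7.
rewrite inE => iz; have [|j] := @fresh_ord n [:: z; i]; first exact: leq_trans n7.
rewrite !inE negb_or => /andP[jz ji].
(* Express [mu i z l] with coefficients in [P] and compare the coefficients at [i] and [j]:
   constancy gives l = f i - f j. *)
have [|f [fP fE]] := PV (mu i z l); first exact: ar_mem (ar_mu i z) _ Ll.
pose g k := f k - (if k == i then l else 0).
have dL k : (if k == i then l else 0) \in L by case: ifP => // _; rewrite rpred0.
have gL k : g k \in L by rewrite rpredB ?dL ?(PL _ (fP k)).
have g0 : \sum_k mu k z (g k) = 0.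
  rewrite (eq_bigr (fun k => mu k z (f k) - mu k z (if k == i then l else 0))); last first.
    by move=> k _; rewrite (arB (ar_mu _ _)) ?dL ?(PL _ (fP k)).
  rewrite sumrB -fE (bigD1 i) //= eqxx big1 ?addr0 ?subrr // => k /negPf->.
  exact: ar0 (ar_mu k z).
have := mu_sum_const n7 ar_mu mu_diag mu_cocycle mu_inj ar_rho_even rho_mu_even gL g0 iz jz.
rewrite /g eqxx (negPf ji) subr0 => e.
have lE : l = f i - f j by rewrite -e subKr.
by rewrite (@twE s s0) ?os //; apply: Pfix; rewrite lE rpredB.
Qed.

(** The kernel lies in [L], so d is at least (n - 2) dim L; if dim L were 2 or more, d would be at
    least 2n - 4, hence at least n. *)
Lemma dim_line_kernel : dim A L = 1%N /\ (d + dim A (kernel L mu z) = n.-1)%N.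
Proof.
have spanV z' y : y \in V -> spans mu L z' y.
  by move=> /line_spans; apply: (spans_base ar_mu mu_diag mu_cocycle obL (fun _ H => H)).
have := dim_family n7 ar_mu mu_diag mu_cocycle mu_inj ar_rho_even rho_mu_even spanV dcL z.
rewrite (Mod_dim hV) => dimE.
have leK : (dim A (kernel L mu z) <= dim A L)%N.
  apply: dim_le => [|//|l /(mem_kernel ar_mu)[]//].
  exact: ob_kersub (ar_diag_sum ar_mu z).
have L0 : dim A L != 0%N.
  have [l Ll /eqP l0] := line_neq0 hG hV px hfaithful.
  by apply/eqP => /(dc_zero obL dcL)/(_ l Ll).
have L1 : dim A L = 1%N.
  move: dimE leK L0; move: (dim A L) (dim A (kernel L mu z)) => a k dimE leK a0.
  apply/eqP; rewrite eqn_leq lt0n a0 andbT leqNgt; apply/negP => a1.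
  have [m nE] : exists m, n = m.+2 by exists n.-2; lia.
  by move: dimE ltdn n7; rewrite nE /=; nia.
by split=> //; move: dimE; rewrite L1 muln1.
Qed.

(* Sum_i mu i z (L) is a submodule of points fixed by the alternating group. *)
Lemma torsion_kernel : (forall l, l \in L -> l *+ n = 0) -> {subset L <= kernel L mu z}.
Proof.
move=> nL; have arS := ar_diag_sum ar_mu z.
set S := fun l => _ in arS; pose W := imsub L S.
have act s l : s \in G -> l \in L -> rho s (S l) = S (tw s l).
  move=> Gs Ll; have Lt : tw s l \in L by apply: (line_twist_mem hG hV px Gs).
  rewrite (ar_big_sum _ _ (ar_rho Gs)) => [|i]; last exact: ar_mem (ar_mu i z) _ Ll.
  under eq_bigr do rewrite rho_mu_tw //.
  transitivity (\sum_i mu i (s z) (tw s l)); first by rewrite [RHS](reindex_inj (@perm_inj _ s)).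
  rewrite (mu_sum_base ar_mu mu_cocycle z (s z)) // sumr_const card_ord nL //.
  by rewrite (ar0 (ar_mu _ _)) addr0.
have stW : Gstable G rho W.
  move=> s Gs _ /(mem_imsub arS)[l Ll ->]; rewrite act //.
  by apply/(mem_imsub arS); exists (tw s l) => //; apply: (line_twist_mem hG hV px Gs).
have sW : submodule U V W by split; [exact: ob_imsub arS|exact: imsub_sub arS].
have [W0|VW] := hirr sW stW (dc_im arS dcL).
  move=> l Ll; apply/(mem_kernel ar_mu); split=> //.
  by apply: W0; apply/(mem_imsub arS); exists l.
(* If [W] were all of [V], this 3-cycle would act trivially, against faithfulness. *)
have evc : ~~ odd_perm (cyc (x 0) (x 1) (x 2)) by apply: odd_cyc; apply: (xneq px).
have c1 : cyc (x 0) (x 1) (x 2) = 1%g.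
  apply: hfaithful; first exact: even_mem.
  by move=> v /VW/(mem_imsub arS)[l Ll ->]; rewrite act ?tw_even ?even_mem.
have [c0 _ _] := cyc_x px (isT : [&& 0 < 7, 1 < 7, 2 < 7, 0 != 1, 0 != 2 & 1 != 2]%N).
have := xneq px (isT : [&& 0 < 7, 1 < 7 & 0 != 1]%N).
by rewrite -c0 c1 perm1 eqxx.
Qed.

(** [L] is an image of the divisible [V], so multiplication by n is onto [L]; its kernel has
    dimension 0 and contains the n-torsion [kernel]. *)
Lemma dim_kernel0 : q = 0%N -> dim A (kernel L mu z) = 0%N.
Proof.
move=> q0; have := Mod_char hV; rewrite /has_characteristic q0 /= => divV.
have arn : Ar U L L (fun l => l *~ n) := mu_mulz n obL.
have n0 : (0 < n)%N by apply: leq_trans n7.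
have im : is_image L (fun l => l *~ n) L.
  move=> l; split=> [|[k Lk ->]]; last by rewrite rpredMz.
  move=> /(mem_line hG hV px)[v Vv ->]; have [w Vw <-] := divV n n0 v Vv.
  exists (line_map rho x w); first by apply/(mem_line hG hV px); exists w.
  rewrite -pmulrn; have arl := ar_line_map hG hV px.
  have lineMn m : line_map rho x (w *+ m) = line_map rho x w *+ m.
    elim: m => [|m IH]; first by rewrite !mulr0n (ar0 arl).
    by rewrite !mulrS (arD arl) ?IH // rpredMn.
  exact: lineMn.
have := dimension_additive dim arn (kersubP arn) im.
have obK := ob_kersub (ar_diag_sum ar_mu z).
have : (dim A (kernel L mu z) <= dim A (kersub L (fun l => l *~ n)))%N.
  apply: dim_le obK (ob_kersub arn) _ => l Kl; apply/(mem_kersub arn).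
  have [Ll _] := (mem_kernel ar_mu z l).1 Kl; split=> //; rewrite -pmulrn.
  exact: (kernel_torsion n7 ar_mu mu_cocycle mu_inj ar_rho_even rho_mu_even Kl).
by move: (dim A (kernel L mu z)) (dim A (kersub L _)) (dim A L) => *; lia.
Qed.

Lemma recognition : exists L : zmodClosed A,
    [/\ submodule U V L, dim_connected dim L
      & [\/ [/\ (0 < q)%N, (q %| n)%N, d = (n - 2)%N
              & isomorphic_to_stdbar G U V rho
                  (@stdbar_act n (subZ L))
                \/ isomorphic_to_stdbar G U V rho
                  (sgn_twist (@stdbar_act n (subZ L)))],
            [/\ (0 < q)%N, ~~ (q %| n)%N, d = (n - 1)%N
              & isomorphic_to_stdbar G U V rho
                  (@stdbar_act n (subZ L))
                \/ isomorphic_to_stdbar G U V rho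
                  (sgn_twist (@stdbar_act n (subZ L)))]
          | [/\ q = 0%N, d = (n - 1)%N
              & exists2 phi : {additive std n (subZ L) -> A},
                  covered_by_std G U V rho (@std_act n (subZ L)) phi
                  \/ covered_by_std G U V rho
                       (sgn_twist (@std_act n (subZ L))) phi
                & exists2 K : zmodClosed (subZ L),
                    {subset K <= Omega n (subZ L)}
                    & forall t, phi t = 0 <-> t \in tensub (std_line n) K]]].
Proof.
exists L; split; [by split|exact: dcL|].
have [b twb] := line_twist_sign.
have rho_mu (s : 'S_n) i j l : s \in G -> l \in L ->
    rho s (mu i j l) = mu (s i) (s j) (if b && odd_perm s then - l else l).
  by move=> Gs Ll; rewrite rho_mu_tw // twb.
have [L1 dE] := dim_line_kernel; have ch := Mod_char hV.
have iso (tk : forall l, l \in L -> l *+ n = 0 -> l \in kernel L mu z) :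
    isomorphic_to_stdbar G U V rho (@stdbar_act n (subZ L)) \/
    isomorphic_to_stdbar G U V rho (sgn_twist (@stdbar_act n (subZ L))).
  have := quotient_cover_iso n7 ar_mu mu_diag mu_cocycle mu_inj even_mem ar_rho rho_mu
    line_spans tk.
  by rewrite /sign_act; case: (b); [right|left].
have [q0|qn0] := eqVneq q 0%N.
  constructor 3; split=> //; first by move: dE; rewrite dim_kernel0 // addn0 subn1.
  exists (additive_of (cover_is_zmod_morphism z ar_mu)).
    suff : covered_by_std G U V rho (sign_act b (@std_act n (subZ L)))
        (additive_of (cover_is_zmod_morphism z ar_mu)).
      by rewrite /sign_act; case: (b); [right|left].
    split; first exact: (cover_onto ar_mu mu_diag line_spans).
      exact: (cover_equivariant z ar_mu mu_cocycle ar_rho rho_mu).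
    exact: (cover_compatible z ar_mu).
  exists (kernel_sub L mu z).
    exact: (kernel_sub_Omega n7 ar_mu mu_cocycle mu_inj even_mem ar_rho rho_mu).
  exact: (cover_kernel z n7 ar_mu mu_diag mu_cocycle mu_inj even_mem ar_rho rho_mu).
move: ch; rewrite /has_characteristic (negPf qn0) => -[prq _ qV].
have q_gt0 : (0 < q)%N by rewrite lt0n.
have obK := ob_kersub (ar_diag_sum ar_mu z).
have [qn|nqn] := boolP (q %| n)%N.
  have nL l : l \in L -> l *+ n = 0.
    by move=> Ll; case/dvdnP: qn => m ->; rewrite mulnC mulrnA qV ?mul0rn ?LV.
  have LK := torsion_kernel nL.
  constructor 1; split=> //; last by apply: iso => l Ll _; apply: LK.
  have dK : dim A (kernel L mu z) = 1%N.
    rewrite -L1; apply: dim_eq => // l; apply/idP/idP => [/(mem_kernel ar_mu)[]//|]; exact: LK.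
  by move: dE; rewrite dK; lia.
have L_tors l : l \in L -> l *+ n = 0 -> l = 0.
  move=> Ll ln; have cop : coprime n q by rewrite coprime_sym prime_coprime.
  have n_gt0 : (0 < n)%N by apply: leq_trans n7.
  have [km kn] := egcdnP q n_gt0; rewrite (eqP cop) => e _.
  have : l *+ (km * n) = l by rewrite e mulrnDr mulnC mulrnA qV ?LV // mul0rn add0r.
  by rewrite mulnC mulrnA ln mul0rn => ->.
constructor 2; split=> //; last first.
  by apply: iso => l Ll /(L_tors l Ll)->; rewrite rpred0.
have dK : dim A (kernel L mu z) = 0%N.
  rewrite (dim_eq dim obK (ob_zero obV)) ?(dim_zero dim obV) // => l.
  apply/idP/idP => [Kl|/mem_zerosub->]; last by rewrite rpred0.
  apply/mem_zerosub/L_tors; first by have [] := (mem_kernel ar_mu z l).1 Kl.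
  exact: (kernel_torsion n7 ar_mu mu_cocycle mu_inj ar_rho_even rho_mu_even Kl).
by move: dE; rewrite dK; lia.
Qed.

End Recognition.

Theorem mainTheorem1 (n d q : nat) (G : {group 'S_n})
    (U : modular_universe) (dim : additive_dimension U)
    (A : zmodType) (V : zmodClosed A) (rho : 'S_n -> A -> A)
    (hG : G = ('Alt_('I_n))%g :> {set 'S_n} \/ G = ('Sym_('I_n))%g :> {set 'S_n})
    (hV : Mod dim G V rho d q)
    (hfaithful : faithful_Gmodule G V rho)
    (hirr : dc_irreducible dim G V rho)
    (hdn : (d < n)%N) (hn7 : (7 <= n)%N)
    (hn10 : G = ('Alt_('I_n))%g :> {set 'S_n} -> q = 2%N -> (10 <= n)%N) :
  exists L : zmodClosed A,
    [/\ submodule U V L, dim_connected dim L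
      & [\/ [/\ (0 < q)%N, (q %| n)%N, d = (n - 2)%N
              & isomorphic_to_stdbar G U V rho
                  (@stdbar_act n (subZ L))
                \/ isomorphic_to_stdbar G U V rho
                  (sgn_twist (@stdbar_act n (subZ L)))],
            [/\ (0 < q)%N, ~~ (q %| n)%N, d = (n - 1)%N
              & isomorphic_to_stdbar G U V rho
                  (@stdbar_act n (subZ L))
                \/ isomorphic_to_stdbar G U V rho
                  (sgn_twist (@stdbar_act n (subZ L)))]
          | [/\ q = 0%N, d = (n - 1)%N
              & exists2 phi : {additive std n (subZ L) -> A},
                  covered_by_std G U V rho (@std_act n (subZ L)) phi
                  \/ covered_by_std G U V rho
                       (sgn_twist (@std_act n (subZ L))) phi
                & exists2 K : zmodClosed (subZ L),
                    {subset K <= Omega n (subZ L)}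
                    & forall t, phi t = 0 <-> t \in tensub (std_line n) K]]].
Proof.
have n0 : (0 < n)%N by apply: leq_trans hn7.
have us : uniq (take 7 (enum 'I_n)) by rewrite take_uniq ?enum_uniq.
have px := uniq_points (Ordinal n0) us; rewrite size_takel ?size_enum_ord // in px.
exact: recognition hG hV hfaithful hirr hdn hn7 hn10 _ px.
Qed.
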